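(* Let $\alpha,\beta\in\mathbb{C}\setminus\{0\}$ with $\alpha\ne\beta$ and $\frac{\alpha\beta}{2}\neq\left(\frac{\alpha+\beta}{3}\right)^2$. Then Vogel's algebra $\mathfrak{V}_3$ over $\mathbb{C}$ has dimension $20$, and, with $K=\mathbb{C}((h))$, there is an isomorphism of $K$-algebras $Q_3\otimes_R K\simeq \mathfrak{V}_3\otimes_{\mathbb{C}} K$, where $R\to K$ is given by $a\mapsto -1$, $b\mapsto e^{h\alpha}$, $c\mapsto e^{h\beta}$.
   Context: Vogel's algebra $\mathfrak{V}_n$ (over $\mathbb{C}$, parameters $\alpha,\beta$) is the algebra generated by the group algebra of the symmetric group $\mathfrak{S}_n$ and elements $t_{ij}=t_{ji}$ ($1\le i\ne j\le n$), with relations: $w t_{ij}w^{-1}=t_{w(i)w(j)}$ for $w\in\mathfrak{S}_n$; $[t_{ij},t_{rs}]=0$ when $i,j,r,s$ are distinct; $[t_{ij},t_{ik}+t_{kj}]=0$ for $i,j,k$ distinct; $t_{ij}(i\ j)=(i\ j)t_{ij}=t_{ij}$; and $t_{ij}^2-(\alpha+\beta)t_{ij}+\frac{\alpha\beta}{2}(1+(i\ j))=0$. $R=\mathbb{Z}[a^{\pm1},b^{\pm1},c^{\pm1}]$, and $Q_3$ is the quotient of the group algebra $RB_3$ of the braid group $B_3$ (Artin generators $s_1,s_2$) by the relations $(s_1-a)(s_1-b)(s_1-c)=0$ and $$s_1^{-1}s_2s_1 = s_1 s_2 s_1^{-1} - a^{-1} s_1 s_2 + a s_1 s_2^{-1}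 + a s_1^{-1}s_2 - a^3 s_1^{-1} s_2^{-1}+ a^{-1} s_2 s_1 - a s_2 s_1^{-1} - a s_2^{-1} s_1 + a^3 s_2^{-1}s_1^{-1} + a^2 s_1^{-1} s_2^{-1} s_1- a^2 s_1 s_2^{-1} s_1^{-1}.$$ *)

(* Defs.v *)
From HB Require Import structures.
From mathcomp Require Import all_boot all_order all_algebra fingroup perm.
From mathcomp Require Import finmap monalg generic_quotient ring_quotient.
From mathcomp Require Import boolp classical_sets functions fsbigop.
From mathcomp Require Import reals complex ring lra.

Set Implicit Arguments.
Unset Strict Implicit.
Unset Printing Implicit Defensive.

Import Order.TTheory GRing.Theory Num.Theory.

Local Open Scope fset_scope.
Local Open Scope ring_scope.

(* The monoid algebra R[M]: finitely supported functions M -> R with the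
   convolution product. The ring structure that the library puts on
   {malg R[M]} excludes the monoids that contain nontrivial units. *)
Definition monoid_algebra (R : comNzRingType) (M : monoidType) :=
  {malg R[M]}.

HB.lock Definition ma_basis (R : comNzRingType) (M : monoidType) (k : M) :
  monoid_algebra R M := << 1 *g k >>.

HB.lock Definition ma_mul (R : comNzRingType) (M : monoidType)
    (g1 g2 : monoid_algebra R M) : monoid_algebra R M :=
  \sum_(k1 <- msupp g1) \sum_(k2 <- msupp g2)
    << g1@_k1 * g2@_k2 *g (k1 * k2)%g >>.

Section MonoidAlgebra.
Variables (R : comNzRingType) (M : monoidType).
Local Notation RM := (monoid_algebra R M).
Implicit Types (g : RM) (k : M).

HB.instance Definition _ := GRing.Lmodule.on RM.

Local Notation ma_basis := (@ma_basis R M).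
Local Notation ma_mul := (@ma_mul R M).

Lemma ma_mulEw (d1 d2 : {fset M}) g1 g2 :
    msupp g1 `<=` d1 -> msupp g2 `<=` d2 ->
  ma_mul g1 g2 = \sum_(k1 <- d1) \sum_(k2 <- d2)
                   << g1@_k1 * g2@_k2 *g (k1 * k2)%g >>.
Proof.
move=> le_d1 le_d2; rewrite ma_mul.unlock (big_fset_incl _ le_d1) /=.
  apply/eq_bigr=> k1 _; apply/big_fset_incl => // k _ /mcoeff_outdom ->.
  by rewrite mulr0 monalgU0.
move=> k _ /mcoeff_outdom g1k.
by rewrite big1 => // k' _; rewrite g1k mul0r monalgU0.
Qed.

Lemma ma_mulUU (c1 c2 : R) (k1 k2 : M) :
  ma_mul << c1 *g k1 >> << c2 *g k2 >> = << c1 * c2 *g (k1 * k2)%g >>.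
Proof. by rewrite (ma_mulEw msuppU_le msuppU_le) !big_seq_fset1 !mcoeffUU. Qed.

Lemma ma_mulDl : left_distributive ma_mul +%R.
Proof.
move=> g1 g2 g; have F := fsubset_refl.
rewrite (ma_mulEw (msuppD_le g1 g2) (F _ _)).
rewrite (ma_mulEw (fsubsetUl _ (msupp g2)) (F _ (msupp g))).
rewrite (ma_mulEw (fsubsetUr (msupp g1) _) (F _ (msupp g))).
rewrite -big_split /=; apply/eq_bigr=> k1 _.
rewrite -big_split /=; apply/eq_bigr=> k2 _.
by rewrite mcoeffD mulrDl monalgUD.
Qed.

Lemma ma_mulDr : right_distributive ma_mul +%R.
Proof.
move=> g g1 g2; have F := fsubset_refl.
rewrite (ma_mulEw (F _ _) (msuppD_le g1 g2)).
rewrite (ma_mulEw (F _ (msupp g)) (fsubsetUl _ (msupp g2))).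
rewrite (ma_mulEw (F _ (msupp g)) (fsubsetUr (msupp g1) _)).
rewrite -big_split /=; apply/eq_bigr=> k1 _.
rewrite -big_split /=; apply/eq_bigr=> k2 _.
by rewrite mcoeffD mulrDr monalgUD.
Qed.

Lemma ma_mul0l : left_zero 0 ma_mul.
Proof. by move=> g; rewrite ma_mul.unlock msupp0 big_seq_fset0. Qed.

Lemma ma_mul0r : right_zero 0 ma_mul.
Proof.
by move=> g; rewrite ma_mul.unlock big1 // => k _; rewrite msupp0 big_seq_fset0.
Qed.

Lemma ma_ind (P : RM -> Prop) :
    P 0 -> (forall g1 g2, P g1 -> P g2 -> P (g1 + g2)) ->
  (forall c k, P << c *g k >>) -> forall g, P g.
Proof. by move=> P0 PD PU g; rewrite (monalgE g); apply: big_ind. Qed.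

Lemma ma_mulA : associative ma_mul.
Proof.
move=> g1 g2 g3.
elim/ma_ind: g1 => [|x y Hx Hy|c1 k1]; rewrite ?ma_mul0l ?ma_mulDl ?Hx ?Hy //.
elim/ma_ind: g2 => [|x y Hx Hy|c2 k2].
- by rewrite !(ma_mul0l, ma_mul0r).
- by rewrite !(ma_mulDl, ma_mulDr) Hx Hy.
elim/ma_ind: g3 => [|x y Hx Hy|c3 k3].
- by rewrite !ma_mul0r.
- by rewrite !ma_mulDr Hx Hy.
by rewrite !ma_mulUU mulrA mulgA.
Qed.

Lemma ma_mul1l : left_id (ma_basis 1%g) ma_mul.
Proof.
elim/ma_ind => [|x y Hx Hy|c k]; first exact: ma_mul0r.
  by rewrite ma_mulDr Hx Hy.
by rewrite ma_basis.unlock ma_mulUU mul1r mul1g.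
Qed.

Lemma ma_mul1r : right_id (ma_basis 1%g) ma_mul.
Proof.
elim/ma_ind => [|x y Hx Hy|c k]; first exact: ma_mul0l.
  by rewrite ma_mulDl Hx Hy.
by rewrite ma_basis.unlock ma_mulUU mulr1 mulg1.
Qed.

Lemma ma_mulC : (forall k l : M, (k * l)%g = (l * k)%g) -> commutative ma_mul.
Proof.
move=> mulMC g1 g2.
elim/ma_ind: g1 => [|x y Hx Hy|c1 k1]; first by rewrite ma_mul0l ma_mul0r.
  by rewrite ma_mulDl ma_mulDr Hx Hy.
elim/ma_ind: g2 => [|x y Hx Hy|c2 k2]; first by rewrite ma_mul0l ma_mul0r.
  by rewrite ma_mulDl ma_mulDr Hx Hy.
by rewrite !ma_mulUU mulrC mulMC.
Qed.

Lemma ma_one_neq0 : ma_basis 1%g != 0.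
Proof. by rewrite ma_basis.unlock monalgU_eq0 oner_eq0. Qed.

HB.instance Definition _ := GRing.Zmodule_isNzRing.Build RM
  ma_mulA ma_mul1l ma_mul1r ma_mulDl ma_mulDr ma_one_neq0.

Lemma ma_scaleU (c d : R) (k : M) :
  c *: (<< d *g k >> : RM) = << c * d *g k >>.
Proof. by apply/malgP => l; rewrite mcoeffZ !mcoeffU mulrnAr. Qed.

Lemma ma_scalerAl (c : R) g1 g2 : c *: (g1 * g2) = (c *: g1) * g2.
Proof.
elim/ma_ind: g1 => [|x y Hx Hy|c1 k1]; first by rewrite !(mul0r, scaler0).
  by rewrite mulrDl !scalerDr Hx Hy mulrDl.
elim/ma_ind: g2 => [|x y Hx Hy|c2 k2]; first by rewrite !(mulr0, scaler0).
  by rewrite mulrDr !scalerDr Hx Hy mulrDr.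
by rewrite /GRing.mul /= ma_scaleU !ma_mulUU ma_scaleU mulrA.
Qed.

Lemma ma_scalerAr (c : R) g1 g2 : c *: (g1 * g2) = g1 * (c *: g2).
Proof.
elim/ma_ind: g1 => [|x y Hx Hy|c1 k1]; first by rewrite !(mul0r, scaler0).
  by rewrite mulrDl !scalerDr Hx Hy mulrDl.
elim/ma_ind: g2 => [|x y Hx Hy|c2 k2]; first by rewrite !(mulr0, scaler0).
  by rewrite mulrDr !scalerDr Hx Hy mulrDr.
by rewrite /GRing.mul /= ma_scaleU !ma_mulUU ma_scaleU mulrCA.
Qed.

HB.instance Definition _ := GRing.Lmodule_isLalgebra.Build R RM ma_scalerAl.
HB.instance Definition _ := GRing.Lalgebra_isAlgebra.Build R RM ma_scalerAr.

End MonoidAlgebra.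

Section MonoidAlgebraEval.
Variables (R : comNzRingType) (M : monoidType) (S : comNzRingType).
Variables (f : {rmorphism R -> S}) (h : M -> S).
Hypothesis h1 : h 1%g = 1.
Hypothesis hM : forall k l : M, h (k * l)%g = h k * h l.

Definition ma_eval (g : monoid_algebra R M) : S := mmap f h g.

Lemma ma_evalB : zmod_morphism ma_eval.
Proof. exact: mmap_is_additive. Qed.

Lemma ma_evalU (c : R) (k : M) : ma_eval << c *g k >> = f c * h k.
Proof. exact: mmapU. Qed.

HB.instance Definition _ :=
  GRing.isZmodMorphism.Build (monoid_algebra R M) S ma_eval ma_evalB.

Lemma ma_eval_basis (k : M) : ma_eval (ma_basis R k) = h k.
Proof. by rewrite ma_basis.unlock ma_evalU rmorph1 mul1r. Qed.

Lemma ma_eval_monoid_morphism : monoid_morphism ma_eval.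
Proof.
split=> [|g1 g2]; first by rewrite ma_eval_basis.
elim/ma_ind: g1 => [|x y Hx Hy|c1 k1]; first by rewrite !(mul0r, raddf0).
  by rewrite mulrDl !raddfD /= Hx Hy mulrDl.
elim/ma_ind: g2 => [|x y Hx Hy|c2 k2]; first by rewrite !(mulr0, raddf0).
  by rewrite mulrDr !raddfD /= Hx Hy mulrDr.
by rewrite /GRing.mul /= ma_mulUU !ma_evalU rmorphM hM mulrACA.
Qed.

End MonoidAlgebraEval.

Definition free_monoid (X : choiceType) := seq X.

HB.instance Definition _ (X : choiceType) := Choice.on (free_monoid X).
HB.instance Definition _ (X : choiceType) := isMonoid.Build (free_monoid X)
  (@catA X) (@cat0s X) (@cats0 X).

Section FreeAlgebra.
Variables (R : comNzRingType) (X : choiceType).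

Definition free_algebra := monoid_algebra R (free_monoid X).

HB.instance Definition _ := GRing.Algebra.on free_algebra.

Definition free_gen (x : X) : free_algebra :=
  ma_basis R ([:: x] : free_monoid X).

Section Eval.
Variables (S : comNzRingType) (f : {rmorphism R -> S}) (v : X -> S).

Definition free_eval (p : free_algebra) : S :=
  ma_eval f (fun w : free_monoid X => \prod_(x <- w) v x) p.

Lemma free_evalB : zmod_morphism free_eval.
Proof. exact: ma_evalB. Qed.

Lemma free_eval_monoid_morphism : monoid_morphism free_eval.
Proof.
apply: ma_eval_monoid_morphism => [|k l]; first exact: big_nil.
exact: big_cat.
Qed.

HB.instance Definition _ :=
  GRing.isZmodMorphism.Build free_algebra S free_eval free_evalB.
HB.instance Definition _ :=
  GRing.isMonoidMorphism.Build free_algebra S free_eval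
    free_eval_monoid_morphism.

Lemma free_eval_gen (x : X) : free_eval (free_gen x) = v x.
Proof.
by rewrite /free_eval /free_gen ma_eval_basis big_cons big_nil mulr1.
Qed.

Lemma free_evalZ (c : R) (p : free_algebra) :
  free_eval (c *: p) = f c * free_eval p.
Proof.
rewrite -[p]mul1r scalerAl !rmorphM rmorph1 mul1r; congr (_ * _).
rewrite [1 in LHS]/GRing.one /= ma_basis.unlock ma_scaleU mulr1.
by rewrite /free_eval ma_evalU big_nil mulr1.
Qed.

End Eval.
End FreeAlgebra.

Section QuotientAlgebra.
Variables (R : comNzRingType) (A : algType R) (rel : A -> A -> Prop).

Inductive generated_ideal : A -> Prop :=
| ideal_rel x y of rel x y : generated_ideal (x - y)
| ideal0 : generated_ideal 0
| idealB x y of generated_ideal x & generated_ideal y :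
    generated_ideal (x - y)
| idealMl a x of generated_ideal x : generated_ideal (a * x)
| idealMr a x of generated_ideal x : generated_ideal (x * a).

Definition in_generated_ideal : {pred A} := fun x => `[< generated_ideal x >].

Lemma generated_ideal_zmod_closed : zmod_closed in_generated_ideal.
Proof.
split=> [|x y /asboolP Ix /asboolP Iy]; apply/asboolP; first exact: ideal0.
exact: idealB.
Qed.

HB.instance Definition _ :=
  GRing.isZmodClosed.Build A in_generated_ideal generated_ideal_zmod_closed.

Definition quot_alg := Quotient.quot in_generated_ideal.

HB.instance Definition _ := GRing.Zmodule.on quot_alg.

Definition qpi (x : A) : quot_alg := (\pi_quot_alg x)%qT.

Lemma qpiP (x y : A) : qpi x = qpi y <-> generated_ideal (x - y).
Proof.
rewrite /qpi; split => [/eqP|H].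
  by rewrite -Quotient.idealrBE => /asboolP.
by apply/eqP; rewrite -Quotient.idealrBE; apply/asboolP.
Qed.

Lemma qpi_surj (u : quot_alg) : exists x, u = qpi x.
Proof. by exists (repr u); rewrite /qpi reprK. Qed.

Lemma qpiB : zmod_morphism qpi.
Proof. by move=> x y; rewrite /qpi !piE. Qed.

HB.instance Definition _ := GRing.isZmodMorphism.Build A quot_alg qpi qpiB.

Definition qmul (u v : quot_alg) : quot_alg := qpi (repr u * repr v).
Definition qscale (k : R) (u : quot_alg) : quot_alg := qpi (k *: repr u).

Lemma qpi_repr u : qpi (repr u) = u.
Proof. exact: reprK. Qed.

Lemma qpi_mul (x y : A) : qmul (qpi x) (qpi y) = qpi (x * y).
Proof.
have := qpi_repr (qpi x); have := qpi_repr (qpi y); rewrite /qmul.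
move: (repr _) (repr _) => x' y' /qpiP Iy /qpiP Ix.
apply/qpiP; have -> : x' * y' - x * y = x' * (y' - y) - (x - x') * y.
  by rewrite mulrBr mulrBl opprB addrA subrK.
apply: idealB; first exact: idealMl.
rewrite -opprB -sub0r; apply: idealMr; apply: idealB => //; exact: ideal0.
Qed.

Lemma qpi_scale (k : R) (x : A) : qscale k (qpi x) = qpi (k *: x).
Proof.
have := qpi_repr (qpi x); rewrite /qscale; move: (repr _) => x' /qpiP Ix.
by apply/qpiP; rewrite -scalerBr -[x' - x]mul1r scalerAl; apply: idealMl.
Qed.

Lemma qmulA : associative qmul.
Proof.
move=> u v w; rewrite -(qpi_repr u) -(qpi_repr v) -(qpi_repr w).
by rewrite !qpi_mul mulrA.
Qed.

Lemma qmul1l : left_id (qpi 1) qmul.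
Proof. by move=> u; rewrite -(qpi_repr u) qpi_mul mul1r. Qed.

Lemma qmul1r : right_id (qpi 1) qmul.
Proof. by move=> u; rewrite -(qpi_repr u) qpi_mul mulr1. Qed.

Lemma qmulDl : left_distributive qmul +%R.
Proof.
move=> u v w; rewrite -(qpi_repr u) -(qpi_repr v) -(qpi_repr w).
by rewrite -raddfD !qpi_mul mulrDl raddfD.
Qed.

Lemma qmulDr : right_distributive qmul +%R.
Proof.
move=> u v w; rewrite -(qpi_repr u) -(qpi_repr v) -(qpi_repr w).
by rewrite -raddfD !qpi_mul mulrDr raddfD.
Qed.

HB.instance Definition _ := GRing.Zmodule_isPzRing.Build quot_alg
  qmulA qmul1l qmul1r qmulDl qmulDr.

Lemma qscaleA a b u : qscale a (qscale b u) = qscale (a * b) u.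
Proof. by rewrite -(qpi_repr u) !qpi_scale scalerA. Qed.

Lemma qscale1 : left_id 1 qscale.
Proof. by move=> u; rewrite -(qpi_repr u) qpi_scale scale1r. Qed.

Lemma qscaleDr : right_distributive qscale +%R.
Proof.
move=> k u v; rewrite -(qpi_repr u) -(qpi_repr v).
by rewrite -raddfD !qpi_scale scalerDr raddfD.
Qed.

Lemma qscaleDl u : {morph qscale^~ u : a b / a + b}.
Proof.
by move=> a b; rewrite -(qpi_repr u) !qpi_scale scalerDl raddfD.
Qed.

HB.instance Definition _ := GRing.Zmodule_isLmodule.Build R quot_alg
  qscaleA qscale1 qscaleDr qscaleDl.

Lemma qpiM (x y : A) : qpi (x * y) = qpi x * qpi y.
Proof. exact/esym/qpi_mul. Qed.

Lemma qpiZ (k : R) (x : A) : qpi (k *: x) = k *: qpi x.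
Proof. exact/esym/qpi_scale. Qed.

Lemma quot_scalerAl (k : R) (u v : quot_alg) : k *: (u * v) = (k *: u) * v.
Proof.
rewrite -(qpi_repr u) -(qpi_repr v).
by rewrite -qpiM -!qpiZ -qpiM -scalerAl.
Qed.

Lemma quot_scalerAr (k : R) (u v : quot_alg) : k *: (u * v) = u * (k *: v).
Proof.
rewrite -(qpi_repr u) -(qpi_repr v).
by rewrite -qpiM -!qpiZ -qpiM -scalerAr.
Qed.

Lemma generated_ideal_ker (S : pzRingType) (f : {rmorphism A -> S}) :
  (forall x y, rel x y -> f x = f y) -> forall x, generated_ideal x -> f x = 0.
Proof.
move=> rel_f x; elim=> [y z /rel_f||y z _ fy _ fz|a y _ fy|a y _ fy].
- by rewrite rmorphB => ->; rewrite subrr.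
- exact: rmorph0.
- by rewrite rmorphB fy fz subrr.
- by rewrite rmorphM fy mulr0.
- by rewrite rmorphM fy mul0r.
Qed.

Lemma quot_alg_neq0 (S : nzRingType) (f : {rmorphism A -> S}) :
  (forall x y, rel x y -> f x = f y) -> (1 : quot_alg) != 0.
Proof.
move=> rel_f; apply/eqP; rewrite -(raddf0 qpi) => /qpiP.
rewrite subr0 => /(generated_ideal_ker rel_f) /eqP.
by rewrite rmorph1 oner_eq0.
Qed.

Lemma quot_alg_augmented (g : {rmorphism A -> R}) :
    (forall k x, g (k *: x) = k * g x) ->
    (forall x y, rel x y -> g x = g y) ->
  exists e : quot_alg -> R, [/\ e 1 = 1, forall u v, e (u + v) = e u + e v
                              & forall k u, e (k *: u) = k * e u].
Proof.
move=> gZ rel_g; exists (fun u => g (repr u)).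
have gE x : g (repr (qpi x)) = g x.
  apply/eqP; rewrite -subr_eq0 -rmorphB; apply/eqP.
  by apply: (generated_ideal_ker rel_g); apply/qpiP; apply: qpi_repr.
split=> [|u v|k u].
- by rewrite -[1]/(qpi 1) gE rmorph1.
- by rewrite -{1}(qpi_repr u) -{1}(qpi_repr v) -raddfD gE rmorphD.
- by rewrite -{1}(qpi_repr u) -qpiZ gE gZ.
Qed.

End QuotientAlgebra.

Section Vogel.
Variables (F : fieldType) (n : nat).

(* inl w is the permutation w, inr (i, j) is t_ij. *)
Definition vogel_gen := ('S_n + {p : 'I_n * 'I_n | p.1 != p.2})%type.

Local Notation free := (free_algebra F vogel_gen).

Definition vw (w : 'S_n) : free := free_gen F (inl w : vogel_gen).
Definition vt (i j : 'I_n) (ij : i != j) : free :=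
  free_gen F (inr (exist _ (i, j) ij) : vogel_gen).

Variables alpha beta : F.

(* The product of 'S_n composes permutations from left to right, that of the
   symmetric group in w t_ij w^-1 = t_(w(i) w(j)) from right to left, so that
   w o w' is (w' * w)%g. *)
Inductive vogel_rel : free -> free -> Prop :=
| vogel_1 : vogel_rel (vw 1%g) 1
| vogel_M w w' : vogel_rel (vw w * vw w') (vw (w' * w)%g)
| vogel_sym i j (ij : i != j) (ji : j != i) : vogel_rel (vt ij) (vt ji)
| vogel_conj (w : 'S_n) i j (ij : i != j) (wij : w i != w j) :
    vogel_rel (vw w * vt ij * vw w^-1%g) (vt wij)
| vogel_comm i j r s (ij : i != j) (rs : r != s) of uniq [:: i; j; r; s] :
    vogel_rel (vt ij * vt rs) (vt rs * vt ij)
| vogel_comm3 i j k (ij : i != j) (ik : i != k) (kj : k != j) :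
    vogel_rel (vt ij * (vt ik + vt kj)) ((vt ik + vt kj) * vt ij)
| vogel_tr i j (ij : i != j) : vogel_rel (vt ij * vw (tperm i j)) (vt ij)
| vogel_tl i j (ij : i != j) : vogel_rel (vw (tperm i j) * vt ij) (vt ij)
| vogel_quad i j (ij : i != j) :
    vogel_rel (vt ij ^+ 2 - (alpha + beta) *: vt ij
                 + (alpha * beta / 2) *: (1 + vw (tperm i j))) 0.

Definition vogel_alg := quot_alg vogel_rel.

HB.instance Definition _ := GRing.PzRing.on vogel_alg.
HB.instance Definition _ := GRing.Lmodule.on vogel_alg.

Definition vogel_sign (x : vogel_gen) : F :=
  if x is inl w then (-1) ^+ w else 0.

Lemma vogel_rel_sign (S : comNzRingType) (g : {rmorphism free -> S}) (c : F -> S) :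
    (forall a x, g (a *: x) = c a * g x) ->
    (forall w, g (vw w) = (-1) ^+ w) ->
    (forall i j (ij : i != j), g (vt ij) = 0) ->
  forall x y, vogel_rel x y -> g x = g y.
Proof.
move=> gZ gW gT x y.
case=> {x y} [|w w'|i j ij ji|w i j ij wij|i j r s ij rs _|i j k ij ik kj
             |i j ij|i j ij|i j ij].
- by rewrite rmorph1 gW odd_perm1.
- by rewrite rmorphM !gW odd_permM -signr_addb addbC.
- by rewrite !gT.
- by rewrite !rmorphM !gT mulr0 mul0r.
- by rewrite !rmorphM !gT.
- by rewrite !rmorphM !gT mulr0 mul0r.
- by rewrite !rmorphM !gT mul0r.
- by rewrite !rmorphM !gT mulr0.
- rewrite rmorphD rmorphB rmorphXn !gZ rmorphD rmorph1 gT gW odd_tperm ij.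
  by rewrite expr1 subrr !mulr0 expr0n subr0 addr0 (rmorph0 g).
Qed.

Lemma vogel_augmented : exists e : vogel_alg -> F,
  [/\ e 1 = 1, forall u v, e (u + v) = e u + e v
    & forall k u, e (k *: u) = k * e u].
Proof.
apply: (@quot_alg_augmented _ _ _ (free_eval idfun vogel_sign)).
  by move=> k x; exact: free_evalZ.
apply: (@vogel_rel_sign _ _ idfun) => [a x|w|i j ij].
- exact: free_evalZ.
- exact: free_eval_gen.
- exact: free_eval_gen.
Qed.

Lemma vogel_alg_neq0 : (1 : vogel_alg) != 0.
Proof.
apply: (@quot_alg_neq0 _ _ _ _ (free_eval idfun vogel_sign)).
apply: (@vogel_rel_sign _ _ idfun) => [a x|w|i j ij].
- exact: free_evalZ.
- exact: free_eval_gen.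
- exact: free_eval_gen.
Qed.

HB.instance Definition _ :=
  GRing.PzSemiRing_isNonZero.Build vogel_alg vogel_alg_neq0.
HB.instance Definition _ := GRing.Lmodule_isLalgebra.Build F vogel_alg
  (@quot_scalerAl _ _ vogel_rel).
HB.instance Definition _ := GRing.Lalgebra_isAlgebra.Build F vogel_alg
  (@quot_scalerAr _ _ vogel_rel).

End Vogel.

Section LaurentSeries.
Variable F : fieldType.
Implicit Types (f g : int -> F) (N M n : int) (p q : nat -> F).

Definition vanishes_below N f := forall n, n < N -> f n = 0.

Definition laurent_pred : {pred int -> F} :=
  fun f => `[< exists N, vanishes_below N f >].

Lemma laurent_zmod_closed : zmod_closed laurent_pred.
Proof.
split=> [|f g /asboolP[N fN] /asboolP[M gM]]; apply/asboolP; first by exists 0.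
exists (Num.min N M) => n; rewrite lt_min => /andP[nN nM].
by rewrite !fctE fN // gM // subrr.
Qed.

HB.instance Definition _ :=
  GRing.isZmodClosed.Build (int -> F) laurent_pred laurent_zmod_closed.

(* F((h)): the coefficient of h^n is the value at n. *)
Record laurent_series := LaurentSeries {
  lcoef :> int -> F;
  lcoefP : lcoef \in laurent_pred
}.

HB.instance Definition _ := [isSub for lcoef].
HB.instance Definition _ := [Choice of laurent_series by <:].
HB.instance Definition _ :=
  [SubChoice_isSubZmodule of laurent_series by <:].

Implicit Types (u v w : laurent_series).

Lemma laurentP u v : (forall n, u n = v n) <-> u = v.
Proof. by split=> [uv|->//]; apply: val_inj; apply/funext. Qed.

Lemma laurent_bound u : exists N, vanishes_below N u.
Proof. exact/asboolP/lcoefP. Qed.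

Lemma lcoefD u v n : (u + v) n = u n + v n. Proof. by []. Qed.

(* A finitely supported sum when f and g are bounded below. *)
Definition laurent_conv f g n : F := \sum_(i \in [set: int]) f i * g (n - i).

Definition ps_conv p q : nat -> F :=
  fun k => \sum_(i < k.+1) p i * q (k - i)%N.

Definition tail N f : nat -> F := fun k => f (N + k%:Z).

Lemma laurent_conv_tail N M f g :
    vanishes_below N f -> vanishes_below M g ->
  tail (N + M) (laurent_conv f g) = ps_conv (tail N f) (tail M g).
Proof.
move=> fN gM; apply/funext => k; rewrite /tail /laurent_conv /ps_conv.
pose r := [seq N + i%:Z | i <- iota 0 k.+1].
have r_uniq : uniq r.
  by rewrite map_inj_uniq ?iota_uniq // => i j /addrI [].
rewrite -(@fsbig_widen _ _ _ _ [set` r]) //=.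
  rewrite -fsbig_seq //= big_map -[iota 0 _]/(index_iota 0 k.+1) big_mkord.
  apply: eq_bigr => i _; congr (_ * g _).
  have ik : (i <= k)%N by rewrite -ltnS.
  by rewrite -subzn //; ring.
move=> i [_ /= /negP ir]; have [iN|Ni] := ltP i N; first by rewrite fN ?mul0r.
rewrite gM ?mulr0 // ltNge; apply/negP => Mi; apply: (negP ir).
have /gez0_abs iE : 0 <= i - N by rewrite subr_ge0.
apply/mapP; exists `|i - N|%N; last by rewrite iE addrC subrK.
rewrite mem_iota /= add0n ltnS -lez_nat iE.
by move: Mi; lra.
Qed.

Lemma laurent_conv_vanish N M f g :
    vanishes_below N f -> vanishes_below M g ->
  vanishes_below (N + M) (laurent_conv f g).
Proof.
move=> fN gM n nNM; apply: fsbig1 => i _.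
have [iN|Ni] := ltP i N; first by rewrite fN ?mul0r.
by rewrite gM ?mulr0 // ltrBlDl (lt_le_trans nNM) // lerD2r.
Qed.

Lemma laurent_mul_subproof u v : laurent_conv u v \in laurent_pred.
Proof.
have [[N uN] [M vM]] := (laurent_bound u, laurent_bound v).
by apply/asboolP; exists (N + M); apply: laurent_conv_vanish.
Qed.

Definition laurent_mul u v := LaurentSeries (laurent_mul_subproof u v).

Definition laurent_const_fun (c : F) n : F := if n == 0 then c else 0.

Lemma laurent_const_vanish c : vanishes_below 0 (laurent_const_fun c).
Proof. by move=> n n0; rewrite /laurent_const_fun lt_eqF. Qed.

Lemma laurent_const_subproof c : laurent_const_fun c \in laurent_pred.
Proof. by apply/asboolP; exists 0; apply: laurent_const_vanish. Qed.

Definition laurent_const c := LaurentSeries (laurent_const_subproof c).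

Lemma tail_eq N f g : vanishes_below N f -> vanishes_below N g ->
  tail N f = tail N g -> f = g.
Proof.
move=> fN gN fg; apply/funext => n.
have [nN|Nn] := ltP n N; first by rewrite fN ?gN.
have /gez0_abs nE : 0 <= n - N by rewrite subr_ge0.
by have /(congr1 (@^~ `|n - N|%N)) := fg; rewrite /tail nE addrC subrK.
Qed.

Let trunc p m : {poly F} := \poly_(i < m) p i.

Lemma ps_convE p q k m : (k < m)%N -> ps_conv p q k = (trunc p m * trunc q m)`_k.
Proof.
move=> km; rewrite coefM; apply: eq_bigr => i _.
have ik : (i <= k)%N by rewrite -ltnS.
by rewrite !coef_poly (leq_ltn_trans ik km) (leq_ltn_trans (leq_subr _ _) km).
Qed.

Lemma ps_convC p q : ps_conv p q = ps_conv q p.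
Proof. by apply/funext => k; rewrite !(ps_convE _ _ (ltnSn k)) mulrC. Qed.

Lemma ps_convA p q r : ps_conv p (ps_conv q r) = ps_conv (ps_conv p q) r.
Proof.
apply/funext => k; have lt_k i : (i < k.+1 -> i <= k)%N by [].
transitivity (trunc p k.+1 * (trunc q k.+1 * trunc r k.+1))`_k.
  rewrite coefM; apply: eq_bigr => i _; rewrite coef_poly ltn_ord.
  by rewrite (@ps_convE _ _ _ k.+1) // ltnS leq_subr.
rewrite mulrA coefM; apply: eq_bigr => i _.
by rewrite coef_poly ltnS leq_subr (@ps_convE _ _ _ k.+1).
Qed.

Lemma tail_const c k : tail 0 (laurent_const_fun c) k = if k is 0 then c else 0.
Proof. by rewrite /tail add0r; case: k. Qed.

Lemma ps_const_conv c q : ps_conv (tail 0 (laurent_const_fun c)) q = fun k => c * q k.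
Proof.
apply/funext => k; rewrite /ps_conv big_ord_recl tail_const subn0.
by rewrite big1 ?addr0 // => i _; rewrite tail_const mul0r.
Qed.

Lemma laurent_mulC : commutative laurent_mul.
Proof.
move=> u v; apply: val_inj => /=.
have [[N uN] [M vM]] := (laurent_bound u, laurent_bound v).
apply: (@tail_eq (N + M)); first exact: laurent_conv_vanish.
  by rewrite addrC; apply: laurent_conv_vanish.
by rewrite laurent_conv_tail // addrC laurent_conv_tail // ps_convC.
Qed.

Lemma laurent_mulA : associative laurent_mul.
Proof.
move=> u v w; apply: val_inj => /=.
have [[N uN] [M vM]] := (laurent_bound u, laurent_bound v).
have [L wL] := laurent_bound w.
have uvNM := laurent_conv_vanish uN vM; have vwML := laurent_conv_vanish vM wL.
apply: (@tail_eq (N + (M + L))); first exact: laurent_conv_vanish.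
  by rewrite addrA; apply: laurent_conv_vanish.
rewrite laurent_conv_tail // laurent_conv_tail // addrA.
rewrite laurent_conv_tail // laurent_conv_tail //.
exact: ps_convA.
Qed.

Lemma laurent_const_mul c u n : laurent_mul (laurent_const c) u n = c * u n.
Proof.
have [N uN] := laurent_bound u; have c0 := @laurent_const_vanish c.
suff -> : lcoef (laurent_mul (laurent_const c) u) = fun n => c * u n by [].
apply: (@tail_eq (0 + N)); first exact: laurent_conv_vanish.
  by move=> m; rewrite add0r => /uN ->; rewrite mulr0.
by rewrite laurent_conv_tail // ps_const_conv add0r.
Qed.

Lemma laurent_mul1 : left_id (laurent_const 1) laurent_mul.
Proof. by move=> u; apply/laurentP => n; rewrite laurent_const_mul mul1r. Qed.

Lemma laurent_mulDl : left_distributive laurent_mul +%R.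
Proof.
move=> u v w; apply: val_inj => /=.
have [[N0 uN] [M0 vM]] := (laurent_bound u, laurent_bound v).
have [L wL] := laurent_bound w; pose N := Num.min N0 M0.
have {}uN : vanishes_below N u by move=> n; rewrite lt_min => /andP[/uN].
have {}vM : vanishes_below N v by move=> n; rewrite lt_min => /andP[_ /vM].
have uvN : vanishes_below N (u + v) by move=> n nN; rewrite lcoefD uN ?vM ?addr0.
have uwNL := laurent_conv_vanish uN wL; have vwNL := laurent_conv_vanish vM wL.
apply: (@tail_eq (N + L)); first exact: laurent_conv_vanish.
  by move=> n nNL; rewrite -[LHS]/(laurent_conv u w n + laurent_conv v w n) uwNL // vwNL // addr0.
transitivity (tail (N + L) (laurent_conv u w) \+ tail (N + L) (laurent_conv v w));
  last by [].
rewrite !laurent_conv_tail //; apply/funext => k; rewrite /= /ps_conv -big_split.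
by apply: eq_bigr => i _; rewrite /= -mulrDl.
Qed.

Lemma laurent_one_neq0 : laurent_const 1 != 0.
Proof.
apply/eqP => /laurentP /(_ 0) /eqP.
by rewrite /= /laurent_const_fun eqxx oner_eq0.
Qed.

HB.instance Definition _ := GRing.Zmodule_isComNzRing.Build laurent_series
  laurent_mulA laurent_mulC laurent_mul1 laurent_mulDl laurent_one_neq0.

Section PowerSeriesInverse.
Variables (p : nat -> F).
Hypothesis p0 : p 0%N != 0.

Fixpoint ps_inv_upto m : nat -> F :=
  if m is m'.+1 then fun k =>
    if (k <= m')%N then ps_inv_upto m' k
    else - (p 0%N)^-1 * \sum_(i < m) ps_inv_upto m' i * p (m - i)%N
  else fun=> (p 0%N)^-1.

Definition ps_inv k := ps_inv_upto k k.

Lemma ps_inv_uptoE m k : (k <= m)%N -> ps_inv_upto m k = ps_inv k.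
Proof.
elim: m => [|m IHm]; first by rewrite leqn0 => /eqP ->.
by rewrite leq_eqVlt => /predU1P[->//|]; rewrite ltnS /= => km; rewrite km IHm.
Qed.

Lemma ps_invP : ps_conv ps_inv p = tail 0 (laurent_const_fun 1).
Proof.
apply/funext => -[|m]; rewrite tail_const /ps_conv.
  by rewrite big_ord1 mulVf.
rewrite big_ord_recr /= subnn /ps_inv /= ltnn mulrAC mulNr mulVf // mulN1r.
apply/eqP; rewrite subr_eq0; apply/eqP; apply: eq_bigr => i _.
by rewrite (@ps_inv_uptoE m) // -ltnS.
Qed.

End PowerSeriesInverse.

Lemma laurent_invertible u : u != 0 -> exists v, v * u = 1.
Proof.
move=> u0; have [N0 uN0] := laurent_bound u.
have uk : exists k, tail N0 u k != 0.
  apply: contrapT => /forallNP u00; case/eqP: u0; apply/laurentP => n.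
  have {}u00 k : tail N0 u k = 0 by apply/eqP/negPn/negP.
  suff -> : lcoef u = (fun=> 0) by [].
  by apply: (tail_eq uN0) => //; apply/funext.
case: (ex_minnP uk) => m um min_m.
pose N := N0 + m%:Z; have uN : vanishes_below N u.
  move=> n nN; have [/uN0//|N0n] := ltP n N0.
  have /gez0_abs nE : 0 <= n - N0 by rewrite subr_ge0.
  apply/eqP; apply: contraTT nN => un0; rewrite -leNgt /N -lerBrDl -nE lez_nat.
  by apply: min_m; rewrite /tail nE addrC subrK.
pose p := tail N u; have p0 : p 0%N != 0 by rewrite /p /tail addr0.
pose f n := if n < - N then 0 else ps_inv p (absz (n + N)).
have fN : vanishes_below (- N) f by move=> n; rewrite /f => ->.
have Pf : f \in laurent_pred by apply/asboolP; exists (- N).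
have fE : tail (- N) f = ps_inv p.
  apply/funext => i; rewrite /tail /f ltNge lerDl lez_nat /=.
  by rewrite addrAC addNr add0r.
exists (LaurentSeries Pf); apply: val_inj; apply: (@tail_eq (- N + N)).
- exact: laurent_conv_vanish.
- by rewrite addNr; apply: laurent_const_vanish.
by rewrite /= laurent_conv_tail // fE addNr ps_invP.
Qed.

Definition laurent_inv u : laurent_series := xget 0 [set v | v * u = 1].

Lemma laurent_mulV u : u != 0 -> laurent_inv u * u = 1.
Proof.
move=> /laurent_invertible [v vu1]; rewrite /laurent_inv.
by case: xgetP => [w _ //|/(_ v)].
Qed.

Lemma laurent_inv0 : laurent_inv 0 = 0.
Proof.
apply: xgetPN => v /= /eqP; apply/negP.
by rewrite mulr0 eq_sym oner_eq0.
Qed.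

HB.instance Definition _ :=
  GRing.ComNzRing_isField.Build laurent_series laurent_mulV laurent_inv0.

Lemma laurent_constB : zmod_morphism laurent_const.
Proof.
move=> c d; apply/laurentP => n; rewrite -[RHS]/(_ n - _ n) /= /laurent_const_fun.
by case: ifP; rewrite ?subrr.
Qed.

Lemma laurent_const_monoid_morphism : monoid_morphism laurent_const.
Proof.
split=> // c d; apply/laurentP => n; rewrite [RHS]laurent_const_mul /=.
by rewrite /laurent_const_fun; case: ifP; rewrite ?mulr0.
Qed.

HB.instance Definition _ :=
  GRing.isZmodMorphism.Build F laurent_series laurent_const laurent_constB.
HB.instance Definition _ :=
  GRing.isMonoidMorphism.Build F laurent_series laurent_const
    laurent_const_monoid_morphism.

(* e^(h gamma) *)
Definition laurent_exp_fun (gamma : F) n : F :=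
  if n is Posz k then gamma ^+ k / k`!%:R else 0.

Lemma laurent_exp_subproof gamma : laurent_exp_fun gamma \in laurent_pred.
Proof. by apply/asboolP; exists 0 => -[]. Qed.

Definition laurent_exp gamma := LaurentSeries (laurent_exp_subproof gamma).

Lemma laurent_exp_neq0 gamma : laurent_exp gamma != 0.
Proof.
apply/eqP => /laurentP /(_ 0) /eqP.
by rewrite /= expr0 fact0 invr1 mulr1 oner_eq0.
Qed.

End LaurentSeries.

Section ExtensionOfScalars.
Variables (R K : comNzRingType) (phi : {rmorphism R -> K}) (A : algType R).

(* A (x)_R K, where K is an R-module through phi: the free abelian group on
   A * K modulo the R-bilinearity relations. *)
Local Notation formal := {malg int[(A * K)%type]}.

Inductive tensor_null : formal -> Prop :=
| tensor_Dl x y k :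
    tensor_null (<< (x + y, k) >> - (<< (x, k) >> + << (y, k) >>))
| tensor_Dr x k l :
    tensor_null (<< (x, k + l) >> - (<< (x, k) >> + << (x, l) >>))
| tensor_Z r x k : tensor_null (<< (r *: x, k) >> - << (x, phi r * k) >>)
| tensor_0 : tensor_null 0
| tensor_B g1 g2 of tensor_null g1 & tensor_null g2 : tensor_null (g1 - g2).

Definition in_tensor_null : {pred formal} := fun g => `[< tensor_null g >].

Lemma tensor_null_zmod_closed : zmod_closed in_tensor_null.
Proof.
split=> [|x y /asboolP Ix /asboolP Iy]; apply/asboolP; first exact: tensor_0.
exact: tensor_B.
Qed.

HB.instance Definition _ :=
  GRing.isZmodClosed.Build formal in_tensor_null tensor_null_zmod_closed.

Definition ext_scalars := Quotient.quot in_tensor_null.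

HB.instance Definition _ := GRing.Zmodule.on ext_scalars.

Definition tensor_pi (g : formal) : ext_scalars := (\pi_ext_scalars g)%qT.

Definition tensor (x : A) (k : K) : ext_scalars := tensor_pi << (x, k) >>.

Lemma tensor_piP g1 g2 : tensor_pi g1 = tensor_pi g2 <-> tensor_null (g1 - g2).
Proof.
rewrite /tensor_pi; split => [/eqP|H].
  by rewrite -Quotient.idealrBE => /asboolP.
by apply/eqP; rewrite -Quotient.idealrBE; apply/asboolP.
Qed.

Lemma tensor_piB : zmod_morphism tensor_pi.
Proof. by move=> x y; rewrite /tensor_pi !piE. Qed.

HB.instance Definition _ :=
  GRing.isZmodMorphism.Build formal ext_scalars tensor_pi tensor_piB.

Lemma tensor_pi_repr (t : ext_scalars) : tensor_pi (repr t) = t.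
Proof. exact: reprK. Qed.

Lemma tensorDl x y k : tensor (x + y) k = tensor x k + tensor y k.
Proof. by rewrite /tensor -raddfD; apply/tensor_piP; apply: tensor_Dl. Qed.

Lemma tensorDr x k l : tensor x (k + l) = tensor x k + tensor x l.
Proof. by rewrite /tensor -raddfD; apply/tensor_piP; apply: tensor_Dr. Qed.

Lemma tensorZ r x k : tensor (r *: x) k = tensor x (phi r * k).
Proof. by apply/tensor_piP; apply: tensor_Z. Qed.

Lemma tensor0r x : tensor x 0 = 0.
Proof. by apply: (addIr (tensor x 0)); rewrite -tensorDr !add0r. Qed.

Lemma tensorNr x k : tensor x (- k) = - tensor x k.
Proof. by apply: (addIr (tensor x k)); rewrite -tensorDr !addNr tensor0r. Qed.

Lemma tensor_ind (P : ext_scalars -> Prop) :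
    P 0 -> (forall t u, P t -> P u -> P (t + u)) ->
  (forall x k, P (tensor x k)) -> forall t, P t.
Proof.
move=> P0 PD PT t; rewrite -(tensor_pi_repr t) (monalgE (repr t)) raddf_sum.
apply: big_ind => //= -[x k] _.
have PN x' k' : P (- tensor x' k') by rewrite -tensorNr.
have -> (n : int) : tensor_pi << n *g (x, k) >> = tensor x k *~ n.
  by rewrite /tensor -raddfMz -(raddfMz (mkmalgU (x, k))) /= intz.
case: (mcoeff _ _) => n.
  by rewrite -pmulrn; elim: n => // n IHn; rewrite mulrS; apply: PD.
rewrite NegzE -nmulrn -mulNrn.
by elim: n => [|n IHn]; rewrite ?mulr1n // mulrS; apply: PD.
Qed.

Section Lift.
Variables (Z : zmodType) (f : A -> K -> Z).
Hypothesis fDl : forall x y k, f (x + y) k = f x k + f y k.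
Hypothesis fDr : forall x k l, f x (k + l) = f x k + f x l.
Hypothesis fZ : forall r x k, f (r *: x) k = f x (phi r * k).

Definition formal_lift (g : formal) : Z :=
  \sum_(p <- msupp g) f p.1 p.2 *~ g@_p.

Lemma formal_liftEw (d : {fset A * K}) g : msupp g `<=` d ->
  formal_lift g = \sum_(p <- d) f p.1 p.2 *~ g@_p.
Proof.
move=> le; rewrite [LHS](big_fset_incl _ le) => //= x xd /mcoeff_outdom ->.
by rewrite mulr0z.
Qed.

Lemma formal_liftB : zmod_morphism formal_lift.
Proof.
move=> g1 g2; rewrite (formal_liftEw (msuppB_le g1 g2)).
rewrite (formal_liftEw (fsubsetUl _ (msupp g2))).
rewrite (formal_liftEw (fsubsetUr (msupp g1) _)).
by rewrite -sumrB; apply: eq_bigr => p _; rewrite mcoeffB mulrzBr.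
Qed.

HB.instance Definition _ :=
  GRing.isZmodMorphism.Build formal Z formal_lift formal_liftB.

Lemma formal_liftU x k : formal_lift << (x, k) >> = f x k.
Proof. by rewrite /formal_lift msuppU oner_eq0 big_seq_fset1 mcoeffUU. Qed.

Lemma formal_lift_null g : tensor_null g -> formal_lift g = 0.
Proof.
elim=> [x y k|x k l|r x k||g1 g2 _ E1 _ E2].
- by rewrite raddfB raddfD /= !formal_liftU fDl subrr.
- by rewrite raddfB raddfD /= !formal_liftU fDr subrr.
- by rewrite raddfB /= !formal_liftU fZ subrr.
- exact: raddf0.
- by rewrite raddfB /= E1 E2 subrr.
Qed.

Definition tensor_lift (t : ext_scalars) : Z := formal_lift (repr t).

Lemma tensor_lift_pi g : tensor_lift (tensor_pi g) = formal_lift g.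
Proof.
apply/eqP; rewrite -subr_eq0 -raddfB; apply/eqP/formal_lift_null/tensor_piP.
exact: tensor_pi_repr.
Qed.

Lemma tensor_liftE x k : tensor_lift (tensor x k) = f x k.
Proof. by rewrite tensor_lift_pi formal_liftU. Qed.

Lemma tensor_liftB : zmod_morphism tensor_lift.
Proof.
move=> t u; rewrite -(tensor_pi_repr t) -(tensor_pi_repr u) -raddfB.
by rewrite !tensor_lift_pi raddfB.
Qed.

Lemma tensor_liftD t u : tensor_lift (t + u) = tensor_lift t + tensor_lift u.
Proof.
rewrite -(tensor_pi_repr t) -(tensor_pi_repr u) -raddfD.
by rewrite !tensor_lift_pi raddfD.
Qed.

Lemma tensor_lift0 : tensor_lift 0 = 0.
Proof. by rewrite -(raddf0 tensor_pi) tensor_lift_pi raddf0. Qed.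

End Lift.

Lemma eq_tensor_lift (Z : zmodType) (f g : A -> K -> Z) t :
  (forall x k, f x k = g x k) -> tensor_lift f t = tensor_lift g t.
Proof. by move=> fg; apply: eq_bigr => p _; rewrite fg. Qed.

(* (x (x) k) (y (x) l) = (x y) (x) (k l) and c (x (x) k) = x (x) (c k) *)
Definition tensor_mul (t u : ext_scalars) : ext_scalars :=
  tensor_lift (fun x k => tensor_lift (fun y l => tensor (x * y) (k * l)) u) t.

Definition tensor_scale (c : K) (t : ext_scalars) : ext_scalars :=
  tensor_lift (fun x k => tensor x (c * k)) t.

Let mul_in x k := tensor_lift (fun y l => tensor (x * y) (k * l)).

Let mul_inD x k : {morph mul_in x k : t u / t + u}.
Proof.
move=> t u; apply: tensor_liftD => [y z l|y l m|r y l].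
- by rewrite mulrDr tensorDl.
- by rewrite mulrDr tensorDr.
- by rewrite -scalerAr tensorZ mulrCA.
Qed.

Let mul_in0 x k : mul_in x k 0 = 0.
Proof.
apply: tensor_lift0 => [y z l|y l m|r y l].
- by rewrite mulrDr tensorDl.
- by rewrite mulrDr tensorDr.
- by rewrite -scalerAr tensorZ mulrCA.
Qed.

Let mul_inE x k y l : mul_in x k (tensor y l) = tensor (x * y) (k * l).
Proof.
apply: tensor_liftE => [{}y z {}l|{}y {}l m|r {}y {}l].
- by rewrite mulrDr tensorDl.
- by rewrite mulrDr tensorDr.
- by rewrite -scalerAr tensorZ mulrCA.
Qed.

Let mul_inDl x y k u : mul_in (x + y) k u = mul_in x k u + mul_in y k u.
Proof.
elim/tensor_ind: u => [|t u Ht Hu|z l]; first by rewrite !mul_in0 addr0.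
  by rewrite !mul_inD Ht Hu addrACA.
by rewrite !mul_inE mulrDl tensorDl.
Qed.

Let mul_inDr x k l u : mul_in x (k + l) u = mul_in x k u + mul_in x l u.
Proof.
elim/tensor_ind: u => [|t u Ht Hu|z m]; first by rewrite !mul_in0 addr0.
  by rewrite !mul_inD Ht Hu addrACA.
by rewrite !mul_inE mulrDl tensorDr.
Qed.

Let mul_inZ r x k u : mul_in (r *: x) k u = mul_in x (phi r * k) u.
Proof.
elim/tensor_ind: u => [|t u Ht Hu|z m]; first by rewrite !mul_in0.
  by rewrite !mul_inD Ht Hu.
by rewrite !mul_inE -scalerAl tensorZ mulrA.
Qed.

Lemma tensor_mulE x k y l :
  tensor_mul (tensor x k) (tensor y l) = tensor (x * y) (k * l).
Proof.
rewrite /tensor_mul tensor_liftE; first exact: mul_inE.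
- by move=> *; apply: mul_inDl.
- by move=> *; apply: mul_inDr.
- by move=> *; apply: mul_inZ.
Qed.

Lemma tensor_mulDl : left_distributive tensor_mul +%R.
Proof.
move=> t u v; rewrite /tensor_mul tensor_liftD //.
- by move=> *; apply: mul_inDl.
- by move=> *; apply: mul_inDr.
- by move=> *; apply: mul_inZ.
Qed.

Lemma tensor_mul0l : left_zero 0 tensor_mul.
Proof.
move=> t; rewrite /tensor_mul tensor_lift0 //.
- by move=> *; apply: mul_inDl.
- by move=> *; apply: mul_inDr.
- by move=> *; apply: mul_inZ.
Qed.

Let mul_tensor x k u : tensor_mul (tensor x k) u = mul_in x k u.
Proof.
rewrite /tensor_mul tensor_liftE //.
- by move=> *; apply: mul_inDl.
- by move=> *; apply: mul_inDr.
- by move=> *; apply: mul_inZ.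
Qed.

Lemma tensor_mulDr : right_distributive tensor_mul +%R.
Proof.
move=> t u v; elim/tensor_ind: t => [|t t' Ht Ht'|x k].
- by rewrite !tensor_mul0l addr0.
- by rewrite !tensor_mulDl Ht Ht' addrACA.
- by rewrite !mul_tensor mul_inD.
Qed.

Lemma tensor_mul0r : right_zero 0 tensor_mul.
Proof.
move=> t; elim/tensor_ind: t => [|t t' Ht Ht'|x k].
- by rewrite tensor_mul0l.
- by rewrite tensor_mulDl Ht Ht' addr0.
- by rewrite mul_tensor mul_in0.
Qed.

Lemma tensor_mulA : associative tensor_mul.
Proof.
move=> t u v; elim/tensor_ind: t => [|t t' Ht Ht'|x k].
- by rewrite !tensor_mul0l.
- by rewrite !tensor_mulDl Ht Ht'.
elim/tensor_ind: u => [|u u' Hu Hu'|y l].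
- by rewrite !(tensor_mul0l, tensor_mul0r).
- by rewrite !(tensor_mulDl, tensor_mulDr) Hu Hu'.
elim/tensor_ind: v => [|v v' Hv Hv'|z m].
- by rewrite !tensor_mul0r.
- by rewrite !tensor_mulDr Hv Hv'.
- by rewrite !tensor_mulE !mulrA.
Qed.

Lemma tensor_mul1l : left_id (tensor 1 1) tensor_mul.
Proof.
elim/tensor_ind => [|u u' Hu Hu'|y l]; first exact: tensor_mul0r.
  by rewrite tensor_mulDr Hu Hu'.
by rewrite tensor_mulE !mul1r.
Qed.

Lemma tensor_mul1r : right_id (tensor 1 1) tensor_mul.
Proof.
elim/tensor_ind => [|u u' Hu Hu'|y l]; first exact: tensor_mul0l.
  by rewrite tensor_mulDl Hu Hu'.
by rewrite tensor_mulE !mulr1.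
Qed.

HB.instance Definition _ := GRing.Zmodule_isPzRing.Build ext_scalars
  tensor_mulA tensor_mul1l tensor_mul1r tensor_mulDl tensor_mulDr.

Lemma tensor_scaleE c x k : tensor_scale c (tensor x k) = tensor x (c * k).
Proof.
apply: tensor_liftE => [{}x y {}k|{}x {}k l|r {}x {}k].
- by rewrite tensorDl.
- by rewrite mulrDr tensorDr.
- by rewrite tensorZ mulrCA.
Qed.

Lemma tensor_scaleDr : right_distributive tensor_scale +%R.
Proof.
move=> c t u; apply: tensor_liftD => [x y k|x k l|r x k].
- by rewrite tensorDl.
- by rewrite mulrDr tensorDr.
- by rewrite tensorZ mulrCA.
Qed.

Lemma tensor_scale0 c : tensor_scale c 0 = 0.
Proof.
apply: (addIr (tensor_scale c 0)); by rewrite -tensor_scaleDr !add0r.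
Qed.

Lemma tensor_scaleDl t : {morph tensor_scale^~ t : c d / c + d}.
Proof.
move=> c d; elim/tensor_ind: t => [|t u Ht Hu|x k].
- by rewrite !tensor_scale0 addr0.
- by rewrite !tensor_scaleDr Ht Hu addrACA.
- by rewrite !tensor_scaleE mulrDl tensorDr.
Qed.

Lemma tensor_scaleA c d t :
  tensor_scale c (tensor_scale d t) = tensor_scale (c * d) t.
Proof.
elim/tensor_ind: t => [|t u Ht Hu|x k].
- by rewrite !tensor_scale0.
- by rewrite !tensor_scaleDr Ht Hu.
- by rewrite !tensor_scaleE mulrA.
Qed.

Lemma tensor_scale1 : left_id 1 tensor_scale.
Proof.
elim/tensor_ind => [|t u Ht Hu|x k]; first by rewrite tensor_scale0.
  by rewrite tensor_scaleDr Ht Hu.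
by rewrite tensor_scaleE mul1r.
Qed.

HB.instance Definition _ := GRing.Zmodule_isLmodule.Build K ext_scalars
  tensor_scaleA tensor_scale1 tensor_scaleDr tensor_scaleDl.

Lemma tensor_oneE : 1 = tensor 1 1. Proof. by []. Qed.

Lemma tensorM x k y l : tensor x k * tensor y l = tensor (x * y) (k * l).
Proof. exact: tensor_mulE. Qed.

Lemma scale_tensor c x k : c *: tensor x k = tensor x (c * k).
Proof. exact: tensor_scaleE. Qed.

Lemma ext_scalars_scalerAl (c : K) (t u : ext_scalars) :
  c *: (t * u) = (c *: t) * u.
Proof.
elim/tensor_ind: t => [|t t' Ht Ht'|x k]; first by rewrite !(mul0r, scaler0).
  by rewrite mulrDl !scalerDr mulrDl Ht Ht'.
elim/tensor_ind: u => [|u u' Hu Hu'|y l]; first by rewrite !(mulr0, scaler0).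
  by rewrite !mulrDr scalerDr Hu Hu'.
by rewrite tensorM !scale_tensor tensorM mulrA.
Qed.

Lemma ext_scalars_scalerAr (c : K) (t u : ext_scalars) :
  c *: (t * u) = t * (c *: u).
Proof.
elim/tensor_ind: t => [|t t' Ht Ht'|x k]; first by rewrite !(mul0r, scaler0).
  by rewrite mulrDl !scalerDr mulrDl Ht Ht'.
elim/tensor_ind: u => [|u u' Hu Hu'|y l]; first by rewrite !(mulr0, scaler0).
  by rewrite mulrDr !scalerDr mulrDr Hu Hu'.
by rewrite tensorM !scale_tensor tensorM mulrCA.
Qed.

Lemma ext_scalars_neq0 :
    (exists e : A -> R, [/\ e 1 = 1, forall x y, e (x + y) = e x + e y
                          & forall r x, e (r *: x) = r * e x]) ->
  (1 : ext_scalars) != 0.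
Proof.
case=> e [e1 eD eZ]; pose f x k := phi (e x) * k.
have fDl x y k : f (x + y) k = f x k + f y k.
  by rewrite /f eD rmorphD mulrDl.
have fDr x k l : f x (k + l) = f x k + f x l by rewrite /f mulrDr.
have fZ r x k : f (r *: x) k = f x (phi r * k).
  by rewrite /f eZ rmorphM mulrCA mulrA.
apply/eqP => /(congr1 (tensor_lift f)); rewrite tensor_oneE.
rewrite tensor_liftE // tensor_lift0 // /f e1 rmorph1 mulr1.
by move/eqP; rewrite oner_eq0.
Qed.

End ExtensionOfScalars.

Section BraidGroup.
Variable n : nat.

(* The letter (i, false) stands for s_(i+1), and (i, true) for its inverse. *)
Definition braid_word := seq ('I_n.-1 * bool).

Inductive braid_eq : braid_word -> braid_word -> Prop :=
| braid_refl u : braid_eq u u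
| braid_sym u v of braid_eq u v : braid_eq v u
| braid_trans u v w of braid_eq u v & braid_eq v w : braid_eq u w
| braid_cat u u' v v' of braid_eq u u' & braid_eq v v' :
    braid_eq (u ++ v) (u' ++ v')
| braid_cancel i b : braid_eq [:: (i, b); (i, ~~ b)] [::]
| braid_comm (i j : 'I_n.-1) of (i.+1 < j)%N : braid_eq [:: (i, false); (j, false)] [:: (j, false); (i, false)]
| braid_artin (i j : 'I_n.-1) of j = i.+1 :> nat :
    braid_eq [:: (i, false); (j, false); (i, false)] [:: (j, false); (i, false); (j, false)].

Definition braid_eqb : rel braid_word := fun u v => `[< braid_eq u v >].

Lemma braid_eqb_equiv : equiv_class_of braid_eqb.
Proof.
split=> [u|u v|v u w /asboolP uv /asboolP vw]; first exact/asboolP/braid_refl.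
  by apply/asboolP/asboolP; apply: braid_sym.
exact/asboolP/(braid_trans uv vw).
Qed.

Canonical braid_equiv_rel := EquivRelPack braid_eqb_equiv.

Definition braid_group := {eq_quot braid_eqb}%qT.

HB.instance Definition _ := Choice.on braid_group.

Definition braid_class (u : braid_word) : braid_group := (\pi_braid_group u)%qT.

Definition braid_word_inv (u : braid_word) : braid_word :=
  [seq (x.1, ~~ x.2) | x <- rev u].

Lemma braid_classP u v : braid_class u = braid_class v <-> braid_eq u v.
Proof.
split=> [/eqP|uv]; first by rewrite /braid_class eqmodE => /asboolP.
by apply/eqP; rewrite /braid_class eqmodE; apply/asboolP.
Qed.

Lemma braid_reprK (x : braid_group) : braid_class (repr x) = x.
Proof. exact: reprK. Qed.

Lemma braid_word_invK : involutive braid_word_inv.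
Proof.
move=> u; rewrite /braid_word_inv -map_rev revK -map_comp.
by rewrite map_id_in // => -[i b] _ /=; rewrite negbK.
Qed.

Lemma braid_word_mulV u : braid_eq (u ++ braid_word_inv u) [::].
Proof.
elim: u => [|[i b] u IHu]; first exact: braid_refl.
have -> : ((i, b) :: u) ++ braid_word_inv ((i, b) :: u) =
    [:: (i, b)] ++ ((u ++ braid_word_inv u) ++ [:: (i, ~~ b)]).
  by rewrite /braid_word_inv rev_cons map_rcons -cats1 /= catA.
apply: braid_trans (braid_cancel i b); rewrite -[X in braid_eq _ X]cat1s.
apply: braid_cat; first exact: braid_refl.
rewrite -[X in braid_eq _ X]cat0s; apply: braid_cat => //; exact: braid_refl.
Qed.

Lemma braid_word_mulVl u : braid_eq (braid_word_inv u ++ u) [::].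
Proof. by rewrite -{2}[u]braid_word_invK; apply: braid_word_mulV. Qed.

Lemma braid_word_inv_eq u v :
  braid_eq u v -> braid_eq (braid_word_inv u) (braid_word_inv v).
Proof.
move=> uv; apply: (@braid_trans _ (braid_word_inv u ++ (v ++ braid_word_inv v))).
  rewrite -{1}[braid_word_inv u]cats0; apply: braid_cat (braid_refl _) _.
  exact/braid_sym/braid_word_mulV.
rewrite catA -[X in braid_eq _ X]cat0s; apply: braid_cat (braid_refl _).
apply: braid_trans (braid_word_mulVl u).
exact: braid_cat (braid_refl _) (braid_sym uv).
Qed.

Definition braid_mul (x y : braid_group) := braid_class (repr x ++ repr y).
Definition braid_inv (x : braid_group) := braid_class (braid_word_inv (repr x)).

Lemma braid_class_cat u v :
  braid_mul (braid_class u) (braid_class v) = braid_class (u ++ v).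
Proof.
by apply/braid_classP; apply: braid_cat; apply/braid_classP; apply: braid_reprK.
Qed.

Lemma braid_mulA : associative braid_mul.
Proof.
move=> x y z; rewrite -(braid_reprK x) -(braid_reprK y) -(braid_reprK z).
by rewrite !braid_class_cat catA.
Qed.

Lemma braid_mul1 : left_id (braid_class [::]) braid_mul.
Proof. by move=> x; rewrite -(braid_reprK x) braid_class_cat. Qed.

Lemma braid_mulr1 : right_id (braid_class [::]) braid_mul.
Proof. by move=> x; rewrite -(braid_reprK x) braid_class_cat cats0. Qed.

Lemma braid_mulVl : left_inverse (braid_class [::]) braid_inv braid_mul.
Proof.
move=> x; rewrite -{2}(braid_reprK x) braid_class_cat.
exact/braid_classP/braid_word_mulVl.
Qed.

Lemma braid_mulrV : right_inverse (braid_class [::]) braid_inv braid_mul.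
Proof.
move=> x; rewrite -{1}(braid_reprK x) braid_class_cat.
exact/braid_classP/braid_word_mulV.
Qed.

HB.instance Definition _ := isGroup.Build braid_group
  braid_mulA braid_mul1 braid_mulr1 braid_mulVl braid_mulrV.

Definition braid_gen (i : 'I_n.-1) : braid_group := braid_class [:: (i, false)].

Section BraidEval.
Variables (S : comNzRingType) (x xV : S).
Hypothesis xxV : x * xV = 1.

Definition braid_eval (u : braid_group) : S :=
  \prod_(l <- repr u) (if l.2 then xV else x).

Lemma braid_eval_class (u : braid_word) :
  braid_eval (braid_class u) = \prod_(l <- u) (if l.2 then xV else x).
Proof.
have : braid_eq (repr (braid_class u)) u.
  exact/braid_classP/braid_reprK.
rewrite /braid_eval; move: (repr _) => v; elim=> {v u}
  [//|u v _ -> //|u v w _ -> _ -> //|u u' v v' _ Eu _ Ev|i b|i j _|i j _].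
- by rewrite !big_cat Eu Ev.
- by rewrite !big_cons big_nil mulr1; case: b; rewrite //= mulrC.
- by rewrite !big_cons !big_nil.
- by rewrite !big_cons !big_nil.
Qed.

Lemma braid_eval1 : braid_eval 1%g = 1.
Proof. by rewrite -[1%g]/(braid_class [::]) braid_eval_class big_nil. Qed.

Lemma braid_evalM (u v : braid_group) :
  braid_eval (u * v)%g = braid_eval u * braid_eval v.
Proof. by rewrite braid_eval_class big_cat. Qed.

Lemma braid_eval_gen i : braid_eval (braid_gen i) = x.
Proof. by rewrite braid_eval_class big_seq1. Qed.

Lemma braid_eval_genV i : braid_eval (braid_gen i)^-1%g = xV.
Proof.
have := braid_evalM (braid_gen i) (braid_gen i)^-1%g.
rewrite mulgV braid_eval1 braid_eval_gen => /(congr1 ( *%R xV)).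
by rewrite mulrA [xV * x]mulrC xxV mul1r mulr1.
Qed.

End BraidEval.
End BraidGroup.

(* Z[a^(+-1), b^(+-1), c^(+-1)], as the group algebra of Z^3: the monomial
   a^i b^j c^k is the basis element (i, j, k). *)
Definition laurent_poly3 :=
  monoid_algebra int (Algebra.to_multiplicative (int * int * int)%type).

HB.instance Definition _ := GRing.Algebra.on laurent_poly3.

Lemma laurent_poly3_mulC : commutative (@GRing.mul laurent_poly3).
Proof. by apply: ma_mulC => k l; apply: addrC. Qed.

HB.instance Definition _ :=
  GRing.PzRing_hasCommutativeMul.Build laurent_poly3 laurent_poly3_mulC.

Definition lmon (i j k : int) : laurent_poly3 :=
  @ma_basis int (Algebra.to_multiplicative (int * int * int)%type) (i, j, k).

Lemma lmonM i j k i' j' k' :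
  lmon i j k * lmon i' j' k' = lmon (i + i') (j + j') (k + k').
Proof. by rewrite /lmon /GRing.mul /= ma_basis.unlock ma_mulUU. Qed.

Lemma lmon0 : lmon 0 0 0 = 1. Proof. by []. Qed.

Section Q3Image.
Variables (S : comNzRingType) (B : algType S) (g : {rmorphism B -> S}).
Hypothesis gZ : forall (k : S) (x : B), g (k *: x) = k * g x.

Lemma cubic_image (a b c : S) (s : B) : g s = a ->
  g ((s - a%:A) * (s - b%:A) * (s - c%:A)) = g 0.
Proof.
move=> gs; rewrite !rmorphM (_ : g (s - a%:A) = 0) ?mul0r ?rmorph0 //.
by rewrite rmorphB gZ gs rmorph1 mulr1 subrr.
Qed.

Lemma skein_image (a aV : S) (s1 s2 s1V s2V : B) : a * aV = 1 ->
    g s1 = a -> g s2 = a -> g s1V = aV -> g s2V = aV ->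
  g (s1V * s2 * s1) =
  g (s1 * s2 * s1V - aV *: (s1 * s2) + a *: (s1 * s2V) + a *: (s1V * s2)
       - a ^+ 3 *: (s1V * s2V) + aV *: (s2 * s1) - a *: (s2 * s1V)
       - a *: (s2V * s1) + a ^+ 3 *: (s2V * s1V)
       + a ^+ 2 *: (s1V * s2V * s1) - a ^+ 2 *: (s1 * s2V * s1V)).
Proof.
move=> aaV gs1 gs2 gs1V gs2V.
have aVa : aV * a = 1 by rewrite mulrC.
have a3 : a ^+ 3 * (aV * aV) = a.
  by rewrite exprSr -mulrA [a * (_ * _)]mulrA aaV mul1r exprSr -mulrA aaV mulr1.
have a2 : a ^+ 2 * (aV * aV) = 1.
  by rewrite exprSr -mulrA [a * (_ * _)]mulrA aaV mul1r expr1 aaV.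
rewrite !(rmorphD, rmorphN, gZ, rmorphM) gs1 gs2 gs1V gs2V a3.
rewrite [aV * (a * a)]mulrA -[a * aV * aV]mulrA [a * (aV * aV)]mulrC.
rewrite ![a ^+ 2 * (aV * aV * a)]mulrA a2 -[a * a * aV]mulrA aaV aVa.
by rewrite mul1r; ring.
Qed.

End Q3Image.

Section Q3.

Local Notation RB3 := (monoid_algebra laurent_poly3 (braid_group 3)).

Let a := lmon 1 0 0.
Let aV := lmon (- 1) 0 0.
Let b := lmon 0 1 0.
Let c := lmon 0 0 1.

Let s1 : RB3 := ma_basis _ (braid_gen (ord0 : 'I_3.-1)).
Let s2 : RB3 := ma_basis _ (braid_gen (ord_max : 'I_3.-1)).
Let s1V : RB3 := ma_basis _ (braid_gen (ord0 : 'I_3.-1))^-1%g.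
Let s2V : RB3 := ma_basis _ (braid_gen (ord_max : 'I_3.-1))^-1%g.

Inductive Q3_rel : RB3 -> RB3 -> Prop :=
| Q3_cubic : Q3_rel ((s1 - a%:A) * (s1 - b%:A) * (s1 - c%:A)) 0
| Q3_skein :
    Q3_rel (s1V * s2 * s1)
      (s1 * s2 * s1V - aV *: (s1 * s2) + a *: (s1 * s2V) + a *: (s1V * s2)
         - a ^+ 3 *: (s1V * s2V) + aV *: (s2 * s1) - a *: (s2 * s1V)
         - a *: (s2V * s1) + a ^+ 3 *: (s2V * s1V)
         + a ^+ 2 *: (s1V * s2V * s1) - a ^+ 2 *: (s1 * s2V * s1V)).

Definition Q3 := quot_alg Q3_rel.

HB.instance Definition _ := GRing.PzRing.on Q3.
HB.instance Definition _ := GRing.Lmodule.on Q3.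

Let aaV : a * aV = 1.
Proof. by rewrite lmonM subrr !addr0 lmon0. Qed.

Definition Q3_eval : RB3 -> laurent_poly3 :=
  ma_eval idfun (@braid_eval 3 _ a aV).

Let h1 := @braid_eval1 3 _ _ _ aaV.
Let hM := @braid_evalM 3 _ _ _ aaV.

HB.instance Definition _ := GRing.isZmodMorphism.Build RB3 laurent_poly3
  Q3_eval (@ma_evalB _ _ _ _ _).
HB.instance Definition _ := GRing.isMonoidMorphism.Build RB3 laurent_poly3
  Q3_eval (@ma_eval_monoid_morphism _ _ _ _ _ h1 hM).

Let evalZ k x : Q3_eval (k *: x) = k * Q3_eval x.
Proof.
rewrite -[x]mul1r scalerAl !rmorphM rmorph1 mul1r; congr (_ * _).
rewrite [1 in LHS]/GRing.one /= ma_basis.unlock ma_scaleU mulr1.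
by rewrite /Q3_eval ma_evalU h1 mulr1.
Qed.

Let eval_s i : Q3_eval (ma_basis _ (braid_gen i)) = a.
Proof. by rewrite /Q3_eval ma_eval_basis braid_eval_gen. Qed.

Let eval_sV i : Q3_eval (ma_basis _ (braid_gen i)^-1%g) = aV.
Proof. by rewrite /Q3_eval ma_eval_basis braid_eval_genV. Qed.

Let rel_morph (g : {rmorphism RB3 -> laurent_poly3}) x y :
    (forall k z, g (k *: z) = k * g z) ->
    (forall i, g (ma_basis _ (braid_gen i)) = a) ->
    (forall i, g (ma_basis _ (braid_gen i)^-1%g) = aV) ->
  Q3_rel x y -> g x = g y.
Proof.
move=> gZ gs gsV; case=> {x y}.
  exact: (@cubic_image _ _ g gZ a b c s1 (gs ord0)).
exact: (@skein_image _ _ g gZ a aV s1 s2 s1V s2V aaV (gs _) (gs _) (gsV _) (gsV _)).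
Qed.

Lemma Q3_rel_eval x y : Q3_rel x y -> Q3_eval x = Q3_eval y.
Proof. exact: rel_morph evalZ eval_s eval_sV. Qed.

Lemma Q3_augmented : exists e : Q3 -> laurent_poly3,
  [/\ e 1 = 1, forall u v, e (u + v) = e u + e v
    & forall k u, e (k *: u) = k * e u].
Proof. exact: quot_alg_augmented evalZ Q3_rel_eval. Qed.

Lemma Q3_neq0 : (1 : Q3) != 0.
Proof. exact: quot_alg_neq0 Q3_rel_eval. Qed.

HB.instance Definition _ := GRing.PzSemiRing_isNonZero.Build Q3 Q3_neq0.
HB.instance Definition _ := GRing.Lmodule_isLalgebra.Build laurent_poly3 Q3
  (@quot_scalerAl _ _ Q3_rel).
HB.instance Definition _ := GRing.Lalgebra_isAlgebra.Build laurent_poly3 Q3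
  (@quot_scalerAr _ _ Q3_rel).

End Q3.

Section Specialization.
Variables (F : fieldType) (alpha beta : F).

Local Notation K := (laurent_series F).

(* The ring morphism with a |-> -1, b |-> e^(h alpha), c |-> e^(h beta). *)
Definition spec_mon (m : Algebra.to_multiplicative (int * int * int)%type) : K :=
  (-1) ^ m.1.1 * laurent_exp alpha ^ m.1.2 * laurent_exp beta ^ m.2.

Definition spec : laurent_poly3 -> K := ma_eval intr spec_mon.

Lemma spec_mon1 : spec_mon 1%g = 1.
Proof. by rewrite /spec_mon /= !expr0z !mulr1. Qed.

Lemma spec_monM (m p : Algebra.to_multiplicative (int * int * int)%type) :
  spec_mon (m * p)%g = spec_mon m * spec_mon p.
Proof.
rewrite /spec_mon /= !expfzDr ?laurent_exp_neq0 ?oppr_eq0 ?oner_eq0 //.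
by rewrite [in RHS]mulrACA; congr (_ * _); rewrite mulrACA.
Qed.

HB.instance Definition _ :=
  GRing.isZmodMorphism.Build laurent_poly3 K spec (@ma_evalB _ _ _ _ _).
HB.instance Definition _ := GRing.isMonoidMorphism.Build laurent_poly3 K spec
  (@ma_eval_monoid_morphism _ _ _ _ _ spec_mon1 spec_monM).

Lemma spec_lmon i j k :
  spec (lmon i j k) = (-1) ^ i * laurent_exp alpha ^ j * laurent_exp beta ^ k.
Proof. exact: ma_eval_basis. Qed.

Lemma spec_a : spec (lmon 1 0 0) = -1.
Proof. by rewrite spec_lmon expr1z !expr0z !mulr1. Qed.

Lemma spec_b : spec (lmon 0 1 0) = laurent_exp alpha.
Proof. by rewrite spec_lmon expr1z !expr0z mulr1 mul1r. Qed.

Lemma spec_c : spec (lmon 0 0 1) = laurent_exp beta.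
Proof. by rewrite spec_lmon expr1z !expr0z !mul1r. Qed.

Definition Q3_ext := ext_scalars spec Q3.

HB.instance Definition _ := GRing.PzRing.on Q3_ext.
HB.instance Definition _ := GRing.Lmodule.on Q3_ext.
HB.instance Definition _ :=
  GRing.PzSemiRing_isNonZero.Build Q3_ext (ext_scalars_neq0 spec Q3_augmented).
HB.instance Definition _ := GRing.Lmodule_isLalgebra.Build K Q3_ext
  (@ext_scalars_scalerAl _ _ spec Q3).
HB.instance Definition _ := GRing.Lalgebra_isAlgebra.Build K Q3_ext
  (@ext_scalars_scalerAr _ _ spec Q3).

Variable n : nat.

Definition vogel_ext :=
  ext_scalars (@laurent_const F) (vogel_alg n alpha beta).

HB.instance Definition _ := GRing.PzRing.on vogel_ext.
HB.instance Definition _ := GRing.Lmodule.on vogel_ext.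
HB.instance Definition _ := GRing.PzSemiRing_isNonZero.Build vogel_ext
  (ext_scalars_neq0 (@laurent_const F) (vogel_augmented n alpha beta)).
HB.instance Definition _ := GRing.Lmodule_isLalgebra.Build K vogel_ext
  (@ext_scalars_scalerAl _ _ (@laurent_const F) (vogel_alg n alpha beta)).
HB.instance Definition _ := GRing.Lalgebra_isAlgebra.Build K vogel_ext
  (@ext_scalars_scalerAr _ _ (@laurent_const F) (vogel_alg n alpha beta)).

End Specialization.

Definition has_dimension (F : fieldType) (V : lmodType F) (n : nat) :=
  exists f : {linear V -> 'rV[F]_n}, bijective f.

Definition alg_isomorphic (F : fieldType) (A B : algType F) :=
  exists f : {lrmorphism A -> B}, bijective f.

(* Main.v *)
(** Both algebras are identified with the split semisimple algebra
    K^3 x M_2(K)^2 x M_3(K), of dimension 20.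

    Upper bound.  Write 1 as the sum of the three spectral projections of a
    generator s1 (with eigenvalues -1, b, c; for Vogel's algebra these are the
    common eigenvalues (-1, 0), (1, alpha), (1, beta) of (1 2) and t_12).  If v is
    an eigenvector of s1, the relations show that the left ideal generated by v
    is spanned by explicit vectors: 8 of them for -1 and 6 for each of the other
    two eigenvalues.  In Q_3 with a = -1, the skein relation applied to v with
    s1 v = x v becomes (s1 - x)(s1 + 1)(s2 - s2^-1) v = 0 as soon as x <> -1, which
    reduces 8 to 6; in Vogel's algebra one uses that t_12 + t_13 + t_23 is central.
    So each algebra is spanned by 8 + 6 + 6 = 20 elements.

    Lower bound.  Each algebra has three representations of dimension 1, two of
    dimension 2 and one of dimension 3, in which s1 is diagonal.  The image in
    the product contains the spectral projections of s1, and the projection for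
    the eigenvalue -1 cuts out a commutative corner K^4.  An element whose four
    coordinates in this corner are distinct separates the blocks, and each block
    is then full because the first row and column of s2 have no zero entry.

    Over C((h)) the required inequalities are checked on e^(h alpha) and
    e^(h beta) modulo h^2. *)
From HB Require Import structures.
Require Import Defs.
From mathcomp Require Import all_boot all_order all_algebra fingroup perm.
From mathcomp Require Import finmap monalg generic_quotient ring_quotient boolp.
From mathcomp Require Import reals complex ring.

Set Implicit Arguments.
Unset Strict Implicit.
Unset Printing Implicit Defensive.

Import Order.TTheory GRing.Theory Num.Theory VectorInternalTheory.

Local Open Scope ring_scope.

Local Notation i0 := (0 : 'I_3).
Local Notation i1 := (1 : 'I_3).
Local Notation i2 := (2%R : 'I_3).

(** * Spanning sequences *)

Section Span.
Variables (K : fieldType) (V : lmodType K).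
Implicit Types (X Y : seq V) (v w : V).

Definition in_span X v :=
  exists c : 'I_(size X) -> K, v = \sum_(i < size X) c i *: X`_i.

Lemma in_span0 X : in_span X 0.
Proof. by exists (fun=> 0); rewrite big1 // => i _; rewrite scale0r. Qed.

Lemma in_spanD X v w : in_span X v -> in_span X w -> in_span X (v + w).
Proof.
move=> [c ->] [d ->]; exists (fun i => c i + d i).
by rewrite -big_split; apply: eq_bigr => i _; rewrite scalerDl.
Qed.

Lemma in_spanZ X k v : in_span X v -> in_span X (k *: v).
Proof.
move=> [c ->]; exists (fun i => k * c i).
by rewrite scaler_sumr; apply: eq_bigr => i _; rewrite scalerA.
Qed.

Lemma in_spanN X v : in_span X v -> in_span X (- v).
Proof. by rewrite -scaleN1r; apply: in_spanZ. Qed.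

Lemma in_spanB X v w : in_span X v -> in_span X w -> in_span X (v - w).
Proof. by move=> Xv /in_spanN; apply: in_spanD. Qed.

Lemma mem_in_span X v : v \in X -> in_span X v.
Proof.
move=> Xv; have ltX : (index v X < size X)%N by rewrite index_mem.
exists (fun i => (i == Ordinal ltX)%:R).
rewrite (bigD1 (Ordinal ltX)) //= eqxx scale1r nth_index //.
by rewrite big1 ?addr0 // => i /negPf ->; rewrite scale0r.
Qed.

End Span.

Lemma in_span_linear (K : fieldType) (V W : lmodType K) (f : {linear V -> W})
    (X : seq V) (Y : seq W) v :
  (forall x, x \in X -> in_span Y (f x)) -> in_span X v -> in_span Y (f v).
Proof.
move=> XY [c ->]; rewrite linear_sum; apply: big_ind => [|*|i _].
- exact: in_span0.
- exact: in_spanD.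
- by rewrite linearZ; apply/in_spanZ/XY/mem_nth.
Qed.

Lemma in_span_trans (K : fieldType) (V : lmodType K) (X Y : seq V) v :
  (forall x, x \in X -> in_span Y x) -> in_span X v -> in_span Y v.
Proof. exact: (@in_span_linear _ _ _ (idfun : {linear V -> V})). Qed.

Lemma in_span_catl (K : fieldType) (V : lmodType K) (X Y : seq V) v :
  in_span X v -> in_span (X ++ Y) v.
Proof.
by apply: in_span_trans => x xX; apply: mem_in_span; rewrite mem_cat xX.
Qed.

Lemma in_span_catr (K : fieldType) (V : lmodType K) (X Y : seq V) v :
  in_span Y v -> in_span (X ++ Y) v.
Proof.
by apply: in_span_trans => x xY; apply: mem_in_span; rewrite mem_cat xY orbT.
Qed.

Lemma in_span_mull (K : fieldType) (A : algType K) (X Y : seq A) g v :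
  (forall x, x \in X -> in_span Y (g * x)) -> in_span X v -> in_span Y (g * v).
Proof.
exact: (@in_span_linear _ _ _ (g \*o (idfun : {linear A -> A}) : {linear A -> A})).
Qed.

Section SpanComb.
Variables (K : fieldType) (V : lmodType K) (n : nat) (x : 'I_n -> V).

Definition span_comb (c : 'rV[K]_n) : V := \sum_(i < n) c 0 i *: x i.

Lemma span_comb_linear : linear span_comb.
Proof.
move=> k c d; rewrite /span_comb scaler_sumr -big_split.
by apply: eq_bigr => i _; rewrite !mxE scalerDl scalerA.
Qed.

HB.instance Definition _ :=
  GRing.isLinear.Build K 'rV[K]_n V *:%R span_comb span_comb_linear.

End SpanComb.

Lemma span_surj_inj (K : fieldType) (V : lmodType K) (P : vectType K)
    (X : seq V) (f : {linear V -> P}) :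
    (forall v, in_span X v) -> (size X <= dim P)%N ->
    (forall p, exists v, f v = p) ->
  injective f.
Proof.
move=> spanX leXP surjf.
pose g := linfun (span_comb (fun i : 'I_(size X) => f X`_i)).
have fE v : exists c, v = \sum_(i < size X) (c : 'rV[K]_(size X)) 0 i *: X`_i /\ f v = g c.
  have [c cE] := spanX v; exists (\row_i c i); split.
    by rewrite cE; apply: eq_bigr => i _; rewrite mxE.
  by rewrite lfunE cE linear_sum; apply: eq_bigr => i _; rewrite mxE linearZ.
have limg_g : limg g = fullv.
  apply/eqP; rewrite eqEsubv subvf; apply/subvP => p _.
  have [v <-] := surjf p; have [c [_ ->]] := fE v.
  exact: memv_img (memvf _).
have ker_g : lker g == 0%VS.
  rewrite -dimv_eq0 -leqn0 -(leq_add2r (\dim (limg g))) add0n.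
  rewrite -[X in (X + _)%N]/(\dim (lker g)).
  have := limg_ker_dim g fullv; rewrite capfv => ->.
  by rewrite limg_g !dimvf /dim /= mul1n.
move=> v w /eqP; rewrite -subr_eq0 -linearB => /eqP fvw.
apply/eqP; rewrite -subr_eq0; apply/eqP.
have [c [vwE fc]] := fE (v - w).
have : c \in lker g by rewrite memv_ker -fc fvw.
rewrite (eqP ker_g) memv0 vwE => /eqP ->.
by rewrite big1 // => i _; rewrite mxE scale0r.
Qed.

Lemma inj_surj_bij (T U : choiceType) (f : T -> U) :
  injective f -> (forall u, exists t, f t = u) -> bijective f.
Proof.
move=> injf surjf; have surjfb u : exists t, f t == u.
  by have [t <-] := surjf u; exists t.
exists (fun u => xchoose (surjfb u)) => [t|u]; last exact/eqP/(xchooseP (surjfb u)).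
exact/injf/eqP/(xchooseP (surjfb (f t))).
Qed.

(** * Modules over Vogel's algebra *)

Ltac in_span_tac :=
  repeat first
    [ by apply: mem_in_span; rewrite !inE eqxx ?orbT
    | exact: in_span0
    | apply: in_spanD | apply: in_spanN | apply: in_spanZ ].

Section VogelModules.
Variables (K : fieldType) (A : algType K) (sigma pi : K) (s1 s2 t : A).
Hypotheses (two_neq0 : 2 != 0 :> K).
Hypotheses (s1K : s1 * s1 = 1) (s2K : s2 * s2 = 1).
Hypothesis braid : s1 * s2 * s1 = s2 * s1 * s2.
Hypotheses (s1t : s1 * t = t) (ts1 : t * s1 = t).
Hypothesis quad : t * t = sigma *: t - pi *: (1 + s1).

(* The images of t_12, t_13, t_23 are t, s2 t s2, s1 s2 t s2 s1. *)
Let T := t + s2 * t * s2 + s1 * s2 * t * s2 * s1.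
Hypothesis tT : t * T = T * t.

Definition sign_vectors v :=
  [:: v; s2 * v; s1 * (s2 * v); t * (s2 * v); s2 * (t * (s2 * v));
      s1 * (s2 * (t * (s2 * v))); t * (s2 * (t * (s2 * v)));
      s2 * (t * (s2 * (t * (s2 * v))))].

Definition triv_vectors v :=
  [:: v; s2 * v; s1 * (s2 * v); t * (s2 * v); s2 * (t * (s2 * v));
      s1 * (s2 * (t * (s2 * v)))].

Let s1KA x : s1 * (s1 * x) = x. Proof. by rewrite mulrA s1K mul1r. Qed.
Let s2KA x : s2 * (s2 * x) = x. Proof. by rewrite mulrA s2K mul1r. Qed.
Let s1tA x : s1 * (t * x) = t * x. Proof. by rewrite mulrA s1t. Qed.
Let ts1A x : t * (s1 * x) = t * x. Proof. by rewrite mulrA ts1. Qed.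
Let braidA x : s2 * (s1 * (s2 * x)) = s1 * (s2 * (s1 * x)).
Proof. by rewrite !mulrA braid. Qed.
Let ttA x : t * (t * x) = sigma *: (t * x) - pi *: (x + s1 * x).
Proof. by rewrite mulrA quad mulrBl -!scalerAl mulrDl mul1r. Qed.
Let TA x : T * x = t * x + s2 * (t * (s2 * x)) + s1 * (s2 * (t * (s2 * (s1 * x)))).
Proof. by rewrite !mulrDl !mulrA. Qed.
Let tTA x : t * (T * x) = T * (t * x). Proof. by rewrite !mulrA tT. Qed.

Lemma sign_vectors_stable v : s1 * v = - v -> 
  forall g, g \in [:: s1; s2; t] ->
  forall x, x \in sign_vectors v -> in_span (sign_vectors v) (g * x).
Proof.
move=> s1v.
have tv : t * v = 0.
  have : t * v = - (t * v) by rewrite -{1}ts1 -mulrA s1v mulrN.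
  move/eqP; rewrite -addr_eq0 -mulr2n -scaler_nat scaler_eq0 (negPf two_neq0).
  by move/eqP.
rewrite /sign_vectors; set p := s2 * v; set q := s1 * p; set m := t * p.
set m' := s2 * m; set m'' := s1 * m'; set y := t * m'; set y' := s2 * y.
have s2q : s2 * q = - q by rewrite /q /p braidA s1v !mulrN.
have tq : t * q = m by rewrite /q ts1A.
have s1m : s1 * m = m by rewrite s1tA.
have s2m'' : s2 * m'' = m'' by rewrite /m'' /m' braidA s1m.
have tm : t * m = sigma *: m - pi *: (p + q) by rewrite ttA.
have tm'' : t * m'' = y by rewrite /m'' ts1A.
have ty : t * y = sigma *: y - pi *: (m' + m'') by rewrite ttA.
have s1y : s1 * y = y by rewrite s1tA.
have s1y' : s1 * y' = - y - y'.
  have : t * (T * p) = T * (t * p) by exact: tTA.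
  rewrite !TA -/m s1m -/m' -/y -/y' /p s2KA tv mulr0 addr0 -/p -/q s2q mulrN tq.
  rewrite !mulrN -/m' -/m'' mulrBr tm'' -addrA => /addrI yE.
  by rewrite yE addrAC subrr add0r.
have ty' : t * y' = - 2^-1 *: (t * y).
  have tE : t * y' = - (t * y) - t * y'.
    by rewrite -{1}(ts1A y') s1y' mulrBr mulrN.
  apply: (scalerI two_neq0); rewrite scalerA mulrN divff // scaleN1r.
  by rewrite scaler_nat mulr2n {1}tE subrK.
have {}ty' : t * y' = - 2^-1 *: (sigma *: y - pi *: (m' + m'')) by rewrite ty' ty.
move=> g; rewrite !inE => /or3P[] /eqP -> x; rewrite !inE.
all: repeat case/predU1P => [->|]; last move/eqP->.
all: rewrite -/p -/q -/m -/m' -/m'' -/y -/y' 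
  ?(s1v, tv, s2q, tq, s1m, s2m'', tm, tm'', ty, s1y, s1y', ty').
all: rewrite ?s1KA ?s2KA; in_span_tac.
Qed.

Lemma triv_vectors_stable (lam : K) v : s1 * v = v -> t * v = lam *: v ->
  forall g, g \in [:: s1; s2; t] ->
  forall x, x \in triv_vectors v -> in_span (triv_vectors v) (g * x).
Proof.
move=> s1v tv.
rewrite /triv_vectors; set p := s2 * v; set q := s1 * p; set m := t * p.
set m' := s2 * m; set m'' := s1 * m'.
have s2q : s2 * q = q by rewrite /q /p braidA s1v.
have tq : t * q = m by rewrite /q ts1A.
have s1m : s1 * m = m by rewrite s1tA.
have s2m'' : s2 * m'' = m'' by rewrite /m'' /m' braidA s1m.
have tm : t * m = sigma *: m - pi *: (p + q) by rewrite ttA.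
have tm' : t * m' = (lam / 2) *: (m' + m'').
  have : t * (T * v) = T * (t * v) by exact: tTA.
  rewrite tv -scalerAr !TA s1v tv -/p -/m -/m' -/m''.
  rewrite 2!mulrDr -scalerAr tv !scalerDr -2!addrA => /addrI; rewrite -scalerDr.
  rewrite /m'' ts1A -/m'' => tE; apply: (scalerI two_neq0).
  by rewrite scalerA mulrCA divff // mulr1 scalerDr scaler_nat mulr2n tE.
have tm'' : t * m'' = (lam / 2) *: (m' + m'') by rewrite /m'' ts1A.
move=> g; rewrite !inE => /or3P[] /eqP -> x; rewrite !inE.
all: repeat case/predU1P => [->|]; last move/eqP->.
all: rewrite -/p -/q -/m -/m' -/m''
  ?(s1v, tv, s2q, tq, s1m, s2m'', tm, tm', tm'').
all: rewrite ?s1KA ?s2KA; in_span_tac.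
Qed.

End VogelModules.

(** * Modules over the cubic quotient of the braid algebra *)

Section BraidModules.
Variables (K : fieldType) (A : algType K) (p q r : K) (s1 s1V s2 s2V : A).
Hypotheses (r_neq0 : r != 0).
Hypotheses (s1K : s1 * s1V = 1) (s1VK : s1V * s1 = 1).
Hypotheses (s2K : s2 * s2V = 1) (s2VK : s2V * s2 = 1).
Hypothesis braid : s1 * s2 * s1 = s2 * s1 * s2.
Hypothesis cubic1 : s1 * s1 = p *: s1 + q *: 1 + r *: s1V.
Hypothesis cubic2 : s2 * s2 = p *: s2 + q *: 1 + r *: s2V.

(* The last vector is fixed up to a scalar by s1, because s2 s1^2 s2 commutes
   with s1. *)
Definition braid_vectors v :=
  [:: v; s2 * v; s2V * v; s1 * (s2 * v); s1V * (s2 * v); s1 * (s2V * v);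
      s1V * (s2V * v); s2 * (s1 * (s1 * (s2 * v)))].

Definition skein_vectors v :=
  [:: v; s2 * v; s2V * v; s1 * (s2 * v); s1V * (s2 * v); s1 * (s2V * v)].

Let s1KA x : s1 * (s1V * x) = x. Proof. by rewrite mulrA s1K mul1r. Qed.
Let s1VKA x : s1V * (s1 * x) = x. Proof. by rewrite mulrA s1VK mul1r. Qed.
Let s2KA x : s2 * (s2V * x) = x. Proof. by rewrite mulrA s2K mul1r. Qed.
Let s2VKA x : s2V * (s2 * x) = x. Proof. by rewrite mulrA s2VK mul1r. Qed.
Let braidA x : s2 * (s1 * (s2 * x)) = s1 * (s2 * (s1 * x)).
Proof. by rewrite !mulrA braid. Qed.
Let cubic1A x : s1 * (s1 * x) = p *: (s1 * x) + q *: x + r *: (s1V * x).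
Proof. by rewrite mulrA cubic1 !mulrDl -!scalerAl mul1r. Qed.
Let cubic2A x : s2 * (s2 * x) = p *: (s2 * x) + q *: x + r *: (s2V * x).
Proof. by rewrite mulrA cubic2 !mulrDl -!scalerAl mul1r. Qed.

Let braidVA x : s2 * (s1 * (s2V * x)) = s1V * (s2 * (s1 * x)).
Proof. by rewrite -[LHS]s1VKA -braidA s2KA. Qed.
Let braidVVA x : s2 * (s1V * (s2V * x)) = s1V * (s2V * (s1 * x)).
Proof. by rewrite -{2}[x]s2KA -{2}[s2V * x]s1KA -braidA s2VKA s1VKA. Qed.
Let braidVVA' x : s2V * (s1V * (s2 * x)) = s1 * (s2V * (s1V * x)).
Proof.
by rewrite -[RHS]s2VKA; congr (_ * _); rewrite braidVA s1KA.
Qed.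

Lemma eigenvectorV x v : x != 0 -> s1 * v = x *: v -> s1V * v = x^-1 *: v.
Proof.
by move=> x0 s1v; rewrite -[in RHS](s1VKA v) s1v -scalerAr scalerA mulVf ?scale1r.
Qed.

Lemma inverse_stable X : 
  (forall g, g \in [:: s1; s2] -> forall x, x \in X -> in_span X (g * x)) ->
  forall g, g \in [:: s1; s1V; s2; s2V] -> forall x, x \in X -> in_span X (g * x).
Proof.
move=> XX.
have Xmul g v : g \in [:: s1; s2] -> in_span X v -> in_span X (g * v).
  by move=> /XX; apply: in_span_mull.
have inv s sV x : s \in [:: s1; s2] -> s * (s * x) = p *: (s * x) + q *: x + r *: (sV * x) ->
    x \in X -> in_span X (sV * x).
  move=> ss cub xX; have Xx := mem_in_span xX.
  have -> : sV * x = r^-1 *: (s * (s * x) - p *: (s * x) - q *: x).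
    by rewrite cub -addrA -opprD addrAC subrr add0r scalerA mulVf ?scale1r.
  have sx : in_span X (s * x) by apply: Xmul.
  apply/in_spanZ/in_spanB; last exact: in_spanZ.
  by apply: in_spanB; [apply: Xmul | apply: in_spanZ].
move=> g; rewrite !inE => /or4P[] /eqP -> x xX.
- by apply: XX; rewrite ?inE ?eqxx.
- by apply: (inv s1); rewrite ?inE ?eqxx.
- by apply: XX; rewrite ?inE ?eqxx ?orbT.
- by apply: (inv s2); rewrite ?inE ?eqxx ?orbT.
Qed.

Lemma braid_vectors_stable x v : x != 0 -> s1 * v = x *: v ->
  forall g, g \in [:: s1; s2] ->
  forall w, w \in braid_vectors v -> in_span (braid_vectors v) (g * w).
Proof.
move=> x0 s1v; have s1Vv := eigenvectorV x0 s1v.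
rewrite /braid_vectors; set P := s2 * v; set N := s2V * v.
set P1 := s1 * P; set P1V := s1V * P; set N1 := s1 * N; set N1V := s1V * N.
set W := s2 * (s1 * P1).
have s1W : s1 * W = x *: W.
  by rewrite /W /P1 /P -braidA [s2 * (s1 * (s2 * v))]braidA s1v -!scalerAr.
have s2P : s2 * P = p *: P + q *: v + r *: N by rewrite cubic2A.
have s2P1 : s2 * P1 = x *: P1 by rewrite /P1 /P braidA s1v -!scalerAr.
have s2N1 : s2 * N1 = x *: P1V by rewrite /N1 /N braidVA s1v -!scalerAr.
have s2N1V : s2 * N1V = x *: N1V by rewrite /N1V /N braidVVA s1v -!scalerAr.
have s2P1V : s2 * P1V = r^-1 *: (W - p *: (x *: P1) - q *: (s2 * P)).
  by rewrite /W /P1 cubic1A 2!mulrDr -!scalerAr s2P1 -/P1V -addrA -opprD addrAC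
    subrr add0r scalerA mulVf ?scale1r.
have s2Vs1P1 : s2V * (s1 * P1) = p *: (s2V * P1) + q *: v + r *: (x^-1 *: N1).
  rewrite /P1 cubic1A 2!mulrDr -!scalerAr /P s2VKA.
  by rewrite braidVVA' s1Vv -!scalerAr.
have s2VP1 : s2V * P1 = x^-1 *: P1.
  by rewrite -[P1 in RHS](s2VKA) s2P1 -scalerAr scalerA mulVf ?scale1r.
have s1P1 : s1 * P1 = p *: P1 + q *: P + r *: P1V by rewrite cubic1A.
have s2W : s2 * W = p *: W + q *: (s1 * P1) +
    r *: (p *: (x^-1 *: P1) + q *: v + r *: (x^-1 *: N1)).
  by rewrite cubic2A s2Vs1P1 s2VP1.
have s1N1 : s1 * N1 = p *: N1 + q *: N + r *: N1V by rewrite cubic1A.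
move=> g; rewrite !inE => /orP[] /eqP -> w; rewrite !inE.
all: repeat case/predU1P => [->|]; last move/eqP->.
all: rewrite -/P -/N -/P1 -/P1V -/N1 -/N1V -/W
  ?(s1v, s1W, s2P1, s2N1, s2N1V, s2P1V, s2W, s1P1, s1N1, s2P).
all: rewrite ?s1KA ?s2KA; in_span_tac.
Qed.

Hypothesis skein : s1V * (s2 - s2V) * s1 - s1 * (s2 - s2V) * s1V =
  (s1 - s1V) * (s2 - s2V) - (s2 - s2V) * (s1 - s1V).

(* On v, the skein relation reads (s1 - x)(s1 + 1)(s2 - s2^-1) v = 0. *)
Lemma skein_eigenvector x v : x != 0 -> x + 1 != 0 -> s1 * v = x *: v ->
  x *: (s1V * ((s2 - s2V) * v)) =
  s1 * ((s2 - s2V) * v) - (x - 1) *: ((s2 - s2V) * v).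
Proof.
move=> x0 x1 s1v; have s1Vv := eigenvectorV x0 s1v.
move: skein; move: (s2 - s2V) => d dE; set D := d * v.
have {dE} : x *: (s1V * D) - x^-1 *: (s1 * D) = s1 * D - s1V * D - (x - x^-1) *: D.
  move/(congr1 ( *%R^~ v)): dE; rewrite !mulrBl -!mulrA [(s1 - s1V) * v]mulrBl.
  by rewrite s1v s1Vv -scalerBl -!scalerAr -/D.
move=> E.
have {}E : (x + 1) *: (s1V * D) = (1 + x^-1) *: (s1 * D) - (x - x^-1) *: D.
  rewrite [(x + 1) *: _]scalerDl [(1 + _) *: _]scalerDl !scale1r.
  rewrite (canRL (subrK _) E) -!addrA; congr (_ + _).
  by rewrite [_ + s1V * D]addrC [- _ + (s1V * D + _)]addrCA addKr addrC.
apply: (scalerI x1); rewrite scalerA mulrC -scalerA E !scalerBr !scalerA.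
by congr (_ *: _ - _ *: _); field.
Qed.

Lemma skein_vectors_stable x v : x != 0 -> x + 1 != 0 -> s1 * v = x *: v ->
  forall g, g \in [:: s1; s2] ->
  forall w, w \in skein_vectors v -> in_span (skein_vectors v) (g * w).
Proof.
move=> x0 x1 s1v; have sk := skein_eigenvector x0 x1 s1v.
suff sub w : in_span (braid_vectors v) w -> in_span (skein_vectors v) w.
  move=> g gs w ws; apply/sub/(braid_vectors_stable x0 s1v) => //.
  by move: ws; rewrite !inE => /or4P[|||/or3P[]] ->; rewrite ?orbT.
have s1VN : s1V * (s2V * v) = s1V * (s2 * v) - x^-1 *: (s1 * ((s2 - s2V) * v)
    - (x - 1) *: ((s2 - s2V) * v)).
  rewrite -sk scalerA mulVf // scale1r.
  by rewrite mulrBl mulrBr opprB addrC subrK.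
have P_s : in_span (skein_vectors v) (s2 * v) by in_span_tac.
have v_s : in_span (skein_vectors v) v by in_span_tac.
have N_s : in_span (skein_vectors v) (s2V * v) by in_span_tac.
have P1_s : in_span (skein_vectors v) (s1 * (s2 * v)) by in_span_tac.
have P1V_s : in_span (skein_vectors v) (s1V * (s2 * v)) by in_span_tac.
have N1_s : in_span (skein_vectors v) (s1 * (s2V * v)) by in_span_tac.
have N1V_s : in_span (skein_vectors v) (s1V * (s2V * v)).
  rewrite s1VN mulrBl mulrBr; apply: in_spanB => //; apply/in_spanZ.
  by apply: in_spanB; [|apply/in_spanZ]; apply: in_spanB.
have s2s2 : in_span (skein_vectors v) (s2 * (s2 * v)).
  by rewrite cubic2A; do 2?apply: in_spanD; apply: in_spanZ.
have w_s : in_span (skein_vectors v) (s2 * (s1V * (s2 * v))).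
  rewrite -[X in in_span _ X]scale1r -(mulVf x0) -scalerA; apply: in_spanZ.
  have : x *: (s2 * (s1V * ((s2 - s2V) * v))) = s2 * (s1 * ((s2 - s2V) * v)) -
      (x - 1) *: (s2 * ((s2 - s2V) * v)) by rewrite scalerAr sk mulrBr -scalerAr.
  rewrite mulrBl !mulrBr braidA braidVA braidVVA s2KA s1v => E.
  rewrite -[X in in_span _ X](subrK (x *: (s1V * (s2V * (x *: v))))) -scalerBr E.
  apply: in_spanD; last by rewrite -!scalerAr; do 2!apply: in_spanZ.
  apply: in_spanB; last by apply: in_spanZ; apply: in_spanB.
  by rewrite -!scalerAr; apply: in_spanB; apply: in_spanZ.
apply: in_span_trans => u; rewrite !inE => /or4P[/eqP->|/eqP->|/eqP->|] //.
case/or4P=> [/eqP->|/eqP->|/eqP->|/orP[/eqP->|/eqP->]] //.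
rewrite cubic1A 2!mulrDr -!scalerAr braidA s1v -!scalerAr.
by do 2?apply: in_spanD; do 2?apply: in_spanZ.
Qed.

End BraidModules.

Record Q3_model (K : fieldType) (B : algType K) (b c : K) (s1 s1V s2 s2V : B) : Prop := {
  model_s1K : s1 * s1V = 1;
  model_s1VK : s1V * s1 = 1;
  model_s2K : s2 * s2V = 1;
  model_s2VK : s2V * s2 = 1;
  model_braid : s1 * s2 * s1 = s2 * s1 * s2;
  model_cubic : (s1 + 1) * (s1 - b%:A) * (s1 - c%:A) = 0;
  model_skein : s1V * (s2 - s2V) * s1 - s1 * (s2 - s2V) * s1V =
    (s1 - s1V) * (s2 - s2V) - (s2 - s2V) * (s1 - s1V)
}.

(** * Subalgebras of a product of matrix algebras *)

Lemma delta_mul_delta (K : fieldType) (n : nat) (M : 'M[K]_n) i j :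
  delta_mx i i *m M *m delta_mx j j = M i j *: delta_mx i j.
Proof.
apply/matrixP => k l; rewrite !mxE (bigD1 j) //= big1 => [|m mj]; last first.
  by rewrite !mxE (negPf mj) mulr0.
rewrite !mxE (bigD1 i) //= big1 => [|m mi]; last by rewrite !mxE (negPf mi) andbF mul0r.
rewrite !mxE !eqxx andbT !addr0 /=.
by case: (k == i); case: (l == j); rewrite /= ?(mulr1, mul1r, mulr0, mul0r).
Qed.

Record matrix_subalgebra (K : fieldType) n (S : 'M[K]_n -> Prop) : Prop := {
  matrix_subalgebra0 : S 0;
  matrix_subalgebraD : forall M N, S M -> S N -> S (M + N);
  matrix_subalgebraZ : forall k M, S M -> S (k *: M);
  matrix_subalgebraM : forall M N, S M -> S N -> S (M *m N)
}.

Section MatrixSubalgebra.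
Variables (K : fieldType) (n : nat).
Variable (S : 'M[K]_n.+1 -> Prop).
Hypothesis HS : matrix_subalgebra S.

Lemma subalgebra_matrix_full : S (delta_mx 0 0) ->
  (forall i, i != 0 -> exists2 k, k != 0 & S (k *: delta_mx i 0)) ->
  (forall i, i != 0 -> exists2 k, k != 0 & S (k *: delta_mx 0 i)) ->
  forall M, S M.
Proof.
move=> S00 Scol Srow.
have unscale k M : k != 0 -> S (k *: M) -> S M.
  by move=> k0 /(matrix_subalgebraZ HS k^-1); rewrite scalerA mulVf ?scale1r.
have Si0 i : S (delta_mx i 0).
  by have [->//|/Scol[k k0]] := eqVneq i 0; apply: unscale.
have S0i i : S (delta_mx 0 i).
  by have [->//|/Srow[k k0]] := eqVneq i 0; apply: unscale.
move=> M; rewrite (matrix_sum_delta M).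
do 2![apply: big_ind => [||? _]; [exact: matrix_subalgebra0|exact: matrix_subalgebraD|]].
by apply: matrix_subalgebraZ => //; rewrite -(@mul_delta_mx _ _ n.+1 _ 0); apply: matrix_subalgebraM.
Qed.

End MatrixSubalgebra.

Section Blocks.
Variables (K : fieldType) (S : K -> K -> K -> 'M[K]_2 -> 'M[K]_2 -> 'M[K]_3 -> Prop).

Record block_subalgebra : Prop := {
  block_subalgebraD : forall x y z M N L x' y' z' M' N' L',
    S x y z M N L -> S x' y' z' M' N' L' ->
    S (x + x') (y + y') (z + z') (M + M') (N + N') (L + L');
  block_subalgebraZ : forall k x y z M N L,
    S x y z M N L -> S (k * x) (k * y) (k * z) (k *: M) (k *: N) (k *: L);
  block_subalgebraM : forall x y z M N L x' y' z' M' N' L',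
    S x y z M N L -> S x' y' z' M' N' L' ->
    S (x * x') (y * y') (z * z') (M *m M') (N *m N') (L *m L')
}.

Definition corner x y z t : Prop :=
  S x 0 0 (y *: delta_mx 0 0) (z *: delta_mx 0 0) (t *: delta_mx 0 0).

Hypothesis HS : block_subalgebra.

Lemma cornerM x y z t x' y' z' t' : corner x y z t -> corner x' y' z' t' ->
  corner (x * x') (y * y') (z * z') (t * t').
Proof.
move=> /(block_subalgebraM HS)/[apply]; rewrite /corner !mulr0.
by rewrite -!scalemxAl -!scalemxAr !mul_delta_mx !scalerA.
Qed.

Lemma cornerZ k x y z t : corner x y z t ->
  corner (k * x) (k * y) (k * z) (k * t).
Proof. by move=> /(block_subalgebraZ HS k); rewrite !mulr0 !scalerA. Qed.

Lemma cornerD x y z t x' y' z' t' : corner x y z t -> corner x' y' z' t' ->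
  corner (x + x') (y + y') (z + z') (t + t').
Proof.
by move=> /(block_subalgebraD HS)/[apply]; rewrite !addr0 -!scalerDl.
Qed.

Lemma cornerP gx gy gz gM gN gL :
  S 1 0 0 (delta_mx 0 0) (delta_mx 0 0) (delta_mx 0 0) -> S gx gy gz gM gN gL ->
  corner gx (gM 0 0) (gN 0 0) (gL 0 0).
Proof.
move=> S0 Sg; have := block_subalgebraM HS (block_subalgebraM HS S0 Sg) S0.
by rewrite !delta_mul_delta !mul0r mulr1 mul1r.
Qed.

(* The hypotheses SE0, SE1 and SE2 hold when S contains the spectral
   projections of a generator that is diagonal in every block, with eigenvalues
   0, 1 and 2 in the 1-dimensional blocks, (0, 1) and (0, 2) in the
   2-dimensional blocks and (0, 1, 2) in the 3-dimensional one. The corner of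
   the projection 0 is commutative, and an element with distinct entries
   separates the blocks in it. *)
Lemma block_subalgebra_full (m0 m1 m2 m3 gx gy gz : K) gM gN gL :
    S 1 0 0 (delta_mx 0 0) (delta_mx 0 0) (delta_mx 0 0) ->
    S 0 1 0 (delta_mx 1 1) 0 (delta_mx 1 1) ->
    S 0 0 1 0 (delta_mx 1 1) (delta_mx 2%R 2%R) ->
    corner m0 m1 m2 m3 -> uniq [:: m0; m1; m2; m3] ->
    S gx gy gz gM gN gL ->
    gM 0 1 != 0 -> gM 1 0 != 0 -> gN 0 1 != 0 -> gN 1 0 != 0 ->
    (forall i, i != 0 -> gL 0 i != 0) -> (forall i, i != 0 -> gL i 0 != 0) ->
  forall x y z M N L, S x y z M N L.
Proof.
move=> SE0 SE1 SE2 SX + Sg M01 M10 N01 N10 L0 Li; rewrite /= !inE !negb_or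
  => /and4P[/and3P[m01 m02 m03] /andP[m12 m13] m23 _].
case: (HS) => SD SZ SM.
have S1 : corner 1 1 1 1 by rewrite /corner !scale1r.
have Slin k : (corner (m0 - k) (m1 - k) (m2 - k) (m3 - k)).
  by have := cornerD SX (cornerZ (- k) S1); rewrite !mulr1.
have Scub k l n : (corner ((m0 - k) * (m0 - l) * (m0 - n)) ((m1 - k) * (m1 - l) * (m1 - n))
     ((m2 - k) * (m2 - l) * (m2 - n)) ((m3 - k) * (m3 - l) * (m3 - n))).
  by do 2?[apply: cornerM].
have e0 : (corner 1 0 0 0).
  have := Scub m1 m2 m3; rewrite !subrr !(mulr0, mul0r).
  move/(cornerZ ((m0 - m1) * (m0 - m2) * (m0 - m3))^-1); rewrite !mulr0 mulVf //.
  by rewrite !mulf_neq0 ?subr_eq0.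
have e1 : (corner 0 1 0 0).
  have := Scub m0 m2 m3; rewrite !subrr !(mulr0, mul0r).
  move/(cornerZ ((m1 - m0) * (m1 - m2) * (m1 - m3))^-1); rewrite !mulr0 mulVf //.
  by rewrite !mulf_neq0 ?subr_eq0 // eq_sym.
have e2 : (corner 0 0 1 0).
  have := Scub m0 m1 m3; rewrite !subrr !(mulr0, mul0r).
  move/(cornerZ ((m2 - m0) * (m2 - m1) * (m2 - m3))^-1); rewrite !mulr0 mulVf //.
  by rewrite !mulf_neq0 ?subr_eq0 // eq_sym.
have e3 : (corner 0 0 0 1).
  have := Scub m0 m1 m2; rewrite !subrr !(mulr0, mul0r).
  move/(cornerZ ((m3 - m0) * (m3 - m1) * (m3 - m2))^-1); rewrite !mulr0 mulVf //.
  by rewrite !mulf_neq0 ?subr_eq0 // eq_sym.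
have I2 (i : 'I_2) : i != 0 -> i = 1.
  by case: i => [[|[|//]] i] // _; apply/val_inj.
have I3 (i : 'I_3) : i != 0 -> i = 1 \/ i = 2%R.
  by case: i => [[|[|[|//]]] i] // _; [left|right]; apply/val_inj.
have SM2 M : S 0 0 0 M 0 0.
  pose S' M := S 0 0 0 M 0 0; rewrite -/(S' M).
  have HS' : matrix_subalgebra S'.
    split=> [|U V|k U|U V]; rewrite /S'.
    - by have := SZ 0 _ _ _ _ _ _ SE0; rewrite !mul0r !scale0r.
    - by move=> /SD/[apply]; rewrite !addr0.
    - by move=> /(SZ k); rewrite !mulr0 !scaler0.
    - by move=> /SM/[apply]; rewrite !mulr0 !mulmx0.
  have c0 : S' (delta_mx 0 0) by move: e1; rewrite /corner !scale0r scale1r.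
  apply: (subalgebra_matrix_full HS' c0) => i /I2 ->.
    exists (gM 1 0) => //; have := block_subalgebraM HS SE1 (block_subalgebraM HS Sg c0).
    rewrite !(mulr0, mul0r, mulmx0, mul0mx).
    by rewrite mulmxA delta_mul_delta.
  exists (gM 0 1) => //; have := block_subalgebraM HS c0 (block_subalgebraM HS Sg SE1).
  rewrite !(mulr0, mul0r, mulmx0, mul0mx).
  by rewrite mulmxA delta_mul_delta.
have SN2 M : S 0 0 0 0 M 0.
  pose S' M := S 0 0 0 0 M 0; rewrite -/(S' M).
  have HS' : matrix_subalgebra S'.
    split=> [|U V|k U|U V]; rewrite /S'.
    - by have := SZ 0 _ _ _ _ _ _ SE0; rewrite !mul0r !scale0r.
    - by move=> /SD/[apply]; rewrite !addr0.
    - by move=> /(SZ k); rewrite !mulr0 !scaler0.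
    - by move=> /SM/[apply]; rewrite !mulr0 !mulmx0.
  have c0 : S' (delta_mx 0 0) by move: e2; rewrite /corner !scale0r scale1r.
  apply: (subalgebra_matrix_full HS' c0) => i /I2 ->.
    exists (gN 1 0) => //; have := block_subalgebraM HS SE2 (block_subalgebraM HS Sg c0).
    rewrite !(mulr0, mul0r, mulmx0, mul0mx).
    by rewrite mulmxA delta_mul_delta.
  exists (gN 0 1) => //; have := block_subalgebraM HS c0 (block_subalgebraM HS Sg SE2).
  rewrite !(mulr0, mul0r, mulmx0, mul0mx).
  by rewrite mulmxA delta_mul_delta.
have SL3 L : S 0 0 0 0 0 L.
  pose S' L := S 0 0 0 0 0 L; rewrite -/(S' L).
  have HS' : matrix_subalgebra S'.
    split=> [|U V|k U|U V]; rewrite /S'.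
    - by have := SZ 0 _ _ _ _ _ _ SE0; rewrite !mul0r !scale0r.
    - by move=> /SD/[apply]; rewrite !addr0.
    - by move=> /(SZ k); rewrite !mulr0 !scaler0.
    - by move=> /SM/[apply]; rewrite !mulr0 !mulmx0.
  have c0 : S' (delta_mx 0 0) by move: e3; rewrite /corner !scale0r scale1r.
  apply: (subalgebra_matrix_full HS' c0) => i i0.
    exists (gL i 0); first exact: Li.
    case: (I3 _ i0) => ->;
      [have := block_subalgebraM HS SE1 (block_subalgebraM HS Sg c0)
      |have := block_subalgebraM HS SE2 (block_subalgebraM HS Sg c0)];
    by rewrite !(mulr0, mul0r, mulmx0, mul0mx) mulmxA delta_mul_delta.
  exists (gL 0 i); first exact: L0.
  case: (I3 _ i0) => ->;
    [have := block_subalgebraM HS c0 (block_subalgebraM HS Sg SE1)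
    |have := block_subalgebraM HS c0 (block_subalgebraM HS Sg SE2)];
  by rewrite !(mulr0, mul0r, mulmx0, mul0mx) mulmxA delta_mul_delta.
have Sx x : S x 0 0 0 0 0.
  by have := cornerZ x e0; rewrite /corner !mulr0 mulr1 !scale0r.
have Sy y : S 0 y 0 0 0 0.
  have := block_subalgebraD HS (SZ y _ _ _ _ _ _ SE1) (block_subalgebraD HS
    (SM2 (- y *: delta_mx 1 1)) (SL3 (- y *: delta_mx 1 1))).
  by rewrite !(mulr0, mulr1, addr0, add0r, scaler0) !scaleNr !subrr.
have Sz z : S 0 0 z 0 0 0.
  have := block_subalgebraD HS (SZ z _ _ _ _ _ _ SE2) (block_subalgebraD HS
    (SN2 (- z *: delta_mx 1 1)) (SL3 (- z *: delta_mx 2%R 2%R))).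
  by rewrite !(mulr0, mulr1, addr0, add0r, scaler0) !scaleNr !subrr.
move=> x y z M N L.
have := block_subalgebraD HS (block_subalgebraD HS (Sx x) (Sy y)) (Sz z).
move/(block_subalgebraD HS)/(_ (SM2 M))/(block_subalgebraD HS)/(_ (SN2 N)).
move/(block_subalgebraD HS)/(_ (SL3 L)).
by rewrite !(addr0, add0r).
Qed.

End Blocks.

Notation blocks K := (K^o * K^o * K^o * 'M[K]_2 * 'M[K]_2 * 'M[K]_3)%type.

Lemma block_subalgebra_image (K : fieldType) (A : algType K)
    (f : {lrmorphism A -> blocks K}) :
  block_subalgebra (fun (x y z : K) (M N : 'M_2) (L : 'M_3) =>
    exists a, f a = (x, y, z, M, N, L)).
Proof.
split=> [? ? ? ? ? ? ? ? ? ? ? ? [a fa] [a' fa']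
  |k ? ? ? ? ? ? [a fa]|? ? ? ? ? ? ? ? ? ? ? ? [a fa] [a' fa']].
- have fD : f (a + a') = f a + f a' by apply: rmorphD.
  by exists (a + a'); rewrite fD fa fa'.
- have fZ : f (k *: a) = k *: f a by apply: linearZ.
  by exists (k *: a); rewrite fZ fa.
- have fM : f (a * a') = f a * f a' by apply: rmorphM.
  by exists (a * a'); rewrite fM fa fa'.
Qed.

Lemma dim_blocks (K : fieldType) : dim (blocks K) = 20.
Proof.
have dim_pair (U V : vectType K) : dim (U * V)%type = (dim U + dim V)%N by [].
rewrite [LHS]dim_pair [X in (X + _)%N]dim_pair [X in (X + _ + _)%N]dim_pair.
by rewrite [X in (X + _ + _ + _)%N]dim_pair [X in (X + _ + _ + _ + _)%N]dim_pair.
Qed.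

(** * Representations of the quotient Q3 *)

Section ExplicitMatrices.
Variable K : fieldType.

Definition mx2 (a b c d : K) : 'M[K]_2 :=
  \matrix_(i < 2, j < 2) nth 0 (nth [::] [:: [:: a; b]; [:: c; d]] i) j.

Definition mx3 (a b c d e f g h k : K) : 'M[K]_3 :=
  \matrix_(i < 3, j < 3)
    nth 0 (nth [::] [:: [:: a; b; c]; [:: d; e; f]; [:: g; h; k]] i) j.

Lemma mx2P (M N : 'M[K]_2) :
  M 0 0 = N 0 0 -> M 0 1 = N 0 1 -> M 1 0 = N 1 0 -> M 1 1 = N 1 1 -> M = N.
Proof.
move=> M00 M01 M10 M11; apply/matrixP => i j.
have I2 (k : 'I_2) : k = 0 \/ k = 1.
  by case: k => [[|[|//]] k]; [left|right]; apply/val_inj.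
by case: (I2 i) => ->; case: (I2 j) => ->.
Qed.

Lemma mx3P (M N : 'M[K]_3) :
    M 0 0 = N 0 0 -> M 0 1 = N 0 1 -> M 0 2%R = N 0 2%R ->
    M 1 0 = N 1 0 -> M 1 1 = N 1 1 -> M 1 2%R = N 1 2%R ->
    M 2%R 0 = N 2%R 0 -> M 2%R 1 = N 2%R 1 -> M 2%R 2%R = N 2%R 2%R -> M = N.
Proof.
move=> M00 M01 M02 M10 M11 M12 M20 M21 M22; apply/matrixP => i j.
have I3 (k : 'I_3) : [\/ k = 0, k = 1 | k = 2%R].
  by case: k => [[|[|[|//]]] k]; [apply: Or31|apply: Or32|apply: Or33]; apply/val_inj.
by case: (I3 i) => ->; case: (I3 j) => ->.
Qed.

Lemma mulmx2 a b c d a' b' c' d' : mx2 a b c d *m mx2 a' b' c' d' =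
  mx2 (a * a' + b * c') (a * b' + b * d') (c * a' + d * c') (c * b' + d * d').
Proof. by apply: mx2P; rewrite !mxE !big_ord_recl big_ord0 !mxE /= addr0. Qed.

Lemma mx2M a b c d a' b' c' d' : mx2 a b c d * mx2 a' b' c' d' =
  mx2 (a * a' + b * c') (a * b' + b * d') (c * a' + d * c') (c * b' + d * d').
Proof. exact: mulmx2. Qed.

Lemma mx2D a b c d a' b' c' d' : mx2 a b c d + mx2 a' b' c' d' =
  mx2 (a + a') (b + b') (c + c') (d + d').
Proof. by apply: mx2P; rewrite !mxE. Qed.

Lemma mx2N a b c d : - mx2 a b c d = mx2 (- a) (- b) (- c) (- d).
Proof. by apply: mx2P; rewrite !mxE. Qed.

Lemma mx2Z k a b c d : k *: mx2 a b c d = mx2 (k * a) (k * b) (k * c) (k * d).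
Proof. by apply: mx2P; rewrite !mxE. Qed.

Lemma mx2_1 : 1 = mx2 1 0 0 1.
Proof. by apply: mx2P; rewrite !mxE. Qed.

Lemma mx2_0 : 0 = mx2 0 0 0 0.
Proof. by apply: mx2P; rewrite !mxE. Qed.

Lemma mulmx3 a b c d e f g h k a' b' c' d' e' f' g' h' k' :
  mx3 a b c d e f g h k *m mx3 a' b' c' d' e' f' g' h' k' =
  mx3 (a * a' + b * d' + c * g') (a * b' + b * e' + c * h') (a * c' + b * f' + c * k')
      (d * a' + e * d' + f * g') (d * b' + e * e' + f * h') (d * c' + e * f' + f * k')
      (g * a' + h * d' + k * g') (g * b' + h * e' + k * h') (g * c' + h * f' + k * k').
Proof. by apply: mx3P; rewrite !mxE !big_ord_recl big_ord0 !mxE /= addr0 addrA. Qed.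

Lemma mx3M a b c d e f g h k a' b' c' d' e' f' g' h' k' :
  mx3 a b c d e f g h k * mx3 a' b' c' d' e' f' g' h' k' =
  mx3 (a * a' + b * d' + c * g') (a * b' + b * e' + c * h') (a * c' + b * f' + c * k')
      (d * a' + e * d' + f * g') (d * b' + e * e' + f * h') (d * c' + e * f' + f * k')
      (g * a' + h * d' + k * g') (g * b' + h * e' + k * h') (g * c' + h * f' + k * k').
Proof. exact: mulmx3. Qed.

Lemma mx3D a b c d e f g h k a' b' c' d' e' f' g' h' k' :
  mx3 a b c d e f g h k + mx3 a' b' c' d' e' f' g' h' k' =
  mx3 (a + a') (b + b') (c + c') (d + d') (e + e') (f + f') (g + g') (h + h') (k + k').
Proof. by apply: mx3P; rewrite !mxE. Qed.

Lemma mx3N a b c d e f g h k : - mx3 a b c d e f g h k =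
  mx3 (- a) (- b) (- c) (- d) (- e) (- f) (- g) (- h) (- k).
Proof. by apply: mx3P; rewrite !mxE. Qed.

Lemma mx3Z l a b c d e f g h k : l *: mx3 a b c d e f g h k =
  mx3 (l * a) (l * b) (l * c) (l * d) (l * e) (l * f) (l * g) (l * h) (l * k).
Proof. by apply: mx3P; rewrite !mxE. Qed.

Lemma mx3_1 : 1 = mx3 1 0 0 0 1 0 0 0 1.
Proof. by apply: mx3P; rewrite !mxE. Qed.

Lemma mx3_0 : 0 = mx3 0 0 0 0 0 0 0 0 0.
Proof. by apply: mx3P; rewrite !mxE. Qed.

End ExplicitMatrices.

Section Q3Models.
Variables (K : fieldType) (b c : K).

Lemma Q3_model_pair (A B : algType K) (s1 s1V s2 s2V : A) (t1 t1V t2 t2V : B) :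
  Q3_model b c s1 s1V s2 s2V -> Q3_model b c t1 t1V t2 t2V ->
  Q3_model b c (s1, t1) (s1V, t1V) (s2, t2) (s2V, t2V).
Proof.
by case=> ? ? ? ? ? ? ? [? ? ? ? ? ? ?]; split; apply: (f_equal2 pair).
Qed.

Lemma Q3_model1 (x : K) : x != 0 -> (x + 1) * (x - b) * (x - c) = 0 ->
  Q3_model b c (x : K^o) x^-1 x x^-1.
Proof.
move=> x0 xE; split; rewrite ?mulfV ?mulVf //; last first.
  by rewrite [X in X - _]mulrAC [X in _ - X]mulrAC mulfV // mulVf // mul1r !subrr.
by rewrite -[b%:A]/(b * 1) -[c%:A]/(c * 1) !mulr1.
Qed.

Lemma Q3_model_sym (B : algType K) (s1 s1V s2 s2V : B) :
  Q3_model c b s1 s1V s2 s2V -> Q3_model b c s1 s1V s2 s2V.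
Proof.
case=> ? ? ? ? ? cubic ?; split=> //; rewrite -mulrA -[RHS]cubic -mulrA.
congr (_ * _); rewrite !mulrBr !mulrBl -!scalerAl -!scalerAr !mul1r !mulr1.
by rewrite !scalerA [c * b]mulrC !opprB !addrA [LHS]addrAC [RHS]addrAC
  [_ - _ - _ in LHS]addrAC.
Qed.

Hypotheses (b0 : b != 0) (c0 : c != 0) (b1 : b + 1 != 0) (c1 : c + 1 != 0).
Hypothesis bc : b - c != 0.

Lemma Q3_model2 : Q3_model b c
  (mx2 (-1) 0 0 b) (mx2 (-1) 0 0 b^-1)
  (mx2 (b ^+ 2 / (b + 1)) 1 (b * (1 + b + b ^+ 2) / (b + 1) ^+ 2) (- (b + 1)^-1))
  (mx2 (b * (b + 1))^-1 b^-1 ((1 + b + b ^+ 2) / (b + 1) ^+ 2) (- (b / (b + 1)))).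
Proof.
by split; rewrite !(mx2_1, mx2_0, mx2Z, mx2M, mx2D, mx2N); congr mx2; field; rewrite ?b0 ?b1.
Qed.

Definition skein_c1 := - (b * c * (1 + b * c) / ((b + 1) * (c + 1))).
Definition skein_c2 := - (c * (b ^+ 2 - c) / (b * (b + 1) * (b - c))).
Definition skein_c3 := b * (c ^+ 2 - b) / (c * (c + 1) * (b - c)).

(* With (l1, l2, l3) = (-1, b, c), s2 is the sum of the diagonal matrix
   - l1 l2 l3 s1^-2 and of the rank 1 matrix with constant rows skein_c. *)
Lemma Q3_model3 : Q3_model b c
  (mx3 (-1) 0 0 0 b 0 0 0 c) (mx3 (-1) 0 0 0 b^-1 0 0 0 c^-1)
  (mx3 (skein_c1 + b * c) skein_c1 skein_c1
       skein_c2 (skein_c2 + c / b) skein_c2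
       skein_c3 skein_c3 (skein_c3 + b / c))
  (mx3 (skein_c1 / (b * c) ^+ 2 + (b * c)^-1) (skein_c1 / c ^+ 2) (skein_c1 / b ^+ 2)
       (skein_c2 / c ^+ 2) (skein_c2 * b ^+ 2 / c ^+ 2 + b / c) skein_c2
       (skein_c3 / b ^+ 2) skein_c3 (skein_c3 * c ^+ 2 / b ^+ 2 + c / b)).
Proof.
rewrite /skein_c1 /skein_c2 /skein_c3.
by split; rewrite !(mx3_1, mx3_0, mx3Z, mx3M, mx3D, mx3N); congr mx3;
  field; rewrite ?b0 ?c0 ?b1 ?c1 ?bc.
Qed.

End Q3Models.

Section SpectralProjections.
Variables (K : fieldType) (A : algType K) (b c : K) (s : A).
Hypotheses (b1 : b + 1 != 0) (c1 : c + 1 != 0) (bc : b - c != 0).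
Hypothesis cubic : (s + 1) * (s - b%:A) * (s - c%:A) = 0.

Definition eigenpoly (x y k : K) : {poly K} := k *: (('X - x%:P) * ('X - y%:P)).

Definition proj_a := horner_alg s (eigenpoly b c ((b + 1) * (c + 1))^-1).
Definition proj_b := horner_alg s (eigenpoly (-1) c ((b + 1) * (b - c))^-1).
Definition proj_c := horner_alg s (eigenpoly (-1) b (- ((c + 1) * (b - c))^-1)).

Lemma proj_sum : 1 = proj_a + proj_b + proj_c.
Proof.
rewrite /proj_a /proj_b /proj_c -!rmorphD /= -[LHS](rmorph1 (horner_alg s)).
congr (horner_alg s _).
rewrite /eigenpoly.
have D0 : (b + 1) * (c + 1) * (b - c) != 0 by rewrite !mulf_neq0.
apply: (scalerI D0); rewrite !scalerDr !scalerA.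
have -> : (b + 1) * (c + 1) * (b - c) / ((b + 1) * (c + 1)) = b - c.
  by field; rewrite b1 c1.
have -> : (b + 1) * (c + 1) * (b - c) / ((b + 1) * (b - c)) = c + 1.
  by field; rewrite b1 bc.
have -> : (b + 1) * (c + 1) * (b - c) * (- ((c + 1) * (b - c))^-1) = - (b + 1).
  by field; rewrite c1 bc.
rewrite -!mul_polyC !(polyCD, polyCN, polyCM, polyC1); ring.
Qed.

Lemma eigen_horner x P Q : 'X * P = x *: P + Q * (('X + 1) * ('X - b%:P) * ('X - c%:P)) ->
  s * horner_alg s P = x *: horner_alg s P.
Proof.
move=> PE; rewrite -{1}[s](horner_algX s) -rmorphM PE -mul_polyC.
rewrite !(rmorphD, rmorphM, rmorphN, rmorph1) /= !horner_algC horner_algX mulr_algl.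
by rewrite cubic mulr0 addr0.
Qed.

Lemma proj_aE : s * proj_a = -1 *: proj_a.
Proof.
apply: (@eigen_horner _ _ ((b + 1) * (c + 1))^-1%:P).
rewrite /eigenpoly -!mul_polyC polyCN polyC1; ring.
Qed.

Lemma proj_bE : s * proj_b = b *: proj_b.
Proof.
apply: (@eigen_horner _ _ ((b + 1) * (b - c))^-1%:P).
rewrite /eigenpoly -!mul_polyC polyCN polyC1; ring.
Qed.

Lemma proj_cE : s * proj_c = c *: proj_c.
Proof.
apply: (@eigen_horner _ _ (- ((c + 1) * (b - c))^-1)%:P).
rewrite /eigenpoly -!mul_polyC !polyCN polyC1; ring.
Qed.

End SpectralProjections.

Lemma Q3_model_span (K : fieldType) (A : algType K) (b c : K) (s1 s1V s2 s2V : A) :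
    Q3_model b c s1 s1V s2 s2V ->
    b != 0 -> c != 0 -> b + 1 != 0 -> c + 1 != 0 -> b - c != 0 ->
  exists X : seq A, [/\ size X = 20%N, in_span X 1 &
    forall g, g \in [:: s1; s1V; s2; s2V] -> forall x, x \in X -> in_span X (g * x)].
Proof.
case=> s1K s1VK s2K s2VK braid cubic skein b0 c0 b1 c1 bc.
set p := b + c - 1; set q := b + c - b * c; pose r := - (b * c).
have r0 : r != 0 by rewrite oppr_eq0 mulf_neq0.
have cubic1 : s1 * s1 = p *: s1 + q *: 1 + r *: s1V.
  have cubic0 : s1 * (s1 * s1) = p *: (s1 * s1) + q *: s1 + r *: 1.
    have E : 'X * ('X * 'X) = p%:P * ('X * 'X) + q%:P * 'X + r%:P +
        ('X + 1) * ('X - b%:P) * ('X - c%:P).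
      by rewrite /p /q /r !(polyCD, polyCN, polyCM, polyC1); ring.
    move/(congr1 (horner_alg s1)): E; move: p q r {r0} => p q r.
    rewrite !(rmorphD, rmorphM, rmorphN, rmorph1) /= !horner_algC horner_algX cubic.
    by rewrite !mulr_algl addr0.
  rewrite -[LHS](mulr1) -s1K !mulrA -[_ * s1]mulrA cubic0 !mulrDl -!scalerAl.
  by rewrite mul1r -mulrA s1K mulr1.
have cubic2 : s2 * s2 = p *: s2 + q *: 1 + r *: s2V.
  have [u [uV [uK uVK us1]]] : exists u uV, [/\ u * uV = 1, uV * u = 1 & u * s1 = s2 * u].
    exists (s1 * s2), (s2V * s1V); split; last by rewrite braid mulrA.
      by rewrite mulrA -[s1 * _ * _]mulrA s2K mulr1 s1K.
    by rewrite mulrA -[s2V * _ * _]mulrA s1VK mulr1 s2VK.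
  have s2E : s2 = u * s1 * uV by rewrite us1 -mulrA uK mulr1.
  have s2VE : s2V = u * s1V * uV.
    rewrite -[RHS]mul1r -s2VK s2E -!mulrA [uV * (u * _)]mulrA uVK mul1r.
    by rewrite [s1 * (s1V * _)]mulrA s1K mul1r uK mulr1.
  rewrite {1}s2E {1}s2E -!mulrA [uV * (u * _)]mulrA uVK mul1r [s1 * (s1 * _)]mulrA cubic1.
  rewrite !mulrDl !mulrDr -!scalerAl -!scalerAr !mulrA -s2E -s2VE mulr1.
  by rewrite uK.
pose e1 := proj_a b c s1; pose e2 := proj_b b c s1; pose e3 := proj_c b c s1.
pose X1 := braid_vectors s1 s1V s2 s2V e1.
pose X2 := skein_vectors s1 s1V s2 s2V e2; pose X3 := skein_vectors s1 s1V s2 s2V e3.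
have st1 := inverse_stable r0 cubic1 cubic2 (braid_vectors_stable r0 s1K s1VK s2K s2VK braid
   cubic1 cubic2 (_ : -1 != 0) (proj_aE cubic)).
have st2 := inverse_stable r0 cubic1 cubic2 (skein_vectors_stable r0 s1K s1VK s2K s2VK braid
   cubic1 cubic2 skein b0 b1 (proj_bE cubic)).
have st3 := inverse_stable r0 cubic1 cubic2 (skein_vectors_stable r0 s1K s1VK s2K s2VK braid
   cubic1 cubic2 skein c0 c1 (proj_cE cubic)).
exists (X1 ++ X2 ++ X3); split=> //.
  rewrite (proj_sum s1 b1 c1 bc) -addrA.
  apply: in_spanD; first by apply: in_span_catl; in_span_tac.
  by apply/in_span_catr/in_spanD; [apply: in_span_catl|apply: in_span_catr]; in_span_tac.
move=> g gs x; rewrite !mem_cat => /or3P[] xX.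
- by apply/in_span_catl/st1 => //; rewrite oppr_eq0 oner_eq0.
- by apply/in_span_catr/in_span_catl/st2.
- by apply/in_span_catr/in_span_catr/st3.
Qed.

Section Q3Blocks.
Variables (K : fieldType) (b c : K).
Hypotheses (b0 : b != 0) (c0 : c != 0) (b1 : b + 1 != 0) (c1 : c + 1 != 0).
Hypothesis bc : b - c != 0.

Lemma Q3_model_blocks : exists s1 s1V s2 s2V : blocks K,
  [/\ Q3_model b c s1 s1V s2 s2V,
     s1 = (-1, b, c, mx2 (-1) 0 0 b, mx2 (-1) 0 0 c, mx3 (-1) 0 0 0 b 0 0 0 c) &
     s2 = (-1, b, c,
      mx2 (b ^+ 2 / (b + 1)) 1 (b * (1 + b + b ^+ 2) / (b + 1) ^+ 2) (- (b + 1)^-1),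
      mx2 (c ^+ 2 / (c + 1)) 1 (c * (1 + c + c ^+ 2) / (c + 1) ^+ 2) (- (c + 1)^-1),
      mx3 (skein_c1 b c + b * c) (skein_c1 b c) (skein_c1 b c)
       (skein_c2 b c) (skein_c2 b c + c / b) (skein_c2 b c)
       (skein_c3 b c) (skein_c3 b c) (skein_c3 b c + b / c))].
Proof.
have ma : Q3_model b c (-1 : K^o) (-1)^-1 (-1) (-1)^-1.
  by apply: Q3_model1; rewrite ?oppr_eq0 ?oner_eq0 // addNr !mul0r.
have mb : Q3_model b c (b : K^o) b^-1 b b^-1.
  by apply: Q3_model1; rewrite // subrr mulr0 mul0r.
have mc : Q3_model b c (c : K^o) c^-1 c c^-1.
  by apply: Q3_model1; rewrite // subrr mulr0.
have mab := Q3_model2 c b0 b1; have mac := Q3_model_sym (Q3_model2 b c0 c1).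
have mabc := Q3_model3 b0 c0 b1 c1 bc.
have m := Q3_model_pair (Q3_model_pair (Q3_model_pair (Q3_model_pair (Q3_model_pair
  ma mb) mc) mab) mac) mabc.
by do 4!eexists; split; [exact: m | |].
Qed.

Lemma Q3_blocks_surj (S : K -> K -> K -> 'M[K]_2 -> 'M[K]_2 -> 'M[K]_3 -> Prop) :
    b ^+ 2 + b + 1 != 0 -> c ^+ 2 + c + 1 != 0 -> b * c + b + c != 0 ->
    b * c * (b + c) + (b + 1) * (c + 1) != 0 -> c ^+ 2 - b != 0 -> b ^+ 2 - c != 0 ->
    1 + b * c != 0 ->
    block_subalgebra S -> S 1 1 1 1 1 1 ->
    S (-1) b c (mx2 (-1) 0 0 b) (mx2 (-1) 0 0 c) (mx3 (-1) 0 0 0 b 0 0 0 c) ->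
    S (-1) b c
      (mx2 (b ^+ 2 / (b + 1)) 1 (b * (1 + b + b ^+ 2) / (b + 1) ^+ 2) (- (b + 1)^-1))
      (mx2 (c ^+ 2 / (c + 1)) 1 (c * (1 + c + c ^+ 2) / (c + 1) ^+ 2) (- (c + 1)^-1))
      (mx3 (skein_c1 b c + b * c) (skein_c1 b c) (skein_c1 b c)
       (skein_c2 b c) (skein_c2 b c + c / b) (skein_c2 b c)
       (skein_c3 b c) (skein_c3 b c) (skein_c3 b c + b / c)) ->
  forall x y z M N L, S x y z M N L.
Proof.
move=> b2 c2 bc2 bc3 cb bb bc1 HS S1 Ss1 Ss2.
have Sproj u v k : S (k * ((-1 - u) * (-1 - v))) (k * ((b - u) * (b - v)))
    (k * ((c - u) * (c - v)))
    (mx2 (k * ((-1 - u) * (-1 - v))) 0 0 (k * ((b - u) * (b - v))))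
    (mx2 (k * ((-1 - u) * (-1 - v))) 0 0 (k * ((c - u) * (c - v))))
    (mx3 (k * ((-1 - u) * (-1 - v))) 0 0 0 (k * ((b - u) * (b - v))) 0
         0 0 (k * ((c - u) * (c - v)))).
  have Ssub w := block_subalgebraD HS Ss1 (block_subalgebraZ HS (- w) S1).
  have := block_subalgebraZ HS k (block_subalgebraM HS (Ssub u) (Ssub v)).
  rewrite mx2_1 mx3_1 !mx2Z !mx3Z !mx2D !mx3D !mulmx2 mulmx3.
  by rewrite !mx2Z !mx3Z !(mulr0, mulr1, addr0, mul0r, add0r).
have SE0 : S 1 0 0 (delta_mx 0 0) (delta_mx 0 0) (delta_mx 0 0).
  have := Sproj b c ((b + 1) * (c + 1))^-1; rewrite !subrr !(mulr0, mul0r).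
  have -> : ((b + 1) * (c + 1))^-1 * ((-1 - b) * (-1 - c)) = 1 by field; rewrite b1 c1.
  congr S; first [by apply: mx2P; rewrite !mxE | by apply: mx3P; rewrite !mxE].
have SE1 : S 0 1 0 (delta_mx 1 1) 0 (delta_mx 1 1).
  have := Sproj (-1) c ((b + 1) * (b - c))^-1; rewrite !subrr !opprK !(mulr0, mul0r).
  rewrite mulVf ?mulf_neq0 //.
  congr S; first [by apply: mx2P; rewrite !mxE | by apply: mx3P; rewrite !mxE].
have SE2 : S 0 0 1 0 (delta_mx 1 1) (delta_mx 2%R 2%R).
  have := Sproj (-1) b (- ((c + 1) * (b - c))^-1); rewrite !subrr !opprK !(mulr0, mul0r).
  have -> : - ((c + 1) * (b - c))^-1 * ((c + 1) * (c - b)) = 1 by field; rewrite c1 bc.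
  congr S; first [by apply: mx2P; rewrite !mxE | by apply: mx3P; rewrite !mxE].
apply: (block_subalgebra_full HS SE0 SE1 SE2 (cornerP HS SE0 Ss2) _ Ss2).
- have neq (x y k l : K) : k != 0 -> l != 0 -> x - y = k / l -> x != y.
    by move=> k0 l0 xy; rewrite -subr_eq0 xy mulf_neq0 ?invr_neq0.
  rewrite !mxE /= !inE !negb_or /skein_c1 !andbT.
  apply/and3P; split; [apply/and3P; split| apply/andP; split |].
  + by apply: (neq _ _ (- (b ^+ 2 + b + 1)) (b + 1)); rewrite ?oppr_eq0 //; field; rewrite b1.
  + by apply: (neq _ _ (- (c ^+ 2 + c + 1)) (c + 1)); rewrite ?oppr_eq0 //; field; rewrite c1.
  + apply: (neq _ _ (- (b * c * (b + c) + (b + 1) * (c + 1))) ((b + 1) * (c + 1)));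
      by rewrite ?oppr_eq0 ?mulf_neq0 //; field; rewrite b1 c1.
  + apply: (neq _ _ ((b - c) * (b * c + b + c)) ((b + 1) * (c + 1)));
      by rewrite ?mulf_neq0 //; field; rewrite b1 c1.
  + apply: (neq _ _ (- (b * (c ^+ 2 - b))) ((b + 1) * (c + 1)));
      by rewrite ?oppr_eq0 ?mulf_neq0 //; field; rewrite b1 c1.
  + apply: (neq _ _ (- (c * (b ^+ 2 - c))) ((b + 1) * (c + 1)));
      by rewrite ?oppr_eq0 ?mulf_neq0 //; field; rewrite b1 c1.
- by rewrite mxE oner_eq0.
- rewrite mxE /= !mulf_neq0 ?invr_neq0 ?expf_neq0 //.
  by rewrite addrC [1 + _]addrC addrA.
- by rewrite mxE oner_eq0.
- rewrite mxE /= !mulf_neq0 ?invr_neq0 ?expf_neq0 //.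
  by rewrite addrC [1 + _]addrC addrA.
- have nz : skein_c1 b c != 0 by rewrite oppr_eq0 !mulf_neq0 ?invr_neq0 ?mulf_neq0.
  by move=> [[|[|[|//]]] i] // _; rewrite mxE.
- have nz2 : skein_c2 b c != 0 by rewrite oppr_eq0 !mulf_neq0 ?invr_neq0 ?mulf_neq0.
  have nz3 : skein_c3 b c != 0 by rewrite !mulf_neq0 ?invr_neq0 ?mulf_neq0.
  by move=> [[|[|[|//]]] i] // _; rewrite mxE.
Qed.

End Q3Blocks.

(** * Representations of Vogel's algebra *)

Record vogel_model3 (K : fieldType) (B : algType K) (alpha beta : K)
    (w : 'S_3 -> B) (t : 'I_3 -> 'I_3 -> B) : Prop := {
  vogel_model1 : w 1%g = 1;
  vogel_modelM : forall u v, w u * w v = w (v * u)%g;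
  vogel_model_sym : forall i j, i != j -> t i j = t j i;
  vogel_model_conj : forall u i j, i != j -> w u * t i j * w u^-1%g = t (u i) (u j);
  vogel_model_comm3 : forall i j k, i != j -> i != k -> k != j ->
    t i j * (t i k + t k j) = (t i k + t k j) * t i j;
  vogel_model_tr : forall i j, i != j -> t i j * w (tperm i j) = t i j;
  vogel_model_tl : forall i j, i != j -> w (tperm i j) * t i j = t i j;
  vogel_model_quad : forall i j, i != j ->
    t i j * t i j - (alpha + beta) *: t i j
      + (alpha * beta / 2) *: (1 + w (tperm i j)) = 0
}.

Lemma ord3P (P : 'I_3 -> Prop) : P i0 -> P i1 -> P i2 -> forall i, P i.
Proof.
move=> P0 P1 P2; case=> [[|[|[|//]]] i].
- by rewrite (_ : Ordinal i = 0) //; apply/val_inj.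
- by rewrite (_ : Ordinal i = 1) //; apply/val_inj.
- by rewrite (_ : Ordinal i = 2%R) //; apply/val_inj.
Qed.

Lemma tperm02E : tperm i0 i2 = (tperm i0 i1 * tperm i1 i2 * tperm i0 i1)%g.
Proof.
by apply/permP; apply: ord3P; rewrite !permM !permE.
Qed.

Lemma tperm02E' : tperm i0 i2 = (tperm i1 i2 * tperm i0 i1 * tperm i1 i2)%g.
Proof.
by apply/permP; apply: ord3P; rewrite !permM !permE.
Qed.

Lemma perm3_ind (P : 'S_3 -> Prop) :
  P 1%g -> (forall u, P u -> P (u * tperm i0 i1)%g) ->
  (forall u, P u -> P (u * tperm i1 i2)%g) -> forall u, P u.
Proof.
move=> P1 P01 P12 u; have [ts -> ] := prod_tpermP u.
elim/last_ind: ts => [|ts [i j] IH]; first by rewrite big_nil.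
rewrite all_rcons => /andP[/= ij /IH Pu].
rewrite -cats1 big_cat big_seq1 /=; move: (\prod_(_ <- _) _)%g Pu => v Pv.
have P02 : P (v * tperm i0 i2)%g.
  by rewrite tperm02E !mulgA; apply/P01/P12/P01.
move: i j ij; apply: ord3P; apply: ord3P => //= _;
  rewrite ?[tperm _ i0]tpermC ?[tperm i2 i1]tpermC //;
  by [apply: P01 | apply: P12].
Qed.

Lemma ord3_pair i j : i != j -> exists u : 'S_3, i = u i0 /\ j = u i1.
Proof.
  move: i j; apply: ord3P; apply: ord3P => //= _.
  - by exists 1%g; rewrite !permE.
  - by exists (tperm i1 i2); rewrite !permE.
  - by exists (tperm i0 i1); rewrite !permE.
  - by exists (tperm i0 i1 * tperm i0 i2)%g; rewrite !permM !permE.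
  - by exists (tperm i0 i1 * tperm i1 i2 )%g; rewrite !permM !permE.
  - by exists (tperm i0 i2); rewrite !permE.
Qed.

Section VogelSpan.
Variables (K : fieldType) (A : algType K) (alpha beta : K).
Variables (w : 'S_3 -> A) (t : 'I_3 -> 'I_3 -> A).
Hypothesis model : vogel_model3 alpha beta w t.
Hypotheses (two_neq0 : 2 != 0 :> K) (ab : alpha != beta).

Let s1 := w (tperm i0 i1).
Let s2 := w (tperm i1 i2).
Let t1 := t i0 i1.

Lemma vogel_generators_stable (U : A -> Prop) :
  (forall g, g \in [:: s1; s2; t1] -> forall x, U x -> U (g * x)) ->
  (forall u x, U x -> U (w u * x)) /\
  (forall i j, i != j -> forall x, U x -> U (t i j * x)).
Proof.
move=> Us.
have Uw u x : U x -> U (w u * x).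
  elim/perm3_ind: u x => [|u IH|u IH] x Ux; first by rewrite (vogel_model1 model) mul1r.
    rewrite -(vogel_modelM model) -mulrA; apply: Us; last exact: IH.
    by rewrite inE eqxx.
  rewrite -(vogel_modelM model) -mulrA; apply: Us; last exact: IH.
  by rewrite !inE eqxx orbT.
split=> // i j ij x Ux.
have [u [-> ->]] := ord3_pair ij.
rewrite -(vogel_model_conj model) // -!mulrA; apply/Uw/Us/Uw => //.
by rewrite !inE eqxx !orbT.
Qed.

Lemma vogel_model_span : exists X : seq A, [/\ size X = 20%N, in_span X 1,
  forall u x, x \in X -> in_span X (w u * x) &
  forall i j, i != j -> forall x, x \in X -> in_span X (t i j * x)].
Proof.
case: (model) => w1 wM tsym tconj comm3 tr tl quad.
have s1K : s1 * s1 = 1 by rewrite wM tperm2 w1.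
have s2K : s2 * s2 = 1 by rewrite wM tperm2 w1.
have braid : s1 * s2 * s1 = s2 * s1 * s2 by rewrite !wM !mulgA -tperm02E -tperm02E'.
have s1t : s1 * t1 = t1 by rewrite tl.
have ts1 : t1 * s1 = t1 by rewrite tr.
have quad1 : t1 * t1 = (alpha + beta) *: t1 - (alpha * beta / 2) *: (1 + s1).
  by apply/eqP; rewrite -subr_eq0 opprB addrA addrAC; apply/eqP/quad.
have t02 : s2 * t1 * s2 = t i0 i2.
  have := tconj (tperm i1 i2) i0 i1 isT; rewrite tpermV => ->.
  by rewrite !permE.
have t12 : s1 * s2 * t1 * s2 * s1 = t i2 i1.
  rewrite -[s1 * s2 * t1]mulrA -[s1 * _ * s2]mulrA t02.
  have := tconj (tperm i0 i1) i0 i2 isT; rewrite tpermV => ->.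
  by rewrite tsym ?permE.
have tT : t1 * (t1 + s2 * t1 * s2 + s1 * s2 * t1 * s2 * s1) =
    (t1 + s2 * t1 * s2 + s1 * s2 * t1 * s2 * s1) * t1.
  by rewrite t02 t12 -addrA mulrDr mulrDl comm3.
have ab0 : alpha - beta != 0 by rewrite subr_eq0.
pose ea := 2^-1 *: (1 - s1).
pose eb := (alpha - beta)^-1 *: (t1 - (beta / 2) *: (1 + s1)).
pose ec := (beta - alpha)^-1 *: (t1 - (alpha / 2) *: (1 + s1)).
have s1ea : s1 * ea = - ea by rewrite -scalerAr mulrBr mulr1 s1K -scalerN opprB.
have s1D : s1 * (1 + s1) = 1 + s1 by rewrite mulrDr mulr1 s1K addrC.
have t1D : t1 * (1 + s1) = 2 *: t1 by rewrite mulrDr mulr1 ts1 scaler_nat mulr2n.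
have half (k : K) : k / 2 * 2 = k by rewrite divfK.
have s1eb : s1 * eb = eb by rewrite -scalerAr mulrBr -scalerAr s1t s1D.
have s1ec : s1 * ec = ec by rewrite -scalerAr mulrBr -scalerAr s1t s1D.
have t1e x y : x + y = alpha + beta -> x * y = alpha * beta ->
    t1 * (t1 - (y / 2) *: (1 + s1)) = x *: (t1 - (y / 2) *: (1 + s1)).
  move=> xy_sum xy_prod; rewrite mulrBr -scalerAr t1D quad1 scalerA half.
  rewrite scalerBr scalerA addrAC -scalerBl -xy_sum addrK.
  by rewrite mulrA xy_prod.
have t1eb : t1 * eb = alpha *: eb by rewrite /eb -scalerAr (t1e alpha beta) // !scalerA mulrC.
have t1ec : t1 * ec = beta *: ec.
  by rewrite /ec -scalerAr (t1e beta alpha) 1?addrC 1?[beta * _]mulrC // !scalerA mulrC.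
have sum1 : 1 = ea + eb + ec.
  rewrite /ec -[beta - alpha]opprB invrN scaleNr -addrA -scalerBr opprB.
  rewrite [t1 - _ + _]addrC addrA subrK -scalerBl -mulrBl scalerA mulrA mulVf // mul1r -scalerDr.
  by rewrite [1 + s1]addrC addrA subrK -[1 + 1]mulr2n -scaler_nat scalerA mulVf // scale1r.
pose X1 := sign_vectors s1 s2 t1 ea; pose X2 := triv_vectors s1 s2 t1 eb.
pose X3 := triv_vectors s1 s2 t1 ec; pose X := X1 ++ X2 ++ X3.
have st1 := sign_vectors_stable two_neq0 s1K s2K braid s1t ts1 quad1 tT s1ea.
have st2 := triv_vectors_stable two_neq0 s1K s2K braid s1t ts1 quad1 tT s1eb t1eb.
have st3 := triv_vectors_stable two_neq0 s1K s2K braid s1t ts1 quad1 tT s1ec t1ec.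
have stX g : g \in [:: s1; s2; t1] -> forall x, in_span X x -> in_span X (g * x).
  move=> gs x; apply: in_span_mull => {}x; rewrite !mem_cat => /or3P[] xX.
  - exact/in_span_catl/st1.
  - exact/in_span_catr/in_span_catl/st2.
  - exact/in_span_catr/in_span_catr/st3.
have [Xw Xt] := vogel_generators_stable stX.
exists X; split=> //.
- rewrite sum1 -addrA; apply: in_spanD; first by apply: in_span_catl; in_span_tac.
  by apply/in_span_catr/in_spanD; [apply: in_span_catl|apply: in_span_catr]; in_span_tac.
- by move=> u x xX; apply/Xw/mem_in_span.
- by move=> i j ij x xX; apply/Xt/mem_in_span.
Qed.

End VogelSpan.

Section VogelModels.
Variables (K : fieldType) (alpha beta : K).
Hypotheses (two_neq0 : 2 != 0 :> K) (three_neq0 : 3 != 0 :> K).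

Let six_neq0 : 6 != 0 :> K.
Proof. by rewrite (natrM K 2 3) mulf_neq0. Qed.

Lemma vogel_model_pair (A B : algType K) w t w' t' :
  @vogel_model3 K A alpha beta w t -> @vogel_model3 K B alpha beta w' t' ->
  @vogel_model3 K (A * B)%type alpha beta (fun u => (w u, w' u))
    (fun i j => (t i j, t' i j)).
Proof.
case=> h1 h2 h3 h4 h5 h6 h7 h8 [k1 k2 k3 k4 k5 k6 k7 k8].
split.
- exact: (f_equal2 pair h1 k1).
- by move=> u v; apply: (f_equal2 pair (h2 u v) (k2 u v)).
- by move=> i j ij; apply: (f_equal2 pair (h3 i j ij) (k3 i j ij)).
- by move=> u i j ij; apply: (f_equal2 pair (h4 u i j ij) (k4 u i j ij)).
- by move=> i j k ij ik kj; apply: (f_equal2 pair (h5 i j k ij ik kj) (k5 i j k ij ik kj)).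
- by move=> i j ij; apply: (f_equal2 pair (h6 i j ij) (k6 i j ij)).
- by move=> i j ij; apply: (f_equal2 pair (h7 i j ij) (k7 i j ij)).
- by move=> i j ij; apply: (f_equal2 pair (h8 i j ij) (k8 i j ij)).
Qed.

Lemma vogel_model_rep (B : algType K) (w : 'S_3 -> B) (x : K) :
    w 1%g = 1 -> (forall u v, w u * w v = w (v * u)%g) ->
    (x - alpha) * (x - beta) = 0 ->
  vogel_model3 alpha beta w (fun i j => (x / 2) *: (1 + w (tperm i j))).
Proof.
move=> w1 wM xE.
have ww i j : w (tperm i j) * w (tperm i j) = 1 by rewrite wM tperm2.
have wc u i j : w u * w (tperm i j) = w (tperm (u i) (u j)) * w u.
  by rewrite !wM -tpermJ conjgE mulKVg.
split=> //.
- by move=> i j _; rewrite tpermC.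
- move=> u i j _; rewrite -scalerAr -scalerAl mulrDr mulr1 wc -[X in X + _]mul1r -mulrDl.
  by rewrite -mulrA wM mulVg w1 mulr1.
- move=> i j k ij ik kj; rewrite -scalerDr -!scalerAl -!scalerAr; congr (_ *: (_ *: _)).
  rewrite ![(1 + w (tperm i j)) * _]mulrDl ![_ * (1 + w (tperm i j))]mulrDr.
  rewrite mul1r mulr1; congr (_ + _).
  have jk : j != k by rewrite eq_sym.
  have e1 : w (tperm i j) * w (tperm i k) = w (tperm k j) * w (tperm i j).
    by rewrite wc tpermL tpermD // [tperm j k]tpermC.
  have e2 : w (tperm i j) * w (tperm k j) = w (tperm i k) * w (tperm i j).
    by rewrite wc tpermR tpermD // [tperm k i]tpermC.
  by rewrite 3!mulrDr 3!mulrDl e1 e2 !mul1r !mulr1 addrC.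
- by move=> i j _; rewrite -scalerAl mulrDl mul1r ww addrC.
- by move=> i j _; rewrite -scalerAr mulrDr mulr1 ww addrC.
- move=> i j _; rewrite -scalerAr -scalerAl mulrDl mul1r mulrDr mulr1 ww [w _ + 1]addrC.
  rewrite -[1 + w _ + (1 + w _)]mulr2n -scaler_nat !scalerA -scalerBl -scalerDl.
  rewrite [X in X *: _](_ : _ = 2^-1 * ((x - alpha) * (x - beta))); last by field.
  by rewrite xE mulr0 scale0r.
Qed.

Lemma vogel_model_image (B C : algType K) (f : B -> C) w t :
    (forall x y, f (x + y) = f x + f y) -> (forall x y, f (x * y) = f x * f y) ->
    (forall k x, f (k *: x) = k *: f x) -> f 1 = 1 ->
  vogel_model3 alpha beta w t -> vogel_model3 alpha beta (f \o w) (fun i j => f (t i j)).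
Proof.
move=> fD fM fZ f1 [h1 h2 h3 h4 h5 h6 h7 h8].
have f0 : f 0 = 0 by rewrite -(scale0r 0) fZ scale0r.
have fN x : f (- x) = - f x by rewrite -scaleN1r fZ scaleN1r.
split=> //=.
- by rewrite h1.
- by move=> u v; rewrite -fM h2.
- by move=> i j ij; rewrite h3.
- by move=> u i j ij; rewrite -!fM h4.
- by move=> i j k ij ik kj; rewrite -fD -!fM h5.
- by move=> i j ij; rewrite -fM h6.
- by move=> i j ij; rewrite -fM h7.
- by move=> i j ij; rewrite -f1 -fM -fD -!fZ -fN -!fD h8.
Qed.

(* Column convention: perm_rep u maps the basis vector e_i to e_(u i). *)
Definition perm_rep (u : 'S_3) : 'M[K]_3 := perm_mx u^-1%g.

Lemma perm_rep1 : perm_rep 1%g = 1.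
Proof. by rewrite /perm_rep invg1 perm_mx1. Qed.

Lemma perm_repM u v : perm_rep u * perm_rep v = perm_rep (v * u)%g.
Proof. by rewrite /perm_rep invMg perm_mxM. Qed.

Lemma perm_rep_tperm i j k l : perm_rep (tperm i j) k l = (tperm i j k == l)%:R.
Proof. by rewrite /perm_rep tpermV !mxE. Qed.

Lemma perm_rep01 : perm_rep (tperm i0 i1) = mx3 0 1 0 1 0 0 0 0 1.
Proof. by apply: mx3P; rewrite perm_rep_tperm permE !mxE. Qed.

Lemma perm_rep12 : perm_rep (tperm i1 i2) = mx3 1 0 0 0 0 1 0 1 0.
Proof. by apply: mx3P; rewrite perm_rep_tperm permE !mxE. Qed.

Definition std_left : 'M[K]_(2, 3) :=
  \matrix_(i < 2, j < 3)
    nth 0 (nth [::] [:: [:: 2^-1; - 2^-1; 0]; [:: 6^-1; 6^-1; - 3^-1]] i) j.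
Definition std_right : 'M[K]_(3, 2) :=
  \matrix_(i < 3, j < 2)
    nth 0 (nth [::] [:: [:: 1; 1]; [:: -1; 1]; [:: 0; - 2]] i) j.

Definition std_rep (u : 'S_3) : 'M[K]_2 := std_left *m perm_rep u *m std_right.

Lemma std_rightK : std_left *m std_right = 1.
Proof.
by apply: mx2P; rewrite !mxE !big_ord_recl big_ord0 !mxE /=; field;
  rewrite ?two_neq0 ?three_neq0 ?six_neq0.
Qed.

Lemma std_leftK : std_right *m std_left = 1%:M - 3^-1 *: const_mx 1.
Proof.
by apply: mx3P; rewrite !mxE !big_ord_recl big_ord0 !mxE /=; field;
  rewrite ?two_neq0 ?three_neq0 ?six_neq0.
Qed.

Lemma std_rep1 : std_rep 1%g = 1.
Proof. by rewrite /std_rep perm_rep1 mulmx1 std_rightK. Qed.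

Lemma std_repM u v : std_rep u * std_rep v = std_rep (v * u)%g.
Proof.
have PJ w : perm_rep w *m const_mx 1 = const_mx 1 :> 'M_3.
  by rewrite -row_permE; apply/matrixP => i j; rewrite !mxE.
have LJ : std_left *m const_mx 1 = 0 :> 'M_(2, 3).
  apply/matrixP => i j; rewrite !mxE !big_ord_recl big_ord0 !mxE /=.
  by case: i => [[|[|//]] i] /=; field; rewrite ?two_neq0 ?three_neq0 ?six_neq0.
rewrite /std_rep -perm_repM -[LHS]/(_ *m _) !mulmxA; congr (_ *m _).
rewrite -[_ *m std_right *m std_left]mulmxA std_leftK mulmxBr mulmx1 -scalemxAr.
by rewrite -[_ *m const_mx 1]mulmxA PJ LJ scaler0 subr0.
Qed.

Let nine_neq0 : 9 != 0 :> K.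
Proof. by rewrite (natrM K 3 3) mulf_neq0. Qed.

Let kap : K := (alpha - 2 * beta) * (2 * alpha - beta) / 9.
Let sg : K := (alpha + beta) / 3.

(* t_ij on the permutation representation: it kills e_i - e_j, and on
   f0 = e_0 + e_1 + e_2 and f+ = e_i + e_j - 2 e_k it acts by
   f0 |-> sg f0 + f+ and f+ |-> kap f0 + 2 sg f+ with sg = (alpha + beta) / 3,
   so that the sum of the three t_ij is alpha + beta. *)
Definition perm_t (i j : 'I_3) : 'M[K]_3 := \matrix_(k < 3, l < 3)
  if (k == i) || (k == j) then
    if (l == i) || (l == j) then (kap + 2 + 4 * sg) / 6 else (1 - kap - sg) / 3
  else
    if (l == i) || (l == j) then (kap - 4 - 2 * sg) / 6 else (5 * sg - kap - 2) / 3.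

Lemma perm_t_sym i j : perm_t i j = perm_t j i.
Proof. by apply/matrixP => k l; rewrite !mxE orbC [(l == i) || _]orbC. Qed.

Lemma perm_t_conj u i j : perm_rep u * perm_t i j * perm_rep u^-1%g = perm_t (u i) (u j).
Proof.
rewrite -[LHS]/(perm_mx _ *m _ *m perm_mx _) -col_permE -row_permE.
have uV k l : ((u^-1)%g k == l) = (k == u l).
  by rewrite -(inj_eq (@perm_inj _ u)) permKV.
by apply/matrixP => k l; rewrite !mxE !uV.
Qed.

Lemma perm_t_sum i j k : i != j -> i != k -> k != j ->
  perm_t i k + perm_t k j = (alpha + beta)%:M - perm_t i j.
Proof.
move: i j k; apply: ord3P; apply: ord3P => //; apply: ord3P => // _ _ _.
all: by apply: mx3P; rewrite !mxE /= /kap /sg; field;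
  rewrite ?three_neq0 ?two_neq0 ?six_neq0 ?nine_neq0.
Qed.

Lemma perm_t_model : vogel_model3 alpha beta perm_rep perm_t.
Proof.
have four_neq0 : 4 != 0 :> K by rewrite (natrM K 2 2) mulf_neq0.
have ts i j : perm_t i j * perm_rep (tperm i j) = perm_t i j.
  rewrite -[LHS]/(_ *m perm_mx (tperm i j)^-1) -col_permE.
  apply/matrixP => k l; rewrite !mxE.
  by case: tpermP => [->|->|//]; rewrite !eqxx ?orbT.
have st i j : perm_rep (tperm i j) * perm_t i j = perm_t i j.
  rewrite -[LHS]/(perm_mx (tperm i j)^-1 *m _) -row_permE tpermV; apply/matrixP => k l; rewrite !mxE.
  by case: tpermP => [->|->|//]; rewrite !eqxx ?orbT.
split=> //.
- exact: perm_rep1.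
- exact: perm_repM.
- by move=> i j _; apply: perm_t_sym.
- by move=> u i j _; apply: perm_t_conj.
- move=> i j k ij ik kj; rewrite perm_t_sum // mulrBr mulrBl.
  congr (_ - _); rewrite -[LHS]/(_ *m _) -[RHS]/(_ *m _).
  by rewrite mul_mx_scalar mul_scalar_mx.
- have quad01 : perm_t i0 i1 * perm_t i0 i1 - (alpha + beta) *: perm_t i0 i1
      + (alpha * beta / 2) *: (1 + perm_rep (tperm i0 i1)) = 0.
    rewrite perm_rep01; apply: mx3P; rewrite !mxE !big_ord_recl big_ord0 !mxE /= /kap /sg;
      by field; rewrite ?three_neq0 ?two_neq0 ?six_neq0 ?nine_neq0 ?four_neq0.
  move=> i j ij.
  have [u [-> ->]] : exists u : 'S_3, i = u i0 /\ j = u i1 by apply: ord3_pair.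
  have PK : perm_rep u^-1%g * perm_rep u = 1 by rewrite perm_repM mulgV perm_rep1.
  have PVK : perm_rep u * perm_rep u^-1%g = 1 by rewrite perm_repM mulVg perm_rep1.
  have E : perm_rep (tperm (u i0) (u i1)) =
      perm_rep u * perm_rep (tperm i0 i1) * perm_rep u^-1%g.
    by rewrite !perm_repM -tpermJ conjgE.
  have := congr1 (fun x => perm_rep u * x * perm_rep u^-1%g) quad01.
  rewrite E -perm_t_conj -{1}[perm_t i0 i1]mulr1 -{1}PK.
  rewrite mulr0 mul0r !mulrDr !mulrDl mulrN mulNr -!scalerAr -!scalerAl mulrDr mulrDl mulr1 PVK.
  by rewrite !mulrA.
Qed.

End VogelModels.

Section VogelBlocks.
Variables (K : fieldType) (alpha beta : K).
Hypotheses (two_neq0 : 2 != 0 :> K) (three_neq0 : 3 != 0 :> K).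
Hypotheses (alpha_neq0 : alpha != 0) (beta_neq0 : beta != 0).
Hypotheses (ab : alpha - beta != 0) (ab2 : alpha - 2 * beta != 0).
Hypothesis (a2b : 2 * alpha - beta != 0).

Let six_neq0 : 6 != 0 :> K.
Proof. by rewrite (natrM K 2 3) mulf_neq0. Qed.
Let nine_neq0 : 9 != 0 :> K.
Proof. by rewrite (natrM K 3 3) mulf_neq0. Qed.

Lemma std_rep01 : std_rep K (tperm i0 i1) = mx2 (-1) 0 0 1.
Proof.
rewrite /std_rep perm_rep01; apply: mx2P; rewrite !mxE !big_ord_recl !big_ord0.
all: rewrite !mxE !big_ord_recl !big_ord0 !mxE /=.
all: by field; rewrite ?two_neq0 ?three_neq0 ?six_neq0.
Qed.

Lemma std_rep12 : std_rep K (tperm i1 i2) = mx2 2^-1 (3 / 2) 2^-1 (- 2^-1).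
Proof.
rewrite /std_rep perm_rep12; apply: mx2P; rewrite !mxE !big_ord_recl !big_ord0.
all: rewrite !mxE !big_ord_recl !big_ord0 !mxE /=.
all: by field; rewrite ?two_neq0 ?three_neq0 ?six_neq0.
Qed.

Let u : K := (alpha - 2 * beta) / 3.
Let v : K := (beta - 2 * alpha) / 3.

(* The columns are e_0 - e_1 and the eigenvectors of t_01 for alpha and beta. *)
Definition eigenbasis : 'M[K]_3 :=
  mx3 1 (1 + u) (1 + v) (-1) (1 + u) (1 + v) 0 (u - 2) (v - 2).

Definition eigenbasisV : 'M[K]_3 :=
  mx3 2^-1 (- 2^-1) 0
    ((3^-1 - v / 6) / (alpha - beta)) ((3^-1 - v / 6) / (alpha - beta))
      ((3^-1 + v / 3) / (alpha - beta))
    ((u / 6 - 3^-1) / (alpha - beta)) ((u / 6 - 3^-1) / (alpha - beta))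
      (- (u / 3 + 3^-1) / (alpha - beta)).

Lemma eigenbasisK : eigenbasisV *m eigenbasis = 1.
Proof.
rewrite mulmx3 mx3_1 /u /v; congr mx3.
all: by field; rewrite ?two_neq0 ?three_neq0 ?six_neq0 ?nine_neq0 ?ab.
Qed.

Definition in_eigenbasis (X : 'M[K]_3) : 'M[K]_3 := eigenbasisV *m X *m eigenbasis.

Lemma in_eigenbasis_model : vogel_model3 alpha beta
  (in_eigenbasis \o @perm_rep K) (fun i j => in_eigenbasis (perm_t alpha beta i j)).
Proof.
apply: vogel_model_image (perm_t_model _ _ two_neq0 three_neq0) => [X Y|X Y|k X|].
- by rewrite /in_eigenbasis mulmxDr mulmxDl.
- rewrite /in_eigenbasis -[X * Y]/(X *m Y) -[RHS]/(_ *m _) !mulmxA; congr (_ *m _).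
  by rewrite -[_ *m eigenbasis *m _]mulmxA (mulmx1C eigenbasisK) mulmx1.
- by rewrite /in_eigenbasis -scalemxAr -scalemxAl.
- by rewrite /in_eigenbasis mulmx1 eigenbasisK.
Qed.

Lemma in_eigenbasis01 : in_eigenbasis (perm_rep K (tperm i0 i1)) = mx3 (-1) 0 0 0 1 0 0 0 1.
Proof.
rewrite /in_eigenbasis perm_rep01 !mulmx3 /u /v; congr mx3.
all: by field; rewrite ?two_neq0 ?three_neq0 ?six_neq0 ?nine_neq0 ?ab.
Qed.

Let kap : K := (alpha - 2 * beta) * (2 * alpha - beta) / 9.
Let sg : K := (alpha + beta) / 3.

Lemma perm_t01 : perm_t alpha beta i0 i1 =
  mx3 ((kap + 2 + 4 * sg) / 6) ((kap + 2 + 4 * sg) / 6) ((1 - kap - sg) / 3)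
      ((kap + 2 + 4 * sg) / 6) ((kap + 2 + 4 * sg) / 6) ((1 - kap - sg) / 3)
      ((kap - 4 - 2 * sg) / 6) ((kap - 4 - 2 * sg) / 6) ((5 * sg - kap - 2) / 3).
Proof. by apply: mx3P; rewrite !mxE. Qed.

Lemma perm_t12 : perm_t alpha beta i1 i2 =
  mx3 ((5 * sg - kap - 2) / 3) ((kap - 4 - 2 * sg) / 6) ((kap - 4 - 2 * sg) / 6)
      ((1 - kap - sg) / 3) ((kap + 2 + 4 * sg) / 6) ((kap + 2 + 4 * sg) / 6)
      ((1 - kap - sg) / 3) ((kap + 2 + 4 * sg) / 6) ((kap + 2 + 4 * sg) / 6).
Proof. by apply: mx3P; rewrite !mxE. Qed.

Lemma in_eigenbasis_t01 :
  in_eigenbasis (perm_t alpha beta i0 i1) = mx3 0 0 0 0 alpha 0 0 0 beta.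
Proof.
rewrite /in_eigenbasis perm_t01 !mulmx3 /u /v /kap /sg; congr mx3.
all: by field; rewrite ?two_neq0 ?three_neq0 ?six_neq0 ?nine_neq0 ?ab.
Qed.

Lemma vogel_model_blocks : exists (w : 'S_3 -> blocks K) (t : 'I_3 -> 'I_3 -> blocks K) L2 L3,
  [/\ vogel_model3 alpha beta w t,
    w (tperm i0 i1) = (-1, 1, 1, mx2 (-1) 0 0 1, mx2 (-1) 0 0 1, mx3 (-1) 0 0 0 1 0 0 0 1),
    t i0 i1 = (0, alpha, beta, mx2 0 0 0 alpha, mx2 0 0 0 beta, mx3 0 0 0 0 alpha 0 0 0 beta),
    w (tperm i1 i2) = (-1, 1, 1, mx2 2^-1 (3 / 2) 2^-1 (- 2^-1),
       mx2 2^-1 (3 / 2) 2^-1 (- 2^-1), L2) &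
    [/\ t i1 i2 = (0, alpha, beta, (alpha / 2) *: (1 + mx2 2^-1 (3 / 2) 2^-1 (- 2^-1)),
        (beta / 2) *: (1 + mx2 2^-1 (3 / 2) 2^-1 (- 2^-1)), L3),
      L2 0 0 = 2^-1, L3 0 0 = (alpha + beta) / 2,
      forall i, i != 0 -> L2 0 i != 0 & forall i, i != 0 -> L2 i 0 != 0]].
Proof.
pose sgn (u : 'S_3) : K^o := (-1) ^+ u.
have m_sgn : vogel_model3 alpha beta sgn
    (fun i j => (alpha / 2) *: (1 + sgn (tperm i j))).
  apply: vogel_model_rep => // [|s s'|]; last by rewrite subrr mul0r.
    by rewrite /sgn odd_perm1.
  by rewrite /sgn odd_permM addbC signr_addb.
have m_triv x : (x - alpha) * (x - beta) = 0 -> vogel_model3 alpha beta (fun=> 1 : K^o)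
    (fun i j => (x / 2) *: (1 + 1)).
  by move=> xE; apply: (vogel_model_rep two_neq0) => // *; rewrite mulr1.
have m_std x : (x - alpha) * (x - beta) = 0 -> vogel_model3 alpha beta (std_rep K)
    (fun i j => (x / 2) *: (1 + std_rep K (tperm i j))).
  by apply: vogel_model_rep => //; [apply: std_rep1 | apply: std_repM].
have aE : (alpha - alpha) * (alpha - beta) = 0 by rewrite subrr mul0r.
have bE : (beta - alpha) * (beta - beta) = 0 by rewrite subrr mulr0.
have m := vogel_model_pair (vogel_model_pair (vogel_model_pair (vogel_model_pair
  (vogel_model_pair m_sgn (m_triv _ aE)) (m_triv _ bE)) (m_std _ aE)) (m_std _ bE))
  in_eigenbasis_model.
have sgnE i j : i != j -> sgn (tperm i j) = -1 by rewrite /sgn odd_tperm => ->.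
have half2 (x : K) : (x / 2) *: (1 + 1 : K^o) = x.
  by rewrite -[LHS]/(x / 2 * (1 + 1)) -mulrA mulVf ?mulr1.
have half0 (x : K) : (x / 2) *: (1 - 1 : K^o) = 0 by rewrite subrr scaler0.
have half_std x : (x / 2) *: (1 + mx2 (-1) 0 0 1) = mx2 0 0 0 x :> 'M[K]_2.
  by rewrite mx2_1 mx2D mx2Z addrN !addr0 !mulr0 -mulrA mulVf ?mulr1.
exists (fun s => (sgn s, 1, 1, std_rep K s, std_rep K s, in_eigenbasis (perm_rep K s))).
eexists; exists (in_eigenbasis (perm_rep K (tperm i1 i2))).
exists (in_eigenbasis (perm_t alpha beta i1 i2)).
split; first exact: m.
- by rewrite sgnE // std_rep01 in_eigenbasis01.
- by rewrite /= sgnE // !half2 half0 std_rep01 !half_std in_eigenbasis_t01.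
- by rewrite sgnE // std_rep12.
split.
- by rewrite /= sgnE // !half2 half0 std_rep12.
- rewrite /in_eigenbasis perm_rep12 !mulmx3 /u /v mxE /=.
  by field; rewrite ?two_neq0 ?three_neq0 ?six_neq0 ?nine_neq0 ?ab.
- rewrite /in_eigenbasis perm_t12 !mulmx3 /u /v /kap /sg mxE /=.
  by field; rewrite ?two_neq0 ?three_neq0 ?six_neq0 ?nine_neq0 ?ab.
- apply: ord3P => // _; rewrite /in_eigenbasis perm_rep12 !mulmx3 /u /v mxE /=.
    rewrite (_ : _ + _ = 3 / 2) ?mulf_neq0 ?invr_neq0 //.
    by field; rewrite ?two_neq0 ?three_neq0 ?six_neq0 ?nine_neq0 ?ab.
  rewrite (_ : _ + _ = 3 / 2) ?mulf_neq0 ?invr_neq0 //.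
  by field; rewrite ?two_neq0 ?three_neq0 ?six_neq0 ?nine_neq0 ?ab.
- apply: ord3P => // _; rewrite /in_eigenbasis perm_rep12 !mulmx3 /u /v mxE /=.
    rewrite (_ : _ + _ = (2 * alpha - beta) / (6 * (alpha - beta)));
      first by rewrite mulf_neq0 ?invr_neq0 ?mulf_neq0.
    by field; rewrite ?two_neq0 ?three_neq0 ?six_neq0 ?nine_neq0 ?ab.
  rewrite (_ : _ + _ = (alpha - 2 * beta) / (6 * (alpha - beta)));
    first by rewrite mulf_neq0 ?invr_neq0 ?mulf_neq0.
  by field; rewrite ?two_neq0 ?three_neq0 ?six_neq0 ?nine_neq0 ?ab.
Qed.

Lemma vogel_blocks_surj (S : K -> K -> K -> 'M[K]_2 -> 'M[K]_2 -> 'M[K]_3 -> Prop) L2 L3 :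
    block_subalgebra S -> S 1 1 1 1 1 1 ->
    S (-1) 1 1 (mx2 (-1) 0 0 1) (mx2 (-1) 0 0 1) (mx3 (-1) 0 0 0 1 0 0 0 1) ->
    S 0 alpha beta (mx2 0 0 0 alpha) (mx2 0 0 0 beta) (mx3 0 0 0 0 alpha 0 0 0 beta) ->
    S (-1) 1 1 (mx2 2^-1 (3 / 2) 2^-1 (- 2^-1)) (mx2 2^-1 (3 / 2) 2^-1 (- 2^-1)) L2 ->
    S 0 alpha beta ((alpha / 2) *: (1 + mx2 2^-1 (3 / 2) 2^-1 (- 2^-1)))
      ((beta / 2) *: (1 + mx2 2^-1 (3 / 2) 2^-1 (- 2^-1))) L3 ->
    L2 0 0 = 2^-1 -> L3 0 0 = (alpha + beta) / 2 ->
    (forall i, i != 0 -> L2 0 i != 0) -> (forall i, i != 0 -> L2 i 0 != 0) ->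
  forall x y z M N L, S x y z M N L.
Proof.
move=> HS S1 Ss1 St1 Ss2 St2 L200 L300 L20 L2i.
have SE0 : S 1 0 0 (delta_mx 0 0) (delta_mx 0 0) (delta_mx 0 0).
  have := block_subalgebraZ HS 2^-1 (block_subalgebraD HS S1 (block_subalgebraZ HS (-1) Ss1)).
  rewrite mx2_1 mx3_1 !mx2Z !mx3Z !mx2D !mx3D !mx2Z !mx3Z.
  rewrite !mulN1r !opprK -[1 + 1]/(2%R : K) mulVf // !subrr !(oppr0, addr0, mulr0).
  congr S; first [by apply: mx2P; rewrite !mxE | by apply: mx3P; rewrite !mxE].
have Sproj k l : S 0 (k * (alpha - l)) (k * (beta - l))
    (mx2 0 0 0 (k * (alpha - l))) (mx2 0 0 0 (k * (beta - l)))
    (mx3 0 0 0 0 (k * (alpha - l)) 0 0 0 (k * (beta - l))).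
  have := block_subalgebraZ HS k (block_subalgebraD HS St1
    (block_subalgebraZ HS (- (l / 2)) (block_subalgebraD HS S1 Ss1))).
  rewrite mx2_1 mx3_1 !mx2D !mx3D !mx2Z !mx3Z !mx2D !mx3D !mx2Z !mx3Z.
  rewrite -[1 + 1]/(2%R : K) !subrr !addr0 !mulr0 !addr0 !mulr0.
  by rewrite mulNr divfK.
have SE1 : S 0 1 0 (delta_mx 1 1) 0 (delta_mx 1 1).
  have := Sproj (alpha - beta)^-1 beta; rewrite subrr mulr0 mulVf //.
  congr S; first [by apply: mx2P; rewrite !mxE | by apply: mx3P; rewrite !mxE].
have SE2 : S 0 0 1 0 (delta_mx 1 1) (delta_mx 2%R 2%R).
  have := Sproj (beta - alpha)^-1 alpha; rewrite subrr mulr0 mulVf; last first.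
    by rewrite -opprB oppr_eq0.
  congr S; first [by apply: mx2P; rewrite !mxE | by apply: mx3P; rewrite !mxE].
(* If alpha + beta = 0, the corner of t_12 alone does not separate the sign
   representation from the 3-dimensional one. *)
pose lam : K := if alpha + beta == 0 then alpha else 0.
have SX := cornerP HS SE0 (block_subalgebraD HS St2 (block_subalgebraZ HS lam Ss2)).
apply: (block_subalgebra_full HS SE0 SE1 SE2 SX _ Ss2) => //.
- rewrite mx2_1 !mx2D !mx2Z !mx2D !mxE L200 L300 /=.
  have neq (x y k l : K) : k != 0 -> l != 0 -> x - y = k / l -> x != y.
    by move=> k0 l0 xy; rewrite -subr_eq0 xy mulf_neq0 ?invr_neq0.
  have four_neq0 : 4 != 0 :> K by rewrite (natrM K 2 2) mulf_neq0.
  have lamE (x : K) : x = alpha \/ x = beta -> - (3 * (2 * lam + x)) != 0.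
    move=> xE; rewrite oppr_eq0; apply: mulf_neq0 => //; rewrite /lam.
    case: ifP => [|_]; last by case: xE => ->; rewrite mulr0 add0r.
    rewrite addr_eq0 => /eqP abE; case: xE => ->; rewrite abE.
      rewrite (_ : _ + _ = - (3 * beta)); last by ring.
      by rewrite oppr_eq0 mulf_neq0.
    by rewrite (_ : _ + _ = - beta); [rewrite oppr_eq0 | ring].
  rewrite !inE !negb_or !andbT; apply/and3P; split;
    [apply/and3P; split| apply/andP; split |].
  + apply: (neq _ _ (- (3 * (2 * lam + alpha))) 4) => //; first by apply: lamE; left.
    by field; rewrite ?two_neq0 ?four_neq0.
  + apply: (neq _ _ (- (3 * (2 * lam + beta))) 4) => //; first by apply: lamE; right.
    by field; rewrite ?two_neq0 ?four_neq0.
  + apply: (neq _ _ (- (3 * lam + (alpha + beta))) 2) => //.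
      rewrite oppr_eq0 /lam; case: ifP => [/eqP ->|/negbT]; last by rewrite mulr0 add0r.
      by rewrite addr0 mulf_neq0.
    by field; rewrite ?two_neq0 ?four_neq0.
  + apply: (neq _ _ (3 * (alpha - beta)) 4); rewrite ?mulf_neq0 //.
    by field; rewrite ?two_neq0 ?four_neq0.
  + apply: (neq _ _ (alpha - 2 * beta) 4) => //.
    by field; rewrite ?two_neq0 ?four_neq0.
  + apply: (neq _ _ (- (2 * alpha - beta)) 4); rewrite ?oppr_eq0 //.
    by field; rewrite ?two_neq0 ?four_neq0.
- by rewrite mxE /= mulf_neq0 ?invr_neq0.
- by rewrite mxE /= invr_neq0.
- by rewrite mxE /= mulf_neq0 ?invr_neq0.
- by rewrite mxE /= invr_neq0.
Qed.

End VogelBlocks.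

(** * Morphisms out of presented algebras *)

Section MonoidAlgebraLift.
Variables (R K : comNzRingType) (phi : {rmorphism R -> K}) (M : monoidType).
Variables (B : algType K) (h : M -> B).
Hypothesis h1 : h 1%g = 1.
Hypothesis hM : forall k l : M, h (k * l)%g = h k * h l.

Definition ma_lift (g : monoid_algebra R M) : B :=
  mmap (in_alg B \o phi) h g.

Lemma ma_lift_zmod_morphism : zmod_morphism ma_lift.
Proof. exact: mmap_is_additive. Qed.

HB.instance Definition _ :=
  GRing.isZmodMorphism.Build (monoid_algebra R M) B ma_lift ma_lift_zmod_morphism.

Lemma ma_liftU (c : R) (k : M) : ma_lift << c *g k >> = phi c *: h k.
Proof. by rewrite [LHS]mmapU /= -scalerAl mul1r. Qed.

Lemma ma_lift_basis (k : M) : ma_lift (ma_basis R k) = h k.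
Proof. by rewrite ma_basis.unlock ma_liftU rmorph1 scale1r. Qed.

Lemma ma_lift_monoid_morphism : monoid_morphism ma_lift.
Proof.
split=> [|g1 g2]; first by rewrite ma_lift_basis.
elim/ma_ind: g1 => [|x y Hx Hy|c1 k1]; first by rewrite !(mul0r, raddf0).
  by rewrite mulrDl !raddfD /= Hx Hy mulrDl.
elim/ma_ind: g2 => [|x y Hx Hy|c2 k2]; first by rewrite !(mulr0, raddf0).
  by rewrite mulrDr !raddfD /= Hx Hy mulrDr.
have -> : (<< c1 *g k1 >> : monoid_algebra R M) * << c2 *g k2 >> =
    << c1 * c2 *g (k1 * k2)%g >> by apply: ma_mulUU.
by rewrite !ma_liftU rmorphM hM -scalerAl -scalerAr scalerA.
Qed.

Lemma ma_liftZ (c : R) g : ma_lift (c *: g) = phi c *: ma_lift g.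
Proof.
elim/ma_ind: g => [|x y Hx Hy|d k]; first by rewrite scaler0 !raddf0.
  by rewrite scalerDr !raddfD /= Hx Hy.
by rewrite ma_scaleU !ma_liftU rmorphM scalerA.
Qed.

Lemma ma_lift_rmorphism : exists f : {rmorphism monoid_algebra R M -> B},
  (forall c g, f (c *: g) = phi c *: f g) /\ forall k, f (ma_basis R k) = h k.
Proof.
pose mM := GRing.isMonoidMorphism.Build (monoid_algebra R M) B ma_lift
  ma_lift_monoid_morphism.
pose f : {rmorphism _ -> _} := HB.pack ma_lift mM.
by exists f; split; [apply: ma_liftZ | apply: ma_lift_basis].
Qed.

End MonoidAlgebraLift.

Section FreeLift.
Variables (R K : comNzRingType) (phi : {rmorphism R -> K}) (X : choiceType).
Variables (B : algType K) (v : X -> B).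

Lemma free_lift : exists f : {rmorphism free_algebra R X -> B},
  (forall c p, f (c *: p) = phi c *: f p) /\ forall x, f (free_gen R x) = v x.
Proof.
pose h (w : free_monoid X) := \prod_(x <- w) v x.
have h1 : h 1%g = 1 by apply: big_nil.
have hM k l : h (k * l)%g = h k * h l by apply: big_cat.
have [f [fZ fE]] := ma_lift_rmorphism phi h1 hM.
by exists f; split=> // x; rewrite fE /h big_seq1.
Qed.

End FreeLift.

Section QuotientLift.
Variables (R K : comNzRingType) (phi : {rmorphism R -> K}) (A : algType R).
Variables (rel : A -> A -> Prop) (B : algType K) (f : {rmorphism A -> B}).
Hypothesis fZ : forall c x, f (c *: x) = phi c *: f x.
Hypothesis rel_f : forall x y, rel x y -> f x = f y.

Lemma quot_lift : exists g : quot_alg rel -> B,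
  [/\ zmod_morphism g, monoid_morphism g, forall c u, g (c *: u) = phi c *: g u
    & forall x, g (qpi rel x) = f x].
Proof.
have gE x : f (repr (qpi rel x)) = f x.
  apply/eqP; rewrite -subr_eq0 -rmorphB; apply/eqP.
  by apply: (generated_ideal_ker rel_f); apply/qpiP; apply: qpi_repr.
exists (fun u => f (repr u)); split=> [u v|| c u|//].
- by rewrite -{1}(qpi_repr u) -{1}(qpi_repr v) -raddfB gE rmorphB.
- split=> [|u v]; first by rewrite -[1]/(qpi rel 1) gE rmorph1.
  by rewrite -{1}(qpi_repr u) -{1}(qpi_repr v) -qpiM gE rmorphM.
- by rewrite -{1}(qpi_repr u) -qpiZ gE fZ.
Qed.

End QuotientLift.

Section ExtensionLift.
Variables (R K : comNzRingType) (phi : {rmorphism R -> K}) (A : algType R).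
Variables (B : algType K) (g : A -> B).
Hypothesis gB : zmod_morphism g.
Hypothesis gM : monoid_morphism g.
Hypothesis gZ : forall c x, g (c *: x) = phi c *: g x.

Lemma ext_scalars_lift : exists f : ext_scalars phi A -> B,
  [/\ linear f, monoid_morphism f & forall x k, f (tensor phi x k) = k *: g x].
Proof.
have gD x y : g (x + y) = g x + g y.
  have g0 : g 0 = 0 by rewrite -(subrr 0) gB subrr.
  by rewrite -{1}[y]opprK gB -[- y]sub0r gB g0 sub0r opprK.
pose f := tensor_lift (fun x k => k *: g x) : ext_scalars phi A -> B.
have fDl x y k : k *: g (x + y) = k *: g x + k *: g y by rewrite gD scalerDr.
have fDr x k l : (k + l) *: g x = k *: g x + l *: g x by apply: scalerDl.
have fZ r x k : k *: g (r *: x) = (phi r * k) *: g x by rewrite gZ scalerA mulrC.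
have fE x k : f (tensor phi x k) = k *: g x by apply: tensor_liftE.
have fD t u : f (t + u) = f t + f u by apply: tensor_liftD.
have f0 : f 0 = 0 by apply: tensor_lift0.
exists f; split=> //.
  move=> c t u; rewrite fD; congr (_ + _).
  elim/tensor_ind: t => [|t t' Ht Ht'|x k]; first by rewrite scaler0 f0 scaler0.
    by rewrite scalerDr !fD Ht Ht' scalerDr.
  by rewrite scale_tensor !fE scalerA.
split=> [|t u]; first by rewrite tensor_oneE fE gM.1 scale1r.
elim/tensor_ind: t => [|t t' Ht Ht'|x k]; first by rewrite !(mul0r, f0).
  by rewrite mulrDl !fD Ht Ht' mulrDl.
elim/tensor_ind: u => [|u u' Hu Hu'|y l]; first by rewrite !(mulr0, f0).
  by rewrite mulrDr !fD Hu Hu' mulrDr.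
by rewrite tensorM !fE gM.2 -scalerAl -scalerAr scalerA.
Qed.

End ExtensionLift.

Section BraidLift.
Variables (B : pzRingType) (x xV : 'I_2 -> B).
Hypotheses (xK : forall i, x i * xV i = 1) (xVK : forall i, xV i * x i = 1).
Hypothesis braid : x 0 * x 1 * x 0 = x 1 * x 0 * x 1.

Lemma braid_lift : exists h : braid_group 3 -> B,
  [/\ h 1%g = 1, forall k l, h (k * l)%g = h k * h l,
      forall i, h (braid_gen i) = x i & forall i, h (braid_gen i)^-1%g = xV i].
Proof.
pose hw (w : braid_word 3) := \prod_(l <- w) (if l.2 then xV l.1 else x l.1).
have hw_eq u v : braid_eq u v -> hw u = hw v.
  rewrite /hw; elim=> {u v} 
    [//|u v _ -> //|u v w _ -> _ -> //|u u' v v' _ Eu _ Ev|i b|i j|i j ij].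
  - by rewrite !big_cat Eu Ev.
  - by rewrite !big_cons !big_nil mulr1; case: b; rewrite /= (xK, xVK).
  - by move=> ij; have := leq_trans ij (ltn_ord j : (j <= 1)%N).
  - have i0 : i = 0.
      by apply/val_inj => /=; have := ltn_ord j; rewrite ij /=; case: (i : nat).
    have j1 : j = 1 by apply/val_inj; move: ij; rewrite i0.
    rewrite i0 j1.
    by rewrite !big_cons big_nil !mulr1 !mulrA.
have hE u : hw (repr (braid_class u)) = hw u.
  by apply/hw_eq/braid_classP/braid_reprK.
have hM (k l : braid_group 3) : hw (repr (k * l)%g) = hw (repr k) * hw (repr l).
  by rewrite [LHS]hE /hw big_cat.
have h1 : hw (repr (1%g : braid_group 3)) = 1 by rewrite [LHS]hE /hw big_nil.
have hx i : hw (repr (braid_gen i)) = x i by rewrite hE /hw big_seq1.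
exists (fun u => hw (repr u)); split=> // i.
have := hM (braid_gen i) (braid_gen i)^-1%g; rewrite mulgV h1 hx.
by move/(congr1 ( *%R (xV i))); rewrite mulr1 mulrA xVK mul1r.
Qed.

End BraidLift.

Definition sigma1 : braid_group 3 := braid_gen (ord0 : 'I_3.-1).
Definition sigma2 : braid_group 3 := braid_gen (ord_max : 'I_3.-1).

Lemma braid_artin3 : (sigma1 * sigma2 * sigma1 = sigma2 * sigma1 * sigma2)%g.
Proof.
have : braid_mul (braid_mul sigma1 sigma2) sigma1 =
    braid_mul (braid_mul sigma2 sigma1) sigma2; last by [].
by rewrite /sigma1 /sigma2 /braid_gen !braid_class_cat; apply/braid_classP/braid_artin.
Qed.

(* Stated for abstract algebras: rewriting with the morphism laws directly in
   the braid algebra makes unification unfold its operations. *)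
Section RelationImages.
Variables (R K : comNzRingType) (phi : R -> K) (A : algType R) (B : algType K).
Variable f : A -> B.
Hypotheses (fB : forall x y, f (x - y) = f x - f y).
Hypotheses (fD : forall x y, f (x + y) = f x + f y).
Hypotheses (fM : forall x y, f (x * y) = f x * f y).
Hypotheses (fZ : forall k x, f (k *: x) = phi k *: f x) (f1 : f 1 = 1).

Lemma cubic_morph a b c s : f ((s - a%:A) * (s - b%:A) * (s - c%:A)) =
  (f s - (phi a)%:A) * (f s - (phi b)%:A) * (f s - (phi c)%:A).
Proof. by rewrite !(fM, fB, fZ, f1). Qed.

Lemma skein_morph a a2 a3 aV s1 s2 s1V s2V :
  f (s1 * s2 * s1V - aV *: (s1 * s2) + a *: (s1 * s2V) + a *: (s1V * s2)
     - a3 *: (s1V * s2V) + aV *: (s2 * s1) - a *: (s2 * s1V)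
     - a *: (s2V * s1) + a3 *: (s2V * s1V)
     + a2 *: (s1V * s2V * s1) - a2 *: (s1 * s2V * s1V)) =
  f s1 * f s2 * f s1V - phi aV *: (f s1 * f s2) + phi a *: (f s1 * f s2V)
    + phi a *: (f s1V * f s2) - phi a3 *: (f s1V * f s2V)
    + phi aV *: (f s2 * f s1) - phi a *: (f s2 * f s1V)
    - phi a *: (f s2V * f s1) + phi a3 *: (f s2V * f s1V)
    + phi a2 *: (f s1V * f s2V * f s1) - phi a2 *: (f s1 * f s2V * f s1V).
Proof. by rewrite !(fM, fB, fD, fZ). Qed.

Lemma mul3_morph x y z : f (x * y * z) = f x * f y * f z.
Proof. by rewrite !fM. Qed.

End RelationImages.

Section SkeinAtMinusOne.
Variables (K : fieldType) (B : algType K) (s1 s1V s2 s2V : B).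

Lemma skein_minus_one :
  s1V * s2 * s1 =
    s1 * s2 * s1V - (-1) *: (s1 * s2) + (-1) *: (s1 * s2V) + (-1) *: (s1V * s2)
    - (-1) ^+ 3 *: (s1V * s2V) + (-1) *: (s2 * s1) - (-1) *: (s2 * s1V)
    - (-1) *: (s2V * s1) + (-1) ^+ 3 *: (s2V * s1V)
    + (-1) ^+ 2 *: (s1V * s2V * s1) - (-1) ^+ 2 *: (s1 * s2V * s1V) <->
  s1V * (s2 - s2V) * s1 - s1 * (s2 - s2V) * s1V =
    (s1 - s1V) * (s2 - s2V) - (s2 - s2V) * (s1 - s1V).
Proof.
have -> : (-1) ^+ 3 = -1 :> K by rewrite !exprS expr0 mulr1 mulrNN mulr1 mulr1.
have -> : (-1) ^+ 2 = 1 :> K by rewrite sqrrN expr1n.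
have move_sides (m1 m2 m3 m4 y z : B) : y = z ->
    (m1 = m2 + y + m3 - m4) <-> (m1 - m3 - (m2 - m4) = z).
  move=> <-; split=> [->|<-]; rewrite opprB.
    by rewrite [_ - m4 - m3]addrAC addrK addrA subrK addrAC subrr add0r.
  by rewrite addrCA [m2 + _]addrC subrK [_ + m4 + m3]addrAC subrK addrK.
have -> : s1V * (s2 - s2V) * s1 - s1 * (s2 - s2V) * s1V =
    s1V * s2 * s1 - s1V * s2V * s1 - (s1 * s2 * s1V - s1 * s2V * s1V).
  by rewrite 2!mulrBr 2!mulrBl.
rewrite -(move_sides _ _ _ _ _ _ erefl) !mulrBl !mulrBr.
rewrite !scaleN1r !scale1r !opprK !opprB !addrA.
rewrite [_ - s1V * s2 + _]addrAC [_ - s2 * s1 + s2 * s1V]addrAC.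
rewrite [_ - s2 * s1 + s2V * s1]addrAC [_ + s2 * s1V + s2V * s1]addrAC.
by rewrite [_ - s2 * s1 - s2V * s1V]addrAC [_ + s2 * s1V - s2V * s1V]addrAC.
Qed.
End SkeinAtMinusOne.

Local Notation RB3 := (monoid_algebra laurent_poly3 (braid_group 3)).

Definition Q3_pi (x : RB3) : Q3 := qpi Q3_rel x.

Lemma Q3_piD x y : Q3_pi (x + y) = Q3_pi x + Q3_pi y.
Proof. exact: raddfD. Qed.

Lemma Q3_piM x y : Q3_pi (x * y) = Q3_pi x * Q3_pi y.
Proof. exact: qpiM. Qed.

Lemma Q3_piZ k x : Q3_pi (k *: x) = k *: Q3_pi x.
Proof. exact: qpiZ. Qed.

(* Locked, to keep unification from unfolding the tensor product. *)
HB.lock Definition Q3_ext_pi (F : fieldType) (alpha beta : F) (x : RB3) :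
  Q3_ext alpha beta := tensor (spec alpha beta) (Q3_pi x) 1.

Section Q3Extension.
Variables (F : fieldType) (alpha beta : F).
Local Notation K := (laurent_series F).
Local Notation spec := (spec alpha beta).
Local Notation eb := (laurent_exp alpha).
Local Notation ec := (laurent_exp beta).
Local Notation Q3_ext_pi := (Q3_ext_pi alpha beta).

Lemma Q3_ext_piD x y : Q3_ext_pi (x + y) = Q3_ext_pi x + Q3_ext_pi y.
Proof. by rewrite Q3_ext_pi.unlock Q3_piD; apply: tensorDl. Qed.

Lemma Q3_ext_piM x y : Q3_ext_pi (x * y) = Q3_ext_pi x * Q3_ext_pi y.
Proof. by rewrite Q3_ext_pi.unlock [RHS](tensorM spec) mulr1 -Q3_piM. Qed.

Lemma Q3_ext_piZ k x : Q3_ext_pi (k *: x) = spec k *: Q3_ext_pi x.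
Proof. by rewrite Q3_ext_pi.unlock [RHS](scale_tensor spec) -tensorZ -Q3_piZ. Qed.

Lemma Q3_ext_pi0 : Q3_ext_pi 0 = 0.
Proof. by rewrite -(scale0r 0) Q3_ext_piZ rmorph0 scale0r. Qed.

Lemma Q3_ext_pi1 : Q3_ext_pi 1 = 1.
Proof. by rewrite Q3_ext_pi.unlock. Qed.

Lemma Q3_ext_piN x : Q3_ext_pi (- x) = - Q3_ext_pi x.
Proof. by apply: (addIr (Q3_ext_pi x)); rewrite -Q3_ext_piD !addNr Q3_ext_pi0. Qed.

Lemma Q3_ext_piB x y : Q3_ext_pi (x - y) = Q3_ext_pi x - Q3_ext_pi y.
Proof. by rewrite Q3_ext_piD Q3_ext_piN. Qed.

Lemma spec_lmonV : spec (lmon (- 1) 0 0) = - 1.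
Proof. by rewrite spec_lmon !expr0z !mulr1 exprN1 invrN invr1. Qed.

Definition Q3_ext_of (g : braid_group 3) := Q3_ext_pi (ma_basis _ g).

Lemma Q3_ext_ofM g h : Q3_ext_of (g * h)%g = Q3_ext_of g * Q3_ext_of h.
Proof.
rewrite -Q3_ext_piM; congr (Q3_ext_pi _); rewrite ma_basis.unlock.
by have := @ma_mulUU laurent_poly3 (braid_group 3) 1 1 g h; rewrite mulr1 => <-.
Qed.

Lemma Q3_ext_of1 : Q3_ext_of 1%g = 1.
Proof. exact: Q3_ext_pi1. Qed.

Lemma Q3_ext_ind (U : Q3_ext alpha beta -> Prop) :
  U 0 -> (forall u v, U u -> U v -> U (u + v)) -> (forall k u, U u -> U (k *: u)) ->
  U 1 -> (forall i u, U u -> U (Q3_ext_of (braid_gen i) * u)) ->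
  (forall i u, U u -> U (Q3_ext_of (braid_gen i)^-1%g * u)) ->
  forall u, U u.
Proof.
move=> U0 UD UZ U1 Us UsV; apply: (@tensor_ind _ _ spec Q3 U U0 UD) => q k.
have [x ->] := qpi_surj q; rewrite -[qpi _ x]/(Q3_pi x).
have -> : tensor spec (Q3_pi x) k = k *: Q3_ext_pi x :> Q3_ext alpha beta.
  by rewrite Q3_ext_pi.unlock [RHS](scale_tensor spec) mulr1.
apply: (UZ).
elim/ma_ind: x {q} => [|x y Ux Uy|r g]; first by rewrite Q3_ext_pi0.
  by rewrite Q3_ext_piD; apply: UD.
have -> : (<< r *g g >> : RB3) = r *: ma_basis _ g.
  by rewrite ma_basis.unlock ma_scaleU mulr1.
rewrite Q3_ext_piZ; apply: UZ; rewrite -/(Q3_ext_of g) -[g]braid_reprK.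
elim: (repr g) => [|[i b] w Uw]; first by rewrite [Q3_ext_of _]Q3_ext_of1.
have -> : braid_class ((i, b) :: w) =
    ((if b then (braid_gen i)^-1 else braid_gen i) * braid_class w)%g.
  rewrite -cat1s -braid_class_cat; congr (_ * _)%g.
  case: b => //; apply: (mulgI (braid_gen i)); rewrite mulgV.
  by rewrite [LHS]braid_class_cat; apply/braid_classP/braid_cancel.
by rewrite Q3_ext_ofM; case: b; [apply: UsV | apply: Us].
Qed.

Lemma Q3_ext_model : Q3_model eb ec
  (Q3_ext_of sigma1) (Q3_ext_of sigma1^-1%g)
  (Q3_ext_of sigma2) (Q3_ext_of sigma2^-1%g).
Proof.
have rel x y : Q3_rel x y -> Q3_ext_pi x = Q3_ext_pi y.
  move=> xy; have E : Q3_pi x = Q3_pi y by apply/qpiP/ideal_rel.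
  by rewrite Q3_ext_pi.unlock E.
split.
- by rewrite -Q3_ext_ofM mulgV; exact: Q3_ext_of1.
- by rewrite -Q3_ext_ofM mulVg; exact: Q3_ext_of1.
- by rewrite -Q3_ext_ofM mulgV; exact: Q3_ext_of1.
- by rewrite -Q3_ext_ofM mulVg; exact: Q3_ext_of1.
- by rewrite -!Q3_ext_ofM braid_artin3.
- have := rel _ _ Q3_cubic.
  rewrite (cubic_morph Q3_ext_piB Q3_ext_piM Q3_ext_piZ Q3_ext_pi1) Q3_ext_pi0.
  by rewrite spec_a spec_b spec_c scaleN1r opprK.
- have := rel _ _ Q3_skein.
  rewrite (skein_morph Q3_ext_piB Q3_ext_piD Q3_ext_piM Q3_ext_piZ).
  rewrite (mul3_morph Q3_ext_piM).
  by rewrite !rmorphXn /= spec_a spec_lmonV => /skein_minus_one.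
Qed.

Lemma Q3_ext_lift (B : algType K) (s1 s1V s2 s2V : B) :
    Q3_model eb ec s1 s1V s2 s2V ->
  exists f : {lrmorphism Q3_ext alpha beta -> B},
    f (Q3_ext_of sigma1) = s1 /\ f (Q3_ext_of sigma2) = s2.
Proof.
case=> s1K s1VK s2K s2VK braid cubic skein.
pose x (i : 'I_2) := if i == 0 then s1 else s2.
pose xV (i : 'I_2) := if i == 0 then s1V else s2V.
have xK i : x i * xV i = 1 by rewrite /x /xV; case: ifP.
have xVK i : xV i * x i = 1 by rewrite /x /xV; case: ifP.
have [h [h1 hM hx hxV]] := braid_lift xK xVK braid.
have [f [fZ fE]] := ma_lift_rmorphism spec h1 hM.
have frel u v : Q3_rel u v -> f u = f v.
  have fB := rmorphB f; have fD := rmorphD f; have fM := rmorphM f.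
  case=> {u v}.
  - rewrite (cubic_morph fB fM fZ (rmorph1 f)) rmorph0 fE hx /=.
    by rewrite spec_a spec_b spec_c scaleN1r opprK.
  - rewrite (skein_morph fB fD fM fZ) (mul3_morph fM) !fE !hx !hxV.
    by rewrite !rmorphXn /= spec_a spec_lmonV; apply/skein_minus_one.
have [g [gB gM gZ gE]] := quot_lift fZ frel.
have [k [kL kM kE]] := @ext_scalars_lift _ _ spec Q3 B g gB gM gZ.
pose kLm := GRing.isLinear.Build _ _ _ _ (k : Q3_ext alpha beta -> B) kL.
pose kMm := GRing.isMonoidMorphism.Build (Q3_ext alpha beta) B k kM.
pose k' : {lrmorphism _ -> _} := HB.pack (k : Q3_ext alpha beta -> B) kLm kMm.
by exists k'; split; rewrite /Q3_ext_of Q3_ext_pi.unlock /= [LHS]kE scale1r [LHS]gE fE hx.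
Qed.

End Q3Extension.

HB.lock Definition vogel_pi (F : fieldType) (alpha beta : F)
    (x : free_algebra F (vogel_gen 3)) :
  vogel_alg 3 alpha beta := qpi (@vogel_rel F 3 alpha beta) x.

Section VogelLift.
Variables (F : fieldType) (alpha beta : F).
Local Notation V := (vogel_alg 3 alpha beta).
Local Notation free := (free_algebra F (vogel_gen 3)).

Local Notation vpi := (vogel_pi alpha beta).

Lemma vogel_piD x y : vpi (x + y) = vpi x + vpi y.
Proof. by rewrite vogel_pi.unlock; apply: raddfD. Qed.

Lemma vogel_piB x y : vpi (x - y) = vpi x - vpi y.
Proof. by rewrite vogel_pi.unlock; apply: raddfB. Qed.

Lemma vogel_piM x y : vpi (x * y) = vpi x * vpi y.
Proof. by rewrite vogel_pi.unlock; apply: qpiM. Qed.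

Lemma vogel_piZ k x : vpi (k *: x) = k *: vpi x.
Proof. by rewrite vogel_pi.unlock; apply: qpiZ. Qed.

Lemma vogel_pi1 : vpi 1 = 1.
Proof. by rewrite vogel_pi.unlock. Qed.

Lemma vogel_pi_rel x y : vogel_rel alpha beta x y -> vpi x = vpi y.
Proof. by move=> xy; rewrite vogel_pi.unlock; apply/qpiP/ideal_rel. Qed.

Definition vogel_w (s : 'S_3) : V := vpi (vw F s).

Definition vogel_t (i j : 'I_3) : V :=
  if insub (i, j) is Some p
  then vpi (free_gen F (inr p : vogel_gen 3)) else 0.

Lemma vogel_tE i j (ij : i != j) : vogel_t i j = vpi (vt F ij).
Proof. by rewrite /vogel_t (@insubT _ (fun p : 'I_3 * 'I_3 => p.1 != p.2) _ (i, j) ij). Qed.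

Lemma vogel_alg_ind (U : V -> Prop) :
  U 0 -> (forall x y, U x -> U y -> U (x + y)) -> (forall k x, U x -> U (k *: x)) ->
  U 1 -> (forall s x, U x -> U (vogel_w s * x)) ->
  (forall i j, i != j -> forall x, U x -> U (vogel_t i j * x)) ->
  forall x, U x.
Proof.
move=> U0 UD UZ U1 Uw Ut x.
have [y ->] := qpi_surj x.
have -> : qpi (@vogel_rel F 3 alpha beta) y = vpi y by rewrite vogel_pi.unlock.
elim/ma_ind: y {x} => [|x y Ux Uy|k m].
- by rewrite -(scale0r 0) vogel_piZ scale0r.
- by rewrite vogel_piD; apply: UD.
have -> : (<< k *g m >> : free) = k *: ma_basis _ m.
  by rewrite ma_basis.unlock ma_scaleU mulr1.
rewrite vogel_piZ; apply: UZ.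
elim: m => [|x m Um]; first by rewrite [vpi _]vogel_pi1.
have -> : ma_basis F (x :: m : free_monoid (vogel_gen 3)) =
    free_gen F x * ma_basis F (m : free_monoid (vogel_gen 3)).
  rewrite /free_gen ma_basis.unlock.
  have := @ma_mulUU F (free_monoid (vogel_gen 3)) 1 1 [:: x] m.
  by rewrite mulr1 => <-.
rewrite vogel_piM; case: x => [s|[[i j] ij]]; first exact: Uw.
by rewrite -[free_gen _ _]/(vt F (ij : i != j)) -vogel_tE; apply: Ut.
Qed.

Lemma vogel_alg_model : vogel_model3 alpha beta vogel_w vogel_t.
Proof.
split.
- by rewrite /vogel_w (vogel_pi_rel (@vogel_1 _ _ _ _)) vogel_pi1.
- move=> s s'; rewrite -vogel_piM; apply/vogel_pi_rel/vogel_M.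
- move=> i j ij; have ji := ij; rewrite eq_sym in ji.
  by rewrite !vogel_tE; apply/vogel_pi_rel/vogel_sym.
- move=> s i j ij; have sij : s i != s j by rewrite (inj_eq (@perm_inj _ s)).
  by rewrite !vogel_tE -!vogel_piM; apply/vogel_pi_rel/vogel_conj.
- move=> i j k ij ik kj; rewrite !vogel_tE -!vogel_piD -!vogel_piM.
  exact/vogel_pi_rel/vogel_comm3.
- by move=> i j ij; rewrite !vogel_tE -!vogel_piM; apply/vogel_pi_rel/vogel_tr.
- by move=> i j ij; rewrite !vogel_tE -!vogel_piM; apply/vogel_pi_rel/vogel_tl.
- move=> i j ij; have := vogel_pi_rel (vogel_quad alpha beta ij).
  rewrite vogel_piD vogel_piB !vogel_piZ vogel_piD vogel_pi1 expr2 vogel_piM -vogel_tE => ->.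
  by rewrite -(scale0r 0) vogel_piZ scale0r.
Qed.

Lemma vogel_lift (K : fieldType) (phi : {rmorphism F -> K}) (B : algType K) w t :
    @vogel_model3 K B (phi alpha) (phi beta) w t ->
  exists g : V -> B, [/\ zmod_morphism g, monoid_morphism g,
    forall k x, g (k *: x) = phi k *: g x, forall s, g (vogel_w s) = w s &
    forall i j, i != j -> g (vogel_t i j) = t i j].
Proof.
case=> h1 h2 h3 h4 h5 h6 h7 h8.
pose v (x : vogel_gen 3) :=
  match x with inl s => w s | inr p => t (val p).1 (val p).2 end.
have [f [fZ fE]] := free_lift phi v.
have fw s : f (vw F s) = w s by apply: fE.
have ft i j (ij : i != j) : f (vt F ij) = t i j by apply: fE.
have fB := rmorphB f; have fD := rmorphD f; have fM := rmorphM f; have f1 := rmorph1 f.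
have frel x y : vogel_rel alpha beta x y -> f x = f y.
  case=> {x y} [|s s'|i j ij ji|s i j ij sij|i j r s ij rs ijrs|i j k ij ik kj
               |i j ij|i j ij|i j ij].
  - by rewrite fw h1 f1.
  - by rewrite fM !fw h2.
  - by rewrite !ft h3.
  - by rewrite 2!fM !fw !ft h4.
  - have := max_card (mem [:: i; j; r; s]).
    by rewrite card_ord (card_uniqP ijrs).
  - by rewrite 2!fM !fD !ft h5.
  - by rewrite fM fw ft h6.
  - by rewrite fM fw ft h7.
  - rewrite fD fB !fZ fD f1 fw expr2 fM ft rmorph0.
    by rewrite rmorphD rmorphM fmorphV rmorphM rmorph_nat h8.
have [g [gB gM gZ gE]] := quot_lift fZ frel.
exists g; split=> // [s|i j ij]; first by rewrite /vogel_w vogel_pi.unlock [LHS]gE.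
by rewrite vogel_tE vogel_pi.unlock [LHS]gE ft.
Qed.

End VogelLift.

Lemma blocks_bijective (K : fieldType) (A : algType K) (f : {lrmorphism A -> blocks K})
    (X : seq A) :
  size X = 20%N -> (forall a, in_span X a) ->
  (forall x y z M N L, exists a, f a = (x, y, z, M, N, L)) -> bijective f.
Proof.
move=> sX spanX surjf; have surj p : exists a, f a = p.
  by case: p => [[[[[x y] z] M] N] L]; apply: surjf.
apply: inj_surj_bij => //.
by apply: (span_surj_inj (P := blocks K) (X := X)) => //; rewrite sX dim_blocks.
Qed.

Lemma alg_isomorphic_common (K : fieldType) (A B C : algType K)
    (f : {lrmorphism A -> C}) (g : {lrmorphism B -> C}) :
  bijective f -> bijective g -> alg_isomorphic A B.
Proof.
move=> [f' fK f'K] [g' gK g'K].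
have fP k x y : f (k *: x + y) = k *: f x + f y by apply: linearP.
have gP k x y : g (k *: x + y) = k *: g x + g y by apply: linearP.
have fM x y : f (x * y) = f x * f y by apply: rmorphM.
have gM x y : g (x * y) = g x * g y by apply: rmorphM.
have f1 : f 1 = 1 by apply: rmorph1.
have g1 : g 1 = 1 by apply: rmorph1.
have g'fl : linear (g' \o f).
  by move=> k x y; apply: (can_inj gK); rewrite gP /= !g'K fP.
have g'fm : monoid_morphism (g' \o f).
  by split=> [|x y]; apply: (can_inj gK); rewrite ?gM /= !g'K ?f1 ?g1 ?fM.
pose lm := GRing.isLinear.Build _ _ _ _ _ g'fl.
pose mm := GRing.isMonoidMorphism.Build _ _ _ g'fm.
pose h : {lrmorphism A -> B} := HB.pack (g' \o f) lm mm.
exists h; exists (f' \o g) => x /=; first by rewrite g'K fK.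
by rewrite f'K gK.
Qed.

Section VogelBlocksIso.
Variables (F K : fieldType) (phi : {rmorphism F -> K}) (alpha beta : F).
Hypotheses (two_neq0 : 2 != 0 :> F) (three_neq0 : 3 != 0 :> F).
Hypotheses (alpha_neq0 : alpha != 0) (beta_neq0 : beta != 0).
Hypotheses (ab : alpha - beta != 0) (ab2 : alpha - 2 * beta != 0).
Hypothesis (a2b : 2 * alpha - beta != 0).
Local Notation V := (vogel_alg 3 alpha beta).

Lemma vogel_alg_span : exists2 X : seq V, size X = 20%N & forall x, in_span X x.
Proof.
have ab' : alpha != beta by rewrite -subr_eq0.
have [X [sX X1 Xw Xt]] := vogel_model_span (vogel_alg_model alpha beta) two_neq0 ab'.
exists X => //; apply: vogel_alg_ind => //.
- exact: in_span0.
- by move=> x y; apply: in_spanD.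
- by move=> k x; apply: in_spanZ.
- by move=> s x; apply: in_span_mull => y; apply: Xw.
- by move=> i j ij x; apply: in_span_mull => y; apply: Xt.
Qed.

Lemma vogel_alg_blocks : exists g : V -> blocks K,
  [/\ zmod_morphism g, monoid_morphism g, forall k x, g (k *: x) = phi k *: g x &
    forall S : K -> K -> K -> 'M[K]_2 -> 'M[K]_2 -> 'M[K]_3 -> Prop,
      block_subalgebra S -> (forall x, let: (x, y, z, M, N, L) := g x in S x y z M N L) ->
      forall x y z M N L, S x y z M N L].
Proof.
have nz (x : F) : x != 0 -> phi x != 0 by rewrite fmorph_eq0.
have two : 2 != 0 :> K by rewrite -(rmorph_nat phi) nz.
have three : 3 != 0 :> K by rewrite -(rmorph_nat phi) nz.
have pab : phi alpha - phi beta != 0 by rewrite -rmorphB nz.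
have pab2 : phi alpha - 2 * phi beta != 0.
  by rewrite -(rmorph_nat phi 2) -rmorphM -rmorphB nz.
have pa2b : 2 * phi alpha - phi beta != 0.
  by rewrite -(rmorph_nat phi 2) -rmorphM -rmorphB nz.
have [w [t [L2 [L3 [model ws1 tt1 ws2 [tt2 L200 L300 L20 L2i]]]]]] :=
  vogel_model_blocks two three pab pab2 pa2b.
have [g [gB gM gZ gw gt]] := vogel_lift model.
exists g; split=> // S HS Sg.
have surj := vogel_blocks_surj two three (nz _ alpha_neq0) (nz _ beta_neq0) pab pab2 pa2b HS.
apply: (surj L2 L3) => //.
- by have := Sg 1; rewrite gM.1.
- by have := Sg (vogel_w alpha beta (tperm i0 i1)); rewrite gw ws1.
- by have := Sg (vogel_t alpha beta i0 i1); rewrite gt // tt1.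
- by have := Sg (vogel_w alpha beta (tperm i1 i2)); rewrite gw ws2.
- by have := Sg (vogel_t alpha beta i1 i2); rewrite gt // tt2.
Qed.

End VogelBlocksIso.

Section VogelIso.
Variables (F : fieldType) (alpha beta : F).
Hypotheses (two_neq0 : 2 != 0 :> F) (three_neq0 : 3 != 0 :> F).
Hypotheses (alpha_neq0 : alpha != 0) (beta_neq0 : beta != 0).
Hypotheses (ab : alpha - beta != 0) (ab2 : alpha - 2 * beta != 0).
Hypothesis (a2b : 2 * alpha - beta != 0).
Local Notation V := (vogel_alg 3 alpha beta).
Local Notation K := (laurent_series F).

Lemma vogel_alg_dimension : has_dimension V 20.
Proof.
have [X sX spanX] := vogel_alg_span two_neq0 ab.
have [g [gB gM gZ gS]] := vogel_alg_blocks (idfun : {rmorphism F -> F}) two_neq0 three_neq0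
  alpha_neq0 beta_neq0 ab ab2 a2b.
have gD x y : g (x + y) = g x + g y.
  have g0 : g 0 = 0 by rewrite -(subrr 0) gB subrr.
  by rewrite -{1}[y]opprK gB -[- y]sub0r gB g0 sub0r opprK.
have gl : linear g by move=> k x y; rewrite gD gZ.
pose lm := GRing.isLinear.Build _ _ _ _ _ gl.
pose mm := GRing.isMonoidMorphism.Build _ _ _ gM.
pose f : {lrmorphism V -> blocks F} := HB.pack g lm mm.
have [f' fK f'K] : bijective f.
  apply: (blocks_bijective sX spanX); apply: (gS _ (block_subalgebra_image f)).
  by move=> x; case E : (g x) => [[[[[x1 y1] z1] M1] N1] L1]; exists x.
have v2r_bij : bijective (fun p : blocks F => v2r p).
  by exists r2v; [apply: v2rK | apply: r2vK].
have : exists h : {linear V -> 'rV[F]_(dim (blocks F))}, bijective h.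
  have hl : linear (fun x : V => v2r (g x : blocks F)).
    by move=> k x y; rewrite gl linearP.
  pose hm := GRing.isLinear.Build _ _ _ _ _ hl.
  pose h : {linear V -> 'rV[F]_(dim (blocks F))} := 
    HB.pack (fun x : V => v2r (g x : blocks F)) hm.
  by exists h; apply: (bij_comp v2r_bij); exists f'.
by rewrite dim_blocks.
Qed.

Lemma vogel_ext_blocks : exists f : {lrmorphism vogel_ext alpha beta 3 -> blocks K}, bijective f.
Proof.
have [X sX spanX] := vogel_alg_span two_neq0 ab.
have [g [gB gM gZ gS]] := vogel_alg_blocks (@laurent_const F) two_neq0 three_neq0
  alpha_neq0 beta_neq0 ab ab2 a2b.
have [k [kL kM kE]] := @ext_scalars_lift _ _ (@laurent_const F) V _ g gB gM gZ.
pose kLm := GRing.isLinear.Build _ _ _ _ (k : vogel_ext alpha beta 3 -> blocks K) kL.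
pose kMm := GRing.isMonoidMorphism.Build (vogel_ext alpha beta 3) (blocks K) k kM.
pose f : {lrmorphism _ -> _} := HB.pack (k : vogel_ext alpha beta 3 -> blocks K) kLm kMm.
have [iota [iotaD iotaZ iotaT fiota]] : exists iota : V -> vogel_ext alpha beta 3,
    [/\ forall x y, iota (x + y) = iota x + iota y,
      forall c x, iota (c *: x) = laurent_const c *: iota x,
      forall x l, tensor (@laurent_const F) x l = l *: iota x &
      forall x, f (iota x) = g x].
  exists (fun x => tensor (@laurent_const F) x 1); split=> [x y|c x|x l|x].
  - exact: tensorDl.
  - by rewrite [LHS]tensorZ [RHS]scale_tensor.
  - by rewrite [RHS]scale_tensor mulr1.
  - by rewrite [LHS]kE scale1r.
exists f.
have iota0 : iota 0 = 0 by apply: (addIr (iota 0)); rewrite -iotaD !add0r.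
have spanX' x : in_span (map iota X) (iota x).
  have [c ->] := spanX x; apply: (big_ind (fun y => in_span (map iota X) (iota y))).
  - by rewrite iota0; apply: in_span0.
  - by move=> y z Xy Xz; rewrite iotaD; apply: in_spanD.
  - by move=> i _; rewrite iotaZ; apply/in_spanZ/mem_in_span/map_f/mem_nth.
apply: (@blocks_bijective _ _ f (map iota X)); first by rewrite size_map.
- apply: (@tensor_ind _ _ (@laurent_const F) V).
  + exact: in_span0.
  + by move=> u v; apply: in_spanD.
  + by move=> x l; rewrite iotaT; apply: in_spanZ.
- apply: (gS _ (block_subalgebra_image f)).
  move=> x; case E : (g x) => [[[[[x1 y1] z1] M1] N1] L1]; exists (iota x).
  by rewrite fiota.
Qed.

End VogelIso.

(** * The specialization to Laurent series *)

Section FirstOrderJets.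
Variable F : fieldType.
Implicit Types u v : laurent_series F.

(* u = x + y h modulo h^2. *)
Definition jet u (x y : F) : Prop := [/\ vanishes_below 0 u, u 0 = x & u 1 = y].

Lemma jetD u v x y x' y' : jet u x y -> jet v x' y' -> jet (u + v) (x + x') (y + y').
Proof.
move=> [u0 ux uy] [v0 vx vy]; split; rewrite ?lcoefD ?ux ?uy ?vx ?vy //.
by move=> n n0; rewrite lcoefD u0 ?v0 ?addr0.
Qed.

Lemma jet_const k : jet (laurent_const k) k 0.
Proof. by split=> //; apply: laurent_const_vanish. Qed.

Lemma jetM u v x y x' y' : jet u x y -> jet v x' y' -> jet (u * v) (x * x') (x * y' + y * x').
Proof.
move=> [u0 <- <-] [v0 <- <-].
have E := laurent_conv_tail u0 v0; rewrite addr0 in E.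
have Ek (k : nat) : (u * v) k%:Z = ps_conv (tail 0 u) (tail 0 v) k.
  by rewrite -E /tail add0r.
split.
- by have := laurent_conv_vanish u0 v0; rewrite addr0.
- by rewrite [LHS](Ek 0%N) /ps_conv big_ord1.
- by rewrite [LHS](Ek 1%N) /ps_conv !big_ord_recl big_ord0 addr0.
Qed.

Lemma jetN u x y : jet u x y -> jet (- u) (- x) (- y).
Proof.
move=> uxy; have := jetM (jet_const (-1)) uxy.
by rewrite rmorphN rmorph1 !mulN1r mul0r addr0.
Qed.

Lemma jet_exp k : jet (laurent_exp k) 1 k.
Proof. by split=> [[]| |] //=; rewrite ?expr0 ?expr1 !divr1. Qed.

Lemma jet_neq0 u x y : jet u x y -> (x != 0) || (y != 0) -> u != 0.
Proof.
move=> [_ ux uy]; apply: contraTneq => u0; move: ux uy; rewrite u0 => <- <-.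
by rewrite negb_or !negbK; apply/andP; split; apply/eqP.
Qed.

End FirstOrderJets.

Section Q3Iso.
Variables (F : numFieldType) (alpha beta : F).
Hypotheses (ab : alpha - beta != 0) (ab2 : alpha - 2 * beta != 0).
Hypothesis (a2b : 2 * alpha - beta != 0).
Local Notation K := (laurent_series F).
Local Notation b := (laurent_exp alpha).
Local Notation c := (laurent_exp beta).

Lemma Q3_ext_blocks : exists f : {lrmorphism Q3_ext alpha beta -> blocks K}, bijective f.
Proof.
have pos := (@ltr01 F, @addr_gt0 F, @mulr_gt0 F).
have jb := jet_exp alpha; have jc := jet_exp beta.
have j1 := jet_const (1 : F); rewrite rmorph1 in j1.
have b0 := laurent_exp_neq0 alpha; have c0 := laurent_exp_neq0 beta.
have b1 : b + 1 != 0 by apply: (jet_neq0 (jetD jb j1)); rewrite lt0r_neq0 ?pos.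
have c1 : c + 1 != 0 by apply: (jet_neq0 (jetD jc j1)); rewrite lt0r_neq0 ?pos.
have bc : b - c != 0 by apply: (jet_neq0 (jetD jb (jetN jc))); rewrite ab orbT.
have b2 : b ^+ 2 + b + 1 != 0.
  by apply: (jet_neq0 (jetD (jetD (jetM jb jb) jb) j1)); rewrite lt0r_neq0 ?pos.
have c2 : c ^+ 2 + c + 1 != 0.
  by apply: (jet_neq0 (jetD (jetD (jetM jc jc) jc) j1)); rewrite lt0r_neq0 ?pos.
have bc2 : b * c + b + c != 0.
  by apply: (jet_neq0 (jetD (jetD (jetM jb jc) jb) jc)); rewrite lt0r_neq0 ?pos.
have bc3 : b * c * (b + c) + (b + 1) * (c + 1) != 0.
  apply: (jet_neq0 (jetD (jetM (jetM jb jc) (jetD jb jc)) (jetM (jetD jb j1) (jetD jc j1)))).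
  by rewrite lt0r_neq0 ?pos.
have cb : c ^+ 2 - b != 0.
  apply: (jet_neq0 (jetD (jetM jc jc) (jetN jb))).
  rewrite !mul1r !mulr1 -[beta + beta]mulr2n -mulr_natl.
  by rewrite -[_ * beta - _]opprB oppr_eq0 ab2 orbT.
have bb : b ^+ 2 - c != 0.
  apply: (jet_neq0 (jetD (jetM jb jb) (jetN jc))).
  rewrite !mul1r !mulr1 -[alpha + alpha]mulr2n -mulr_natl.
  by rewrite a2b orbT.
have bc1 : 1 + b * c != 0.
  by apply: (jet_neq0 (jetD j1 (jetM jb jc))); rewrite lt0r_neq0 ?pos.
have [s1 [s1V [s2 [s2V [model s1E s2E]]]]] := Q3_model_blocks b0 c0 b1 c1 bc.
have [f [fs1 fs2]] := Q3_ext_lift model.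
have [X [sX X1 Xs]] := Q3_model_span (Q3_ext_model alpha beta) b0 c0 b1 c1 bc.
have mem4 (T : eqType) (x y z t : T) (l := [:: x; y; z; t]) :
    [/\ x \in l, y \in l, z \in l & t \in l] by split; rewrite !inE eqxx ?orbT.
have spanX u : in_span X u.
  have [m1 m1V m2 m2V] := mem4 _ (Q3_ext_of alpha beta sigma1)
    (Q3_ext_of alpha beta sigma1^-1%g) (Q3_ext_of alpha beta sigma2)
    (Q3_ext_of alpha beta sigma2^-1%g).
  have gm (i : 'I_3.-1) : Q3_ext_of alpha beta (braid_gen i) \in
      [:: Q3_ext_of alpha beta sigma1; Q3_ext_of alpha beta sigma1^-1%g;
          Q3_ext_of alpha beta sigma2; Q3_ext_of alpha beta sigma2^-1%g] /\
      Q3_ext_of alpha beta (braid_gen i)^-1%g \in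
      [:: Q3_ext_of alpha beta sigma1; Q3_ext_of alpha beta sigma1^-1%g;
          Q3_ext_of alpha beta sigma2; Q3_ext_of alpha beta sigma2^-1%g].
    have [-> | ->] : i = ord0 \/ i = ord_max.
      by case: i => [[|[|//]] i]; [left | right]; apply/val_inj.
    - by split; [exact: m1 | exact: m1V].
    - by split; [exact: m2 | exact: m2V].
  elim/Q3_ext_ind: u => [|u v|k u||i u|i u].
  - exact: in_span0.
  - exact: in_spanD.
  - exact: in_spanZ.
  - exact: X1.
  - apply: in_span_mull => x; exact: (Xs _ (gm i).1).
  - apply: in_span_mull => x; exact: (Xs _ (gm i).2).
exists f; apply: (blocks_bijective sX spanX).
apply: (Q3_blocks_surj b0 c0 b1 c1 bc b2 c2 bc2 bc3 cb bb bc1 (block_subalgebra_image f)).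
- by exists 1; apply: rmorph1.
- by rewrite -s1E; exists (Q3_ext_of alpha beta sigma1).
- by rewrite -s2E; exists (Q3_ext_of alpha beta sigma2).
Qed.

Lemma Q3_ext_vogel_ext : alpha != 0 -> beta != 0 ->
  alg_isomorphic (Q3_ext alpha beta) (vogel_ext alpha beta 3).
Proof.
move=> alpha0 beta0.
have two : 2 != 0 :> F by rewrite pnatr_eq0.
have three : 3 != 0 :> F by rewrite pnatr_eq0.
have [f fb] := Q3_ext_blocks.
have [g gb] := vogel_ext_blocks two three alpha0 beta0 ab ab2 a2b.
exact: alg_isomorphic_common fb gb.
Qed.

End Q3Iso.

Theorem mainTheorem13 (R : realType) (alpha beta : R[i]%C) :
  alpha != 0 -> beta != 0 -> alpha != beta ->
  alpha * beta / 2 != ((alpha + beta) / 3) ^+ 2 ->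
  has_dimension (vogel_alg 3 alpha beta) 20 /\
  alg_isomorphic (Q3_ext alpha beta) (vogel_ext alpha beta 3).
Proof.
move=> alpha0 beta0; rewrite -subr_eq0 => ab disc.
have two : 2 != 0 :> R[i]%C by rewrite pnatr_eq0.
have three : 3 != 0 :> R[i]%C by rewrite pnatr_eq0.
have discE (x y : R[i]%C) : (x - 2 * y = 0) -> x * y / 2 = ((x + y) / 3) ^+ 2.
  by move/eqP; rewrite subr_eq0 => /eqP ->; field.
have ab2 : alpha - 2 * beta != 0 by apply: contraNneq disc => /discE ->.
have a2b : 2 * alpha - beta != 0.
  apply: contraNneq disc => E; rewrite [alpha * beta]mulrC [alpha + beta]addrC.
  by rewrite discE // -opprB E oppr0.
split; first exact: vogel_alg_dimension.
exact: Q3_ext_vogel_ext.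
Qed.
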